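(* Let $m=n$ and suppose $G\in C^4(\mathrm{cl}(X\times Y\times Z))$ (together with $\pi$) satisfies the regularity, twist, convex range, price monotonicity, outside option, non-degeneracy, dual twist and dual convex range conditions written out under these names in the context. Then the following statements are equivalent: (i) For each $x,x_0\in X$, $t\in[0,1]\mapsto G(x,y_t,z_t)$ is convex along every $G$-segment $t\mapsto(x_0,y_t,z_t)$. (ii) For any given $x_0,x_1\in X$, any curve $t\in[0,1]\mapsto(y_t,z_t)\in \mathrm{cl}(Y\times Z)$ connecting $(y_0,z_0)$ and $(y_1,z_1)$, and any curve $s\in[0,1]\mapsto x_s\in X$ connecting $x_0$ and $x_1$, we have $$\frac{\partial^2}{\partial s^2}\left(\frac{1}{G_z(x_s,y_t,z_t)}\frac{\partial^2}{\partial t^2}G(x_s,y_t,z_t)\right)\bigg|_{t=t_0}\le 0$$ whenever $s\in[0,1]\mapsto\frac{G_y}{G_z}(x_s,y_{t_0},z_{t_0})$ forms an affinely parametrized line segment for some $t_0\in[0,1]$. (iii) For any given curve $s\in[0,1]\mapsto x_s\in X$ connecting $x_0$ and $x_1$, any $(y_0,z_0),(y_1,z_1)\in \mathrm{cl}(Y\times Z)$, and any curve $t\in[0,1]\mapsto(y_t,z_t)\in \mathrm{cl}(Y\times Z)$ connecting them, we have $$\frac{\partial^2}{\partial s^2}\left(\frac{1}{G_z(x_s,y_t,z_t)}\frac{\partial^2}{\partial t^2}G(x_s,y_t,z_t)\right)\bigg|_{s=s_0}\le 0$$ whenever $t\in[0,1]\mapsto(G_x,G)(x_{s_0},y_t,z_t)$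 forms an affinely parametrized line segment for some $s_0\in[0,1]$.
   Context: Setting. $m=n$; $X\subset\mathbb{R}^n$, $Y\subset\mathbb{R}^n$; $Z=(\underline z,\bar z)$; $\mathrm{cl}$ denotes closure in Euclidean space. Subscripts denote partial derivatives: $G_x=(\partial G/\partial x^i)_i$, $G_y=(\partial G/\partial y^k)_k$, $G_z=\partial G/\partial z$. Curves $x_s$ and $(y_t,z_t)$ are smooth enough (twice differentiable) for the displayed derivatives to make sense. The inequality in (ii) is asserted for all $s\in[0,1]$, that in (iii) for all $t\in[0,1]$. Regularity: $G\in C^1(\mathrm{cl}(X\times Y\times Z))$, where $X$, $Y$ are open and bounded and $Z=(\underline z,\bar z)$ with $-\infty<\underline z<\bar z\le+\infty$. Twist: For each $x\in X$, the map $(y,z)\in \mathrm{cl}(Y\times Z)\mapsto (G_x,G)(x,y,z)\in\mathbb{R}^{m+1}$ is a homeomorphism onto its range. Convex range: For each $x\in X$, the range $(G_x,G)(x,\mathrm{cl}(Y\times Z))$ is convex. $G$-segments: for $x_0\in X$ and $(y_0,z_0),(y_1,z_1)\in \mathrm{cl}(Y\times Z)$, let $(y_t,z_t)\in \mathrm{cl}(Y\times Z)$ be the unique solution of $(G_x,G)(x_0,y_t,z_t)=(1-t)(G_x,G)(x_0,y_0,z_0)+t(G_x,G)(x_0,y_1,z_1)$, $t\in[0,1]$. The curve $t\mapsto(x_0,y_t,z_t)$ is the $G$-segment connecting $(x_0,y_0,z_0)$ and $(x_0,y_1,z_1)$. Price monotonicity: $G_z(x,y,z)<0$ for each $(x,y,z)\in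 X\times \mathrm{cl}(Y)\times \mathrm{cl}(Z)$. Outside option: $\pi\in C^0(\mathrm{cl}(X\times Y\times Z))$ and $u_\emptyset(x):=G(x,y_\emptyset,z_\emptyset)$ for some fixed $(y_\emptyset,z_\emptyset)\in \mathrm{cl}(Y\times Z)$ satisfying $G(x,y,\bar z):=\lim_{z\to\bar z}G(x,y,z)\le G(x,y_\emptyset,z_\emptyset)$ for all $(x,y)\in X\times \mathrm{cl}(Y)$. When $\bar z=+\infty$ this inequality is assumed strict, and moreover for all sufficiently large $z$, $G(x,y,z)<G(x,y_\emptyset,z_\emptyset)$ for all $(x,y)\in X\times \mathrm{cl}(Y)$. Non-degeneracy: $G\in C^2(\mathrm{cl}(X\times Y\times Z))$ and, with $\bar G(\bar x,\bar y)=\bar G(x,x_0,y,z):=x_0G(x,y,z)$ where $\bar x=(x,x_0)$, $\bar y=(y,z)$, $x_0\in X_0$ and $X_0\subset(-\infty,0)$ is a bounded open interval containing $-1$, the $(m+1)\times(n+1)$ matrix $D_{\bar x,\bar y}\bar G(x,-1,y,z)$ has full rank for each $(x,y,z)\in \mathrm{cl}(X\times Y\times Z)$. Dual twist: For each $(y,z)\in \mathrm{cl}(Y\times Z)$ the map $x\in X\mapsto\frac{G_y}{G_z}(x,y,z)\in\mathbb{R}^n$ is one-to-one. Dual convex range: For each $(y,z)\in \mathrm{cl}(Y\times Z)$ the range $\frac{G_y}{G_z}(X,y,z)\subset\mathbb{R}^n$ is convex. *)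

(* Defs.v *)
From HB Require Import structures.
From mathcomp Require Import all_boot all_order all_algebra.
From mathcomp Require Import all_classical all_reals all_analysis.
Set Implicit Arguments.
Unset Strict Implicit.
Unset Printing Implicit Defensive.
Import Order.TTheory GRing.Theory Num.Theory.
Import numFieldNormedType.Exports.
Local Open Scope classical_set_scope.
Local Open Scope ring_scope.

Section calculus.
Context {R : realType}.

(** [C_cl k U f], for an open set [U], is [f \in C^k(cl U)]: all derivatives
    of [f] on [U] up to order [k] extend continuously to [cl U], and for [f] and
    its derivatives of order [< k] the extended derivatives are a differential
    relatively to [cl U] at every point of [cl U].  The latter is automatic when
    [U] is locally quasiconvex (e.g. Lipschitz) or when [f] extends to a [C^k]
    function around [cl U].  For an arbitrary open [U] it is what makes the
    chain rule hold along curves in [cl U] that meet the boundary: if [U] is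
    ]0, 1[ minus the Cantor set, then the derivative of the Cantor function on
    [U] extends continuously by 0.  Only the values of [f] on [cl U] matter. *)
Fixpoint C_cl (k : nat) (V : normedModType R) (U : set V) (f : V -> R) : Prop :=
  match k with
  | 0 => {within closure U, continuous f}
  | k'.+1 => {within closure U, continuous f} /\
      exists Df : V -> V -> R,
        [/\ forall p, U p -> differentiable f p /\ forall v, 'D_v f p = Df v p,
            forall p, closure U p -> forall q,
              f q = f p + Df (q - p) p
                    +o_(q \near within (closure U) (nbhs p)) (q - p)
          & forall v, C_cl k' U (Df v)]
  end.

(** Derivative in direction [v], extended by continuity from [U] to [cl U]. *)
Definition D_cl (V : normedModType R) (U : set V) (v : V) (f : V -> R) (p : V) : R :=
  lim ('D_v f q @[q --> within U (nbhs p)]).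

Definition homeo_onto_range (S T : topologicalType) (A : set S) (F : S -> T) :=
  {within A, continuous F} /\
  exists2 F' : T -> S,
    {within F @` A, continuous F'} & forall a, A a -> F' (F a) = a.

(** Derivatives of functions on [0, 1] (one-sided at the endpoints); the values
    outside [0, 1] are irrelevant. *)
Definition slope (V : normedModType R) (g : R -> V) (s r : R) : V :=
  (r - s)^-1 *: (g r - g s).

Definition derivable01 (V : normedModType R) (g : R -> V) (s : R) :=
  cvg (slope g s r @[r --> within `[0, 1]%classic s^']).

Definition D01 (V : normedModType R) (g : R -> V) (s : R) : V :=
  lim (slope g s r @[r --> within `[0, 1]%classic s^']).

Definition twice_derivable01 (V : normedModType R) (g : R -> V) :=
  forall s, s \in `[0, 1] -> derivable01 g s /\ derivable01 (D01 g) s.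

Definition affine01 (V : normedModType R) (g : R -> V) :=
  forall s, s \in `[0, 1] -> g s = (1 - s) *: g 0 + s *: g 1.

(** A curve in [A], parametrized by [0, 1], connecting [a] and [b]. *)
Definition curve (V : normedModType R) (A : set V) (a b : V) (g : R -> V) :=
  [/\ twice_derivable01 g, forall s, s \in `[0, 1] -> A (g s), g 0 = a & g 1 = b].

End calculus.

Section model.
Context {R : realType} {n : nat}.
Variables (X Y : set 'rV[R]_n) (zl : R) (zu : \bar R).
Variable G : 'rV[R]_n * ('rV[R]_n * R) -> R.

Definition Zset : set R := [set z | zl < z /\ (z%:E < zu)%E].

Definition YZ : set ('rV[R]_n * R) := Y `*` Zset.

Definition XYZ : set ('rV[R]_n * ('rV[R]_n * R)) := X `*` YZ.

Definition e_ (i : 'I_n) : 'rV[R]_n := delta_mx 0 i.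

Definition Gx (x : 'rV[R]_n) (p : 'rV[R]_n * R) : 'rV[R]_n :=
  \row_i D_cl XYZ (e_ i, 0) G (x, p).

Definition Gy (x : 'rV[R]_n) (p : 'rV[R]_n * R) : 'rV[R]_n :=
  \row_k D_cl XYZ (0, (e_ k, 0)) G (x, p).

Definition Gz (x : 'rV[R]_n) (p : 'rV[R]_n * R) : R :=
  D_cl XYZ (0, (0, 1)) G (x, p).

Definition Gx_G (x : 'rV[R]_n) (p : 'rV[R]_n * R) : 'rV[R]_n * R :=
  (Gx x p, G (x, p)).

Definition Gy_Gz (x : 'rV[R]_n) (p : 'rV[R]_n * R) : 'rV[R]_n :=
  (Gz x p)^-1 *: Gy x p.

Definition regularity :=
  [/\ open X /\ bounded_set X, open Y /\ bounded_set Y, (zl%:E < zu)%E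
    & C_cl 1 XYZ G].

Definition twist :=
  forall x, X x -> homeo_onto_range (closure YZ) (Gx_G x).

Definition convex_range :=
  forall x, X x -> convex_set (Gx_G x @` closure YZ).

Definition price_monotonicity :=
  forall x y z, X x -> closure Y y -> closure Zset z -> Gz x (y, z) < 0.

(** [G (x, y, \bar z)], the limit of [G (x, y, z)] as [z] tends to [zu]. *)
Definition G_zu (x y : 'rV[R]_n) : \bar R :=
  lim ((G (x, (y, z)))%:E @[z --> if zu is r%:E then r^'- else +oo]).

(** [p0] is the pair (y_0, z_0) defining the outside option
    [u_0 (x) := G (x, y_0, z_0)]. *)
Definition outside_option (pi : 'rV[R]_n * ('rV[R]_n * R) -> R)
    (p0 : 'rV[R]_n * R) :=
  [/\ C_cl 0 XYZ pi,
      closure YZ p0,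
      forall x y, X x -> closure Y y -> (G_zu x y <= (G (x, p0))%:E)%E
    & zu = +oo%E ->
      (forall x y, X x -> closure Y y -> (G_zu x y < (G (x, p0))%:E)%E) /\
      \forall z \near +oo,
        forall x y, X x -> closure Y y -> G (x, (y, z)) < G (x, p0)].

Definition Gbar (q : ('rV[R]_n * R) * ('rV[R]_n * R)) : R :=
  q.1.2 * G (q.1.1, q.2).

(** The standard basis of R^n x R. *)
Definition ebar_ (i : 'I_(n + 1)) : 'rV[R]_n * R :=
  match fintype.split i with inl j => (e_ j, 0) | inr _ => (0, 1) end.

(** The mixed second derivatives of [Gbar]; the open set on which [Gbar] is
    differentiated is (X x X0) x (Y x Z). *)
Definition D2Gbar (X0 : set R) (q : ('rV[R]_n * R) * ('rV[R]_n * R)) :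
    'M[R]_(n + 1, n + 1) :=
  let W := (X `*` X0) `*` YZ in
  \matrix_(i, k) D_cl W (0, ebar_ k) (D_cl W (ebar_ i, 0) Gbar) q.

Definition nondegeneracy (X0 : set R) :=
  C_cl 2 XYZ G /\
  forall x y z, closure XYZ (x, (y, z)) ->
    \rank (D2Gbar X0 ((x, -1), (y, z))) = (n + 1)%N.

Definition dual_twist :=
  forall p, closure YZ p -> {in X &, injective (fun x => Gy_Gz x p)}.

Definition dual_convex_range :=
  forall p, closure YZ p -> convex_set ((fun x => Gy_Gz x p) @` X).

(** [g] is the G-segment [t |-> (y_t, z_t)], based at [x0], connecting
    [(x0, p0)] and [(x0, p1)]. *)
Definition G_segment (x0 : 'rV[R]_n) (p0 p1 : 'rV[R]_n * R)
    (g : R -> 'rV[R]_n * R) :=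
  forall t, t \in `[0, 1] ->
    closure YZ (g t) /\
    Gx_G x0 (g t) = (1 - t) *: Gx_G x0 p0 + t *: Gx_G x0 p1.

(** [s, t |-> (1 / G_z) \partial_t^2 G] at [(x_s, y_t, z_t)]. *)
Definition GttGz (x : R -> 'rV[R]_n) (p : R -> 'rV[R]_n * R) (s t : R) : R :=
  (Gz (x s) (p t))^-1 * D01 (D01 (fun t' => G (x s, p t'))) t.

Definition convex_along_G_segments :=
  forall x x0, X x -> X x0 ->
  forall p0 p1, closure YZ p0 -> closure YZ p1 ->
  forall g, G_segment x0 p0 p1 g ->
    convex_function (E := R^o) `[0, 1]%classic (fun t => G (x, g t)).

Definition cross_diff_dual_segment :=
  forall x0 x1, X x0 -> X x1 ->
  forall p0 p1 p, curve (closure YZ) p0 p1 p ->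
  forall x, curve X x0 x1 x ->
  forall t0, t0 \in `[0, 1] ->
    affine01 (fun s => Gy_Gz (x s) (p t0)) ->
  forall s, s \in `[0, 1] -> D01 (D01 (fun s' => GttGz x p s' t0)) s <= 0.

Definition cross_diff_G_segment :=
  forall x0 x1 x, curve X x0 x1 x ->
  forall p0 p1, closure YZ p0 -> closure YZ p1 ->
  forall p, curve (closure YZ) p0 p1 p ->
  forall s0, s0 \in `[0, 1] ->
    affine01 (fun t => Gx_G (x s0) (p t)) ->
  forall t, t \in `[0, 1] -> D01 (D01 (fun s' => GttGz x p s' t)) s0 <= 0.

End model.

(* Main.v *)
From HB Require Import structures.
Require Import Defs.
From mathcomp Require Import all_boot all_order all_algebra.
From mathcomp Require Import ring lra.
From mathcomp Require Import all_classical all_reals all_analysis.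
Set Implicit Arguments.
Unset Strict Implicit.
Unset Printing Implicit Defensive.
Import Order.TTheory GRing.Theory Num.Theory.
Import numFieldNormedType.Exports.
Local Open Scope classical_set_scope.
Local Open Scope ring_scope.

(** Fix [x], [p = (y, z)] and velocities [u] of a curve in [X], [v] of a curve in
    [cl (Y x Z)].  If the second curve is a G-segment at [x], then its acceleration
    is determined by [v], both [G_tt] and its first derivative in [s] vanish at
    [x], and the quantity in (iii) equals [G_ttss / G_z].  If instead the first
    curve is a dual segment, then changing the acceleration of the second curve
    changes [G_tt / G_z] by an affine function of [s], so the quantity in (ii) is
    the same tensor.  Hence (ii) and (iii) both say that this tensor has a sign.
    Given (i), [G_tt / G_z] is nonpositive and vanishes to second order at [x],
    which gives the sign; conversely, the sign makes [G_tt / G_z] concave in [s]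
    along the dual segment from [x0] to [x], and it vanishes with its derivative
    at [x0], so that [G_tt >= 0] at [x].

    Segments through an arbitrary point exist only when the point is interior: they
    come from the contraction principle applied to [(G_x, G)(x, .)] and to
    [(G_y / G_z)(., y, z)], whose differentials are invertible by non-degeneracy.
    The tensor inequality extends to the boundary by continuity. *)

(** * One-sided derivatives on the unit interval *)

Section isD.

(** Three points shape the details. [D01] is a [lim], which has a value even when the slopes
    diverge, so a bound on a displayed derivative means something only once that derivative is shown
    to exist; every curve built below is therefore proved twice differentiable on all of [0, 1]. As
    second derivatives of curves need not be continuous, the sign arguments use the mean value
    theorem rather than Taylor expansions.

    The twist condition contains a continuous inverse, which makes G-segments continuous at once;
    dual twist is mere injectivity, and the continuity of dual segments is recovered from local
    surjectivity. In both cases the first derivative comes from the invertible differential, and the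
    second from differentiating the equation saying that this differential, applied to the velocity,
    is constant.

    A germ of a segment realises a prescribed direction only up to a positive factor. This is
    harmless: the tensor is quadratic in each velocity once the acceleration is rescaled by the
    square. Finally, (iii) returns to (i) through (ii), because convexity is tested at an arbitrary
    [x], which a dual segment joins to the base point. *)

Lemma cvg_near_eq T (U : topologicalType) (F : set_system T) {FF : Filter F}
    (f g : T -> U) (l : U) :
  f x @[x --> F] --> l -> (\forall x \near F, f x = g x) -> g x @[x --> F] --> l.
Proof.
move=> h fg; apply: cvg_trans h; apply: near_eq_cvg.
by apply: filterS fg => x ->.
Qed.

Context {R : realType}.
Implicit Types (V W : normedModType R) (s : R).

Definition nb01 s : set_system R := within `[0, 1]%classic s^'.

(** Convergence is recorded together with the limit. All rules of calculus are proved for [isD] and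
    carried over to [D01] by [isD_D01]. *)
Definition isD V (g : R -> V) s (l : V) := slope g s r @[r --> nb01 s] --> l.

Global Instance nb01_filter s : Filter (nb01 s).
Proof. exact: within_filter. Qed.

(** Properness gives uniqueness of limits, which is why [s] is kept in [0, 1] throughout. A nearby
    point is found to the right of [s] if [s < 1], and to the left otherwise. *)
Lemma nb01_proper s : s \in `[0, 1] -> ProperFilter (nb01 s).
Proof.
rewrite in_itv /= => /andP[s0 s1]; split; last exact: nb01_filter.
rewrite /nb01 /dnbhs /within /= => /nbhs_ballP[e /= e0 sub].
case: (ltP s 1) => [ls|ge1].
- pose d := Num.min (e / 2) (1 - s).
  have d0 : 0 < d by rewrite lt_min divr_gt0//= subr_gt0.
  have de : d <= e / 2 by rewrite ge_min lexx.
  have d1 : d <= 1 - s by rewrite ge_min lexx orbT.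
  apply: (sub (s + d)); rewrite /ball /=.
  + by rewrite opprD addrA subrr sub0r normrN gtr0_norm//; lra.
  + by apply/eqP; lra.
  + by rewrite in_itv /=; lra.
- pose d := Num.min (e / 2) 1.
  have d0 : 0 < d by rewrite lt_min divr_gt0//=.
  have de : d <= e / 2 by rewrite ge_min lexx.
  have d1 : d <= 1 by rewrite ge_min lexx orbT.
  apply: (sub (s - d)); rewrite /ball /=.
  + by rewrite opprB addrC subrK gtr0_norm//; lra.
  + by apply/eqP; lra.
  + by rewrite in_itv /=; lra.
Qed.

Lemma near_nb01 s : \forall r \near nb01 s, r \in `[0, 1] /\ r != s.
Proof.
have : nbhs s [set r | r != s -> r \in `[0, 1] -> r \in `[0, 1] /\ r != s].
  by apply: filterE => r.
by [].
Qed.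

Lemma near_nb01E s (P : R -> Prop) : (\forall r \near nb01 s, P r) <->
  (\forall r \near s, r != s -> r \in `[0, 1] -> P r).
Proof. by []. Qed.

Lemma near_within_nbhsE (T : topologicalType) (A : set T) (p : T) (P : T -> Prop) :
  (\forall r \near within A (nbhs p), P r) <-> (\forall r \near p, A r -> P r).
Proof. by []. Qed.

Lemma isD_D01 V (g : R -> V) s l : s \in `[0, 1] -> isD g s l -> D01 g s = l.
Proof.
move=> si h; have := nb01_proper si => P.
exact: (@cvg_lim V (@norm_hausdorff _ _) _ _ P).
Qed.

Lemma isD_derivable01 V (g : R -> V) s l : isD g s l -> derivable01 g s.
Proof. by move=> h; apply/cvg_ex; exists l. Qed.

Lemma isD_uniq V (g : R -> V) s l l' : s \in `[0, 1] ->
  isD g s l -> isD g s l' -> l = l'.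
Proof. by move=> si h h'; rewrite -(isD_D01 si h) (isD_D01 si h'). Qed.

Lemma isD_eq V (f g : R -> V) s l : s \in `[0, 1] ->
  (forall r, r \in `[0, 1] -> f r = g r) -> isD f s l -> isD g s l.
Proof.
rewrite /isD => si fg h; apply: (cvg_near_eq h).
near=> r; have [ri _] : r \in `[0, 1] /\ r != s by near: r; exact: near_nb01.
by rewrite /slope !fg.
Unshelve. all: by end_near. Qed.

Lemma eq_D01 V (f g : R -> V) s l : s \in `[0, 1] ->
  (forall r, r \in `[0, 1] -> f r = g r) -> isD g s l -> D01 f s = l.
Proof.
by move=> si fg h; apply: isD_D01 => //; apply: isD_eq h => // r /fg ->.
Qed.

Lemma cvg_id01 s : (r : R) @[r --> nb01 s] --> s.
Proof. by apply: cvg_within_filter; apply: cvg_within_filter. Qed.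

Lemma isD_slopeE V (g : R -> V) s r : r != s -> g r = g s + (r - s) *: slope g s r.
Proof.
move=> rs; rewrite /slope scalerA divff ?scale1r ?subr_eq0//.
by rewrite addrC subrK.
Qed.

Lemma isD_cont V (g : R -> V) s l : isD g s l -> g r @[r --> nb01 s] --> g s.
Proof.
move=> h.
suff : (g s + (r - s) *: slope g s r) @[r --> nb01 s] --> g s + (s - s) *: l.
  rewrite subrr scale0r addr0; move=> h1; apply: (cvg_near_eq h1).
  near=> r; apply: esym; apply: isD_slopeE.
  by have [] : r \in `[0, 1] /\ r != s by near: r; exact: near_nb01.
apply: cvgD; first exact: cvg_cst.
by apply: cvgZ => //; apply: cvgB; [exact: cvg_id01|exact: cvg_cst].
Unshelve. all: by end_near. Qed.

Lemma isD_cst V (v : V) s : isD (fun _ => v) s 0.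
Proof.
rewrite /isD /slope; under eq_fun do rewrite subrr scaler0.
exact: cvg_cst.
Qed.

Lemma isD_affine V (u v : V) s : isD (fun r => u + r *: v) s v.
Proof.
have : (fun _ : R => v) r @[r --> nb01 s] --> v by exact: cvg_cst.
rewrite /isD; move=> h; apply: (cvg_near_eq h).
near=> r.
have [_ rs] : r \in `[0, 1] /\ r != s by near: r; exact: near_nb01.
rewrite /slope; have -> : u + r *: v - (u + s *: v) = (r - s) *: v.
  by rewrite scalerBl opprD addrACA subrr add0r.
by rewrite scalerA mulVf ?scale1r // subr_eq0.
Unshelve. all: by end_near. Qed.

Lemma isDD V (f g : R -> V) s l k : isD f s l -> isD g s k ->
  isD (fun r => f r + g r) s (l + k).
Proof.
rewrite /isD => hf hg; have h : slope f s r + slope g s r @[r --> nb01 s] --> l + k by exact: cvgD.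
 apply: (cvg_near_eq h); near=> r; rewrite /=.
by rewrite /slope -scalerDr opprD addrACA.
Unshelve. all: by end_near. Qed.

Lemma isDZ V (f : R -> V) (a : R) s l :
  isD f s l -> isD (fun r => a *: f r) s (a *: l).
Proof.
rewrite /isD => hf; have h : a *: slope f s r @[r --> nb01 s] --> a *: l by exact: cvgZl_tmp.
 apply: (cvg_near_eq h); near=> r; rewrite /=.
by rewrite /slope -scalerBr !scalerA mulrC.
Unshelve. all: by end_near. Qed.

Lemma isDM (f g : R -> R) s l k : isD f s l -> isD g s k ->
  isD (fun r => f r * g r) s (l * g s + f s * k).
Proof.
move=> hf hg; rewrite /isD.
have h : slope f s r * g r + f s * slope g s r @[r --> nb01 s] -->
    l * g s + f s * k.
  by apply: cvgD; apply: cvgM => //; [exact: isD_cont hg|exact: cvg_cst].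
 apply: (cvg_near_eq h); near=> r; rewrite /=.
rewrite /slope /GRing.scale /=; ring.
Unshelve. all: by end_near. Qed.

Lemma isDV (f : R -> R) s l : f s != 0 -> isD f s l ->
  isD (fun r => (f r)^-1) s (- (f s) ^-2 * l).
Proof.
move=> f0 hf; rewrite /isD.
have h : - ((f s)^-1 * (f r)^-1) * slope f s r @[r --> nb01 s] -->
    - ((f s)^-1 * (f s)^-1) * l.
  apply: cvgM => //; apply: cvgN; apply: cvgM; first exact: cvg_cst.
  by apply: cvgV => //; exact: isD_cont hf.
rewrite expr2 invfM; apply: (cvg_near_eq h); near=> r; rewrite /=.
have : f r != 0 by near: r; apply: (@cvgr_neq0 _ R _ _ _ f (f s)) => //; exact: isD_cont hf.
rewrite /slope /GRing.scale /= => fr0.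
by have -> : (f r)^-1 - (f s)^-1 = - ((f s)^-1 * (f r)^-1) * (f r - f s);
  [field; rewrite f0 fr0|rewrite mulrCA].
Unshelve. all: by end_near. Qed.

Lemma isD_pair V W (f : R -> V) (g : R -> W) s l k :
  isD f s l -> isD g s k -> isD (fun r => (f r, g r)) s (l, k).
Proof. by move=> hf hg; apply: cvg_pair. Qed.

Lemma cvg_rowP n T (F : set_system T) (f : T -> 'rV[R]_n) (l : 'rV[R]_n) :
  Filter F ->
  (f x @[x --> F] --> l) <-> (forall i, f x ord0 i @[x --> F] --> l ord0 i).
Proof.
move=> FF; split.
  move=> h i; exact: (cvg_comp _ (fun M : 'rV[R]_n => M ord0 i) h (@coord_continuous _ _ _ _ _ _)).
move=> h; apply/cvgrPdist_le => e e0.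
have : forall i, \forall x \near F, `|l ord0 i - f x ord0 i| <= e.
  by move=> i; move/cvgrPdist_le : (h i); exact.
move=> /filter_forall; apply: filterS => x hx.
rewrite /Num.norm /= mx_normrE; apply/bigmax_leP; split; first exact: ltW.
by move=> [i j] _; rewrite !mxE ord1; exact: hx.
Qed.

Lemma isD_rowP n (f : R -> 'rV[R]_n) s l :
  isD f s l <-> forall i, isD (fun r => f r ord0 i) s (l ord0 i).
Proof.
rewrite /isD cvg_rowP; split => h i; apply: (cvg_near_eq (h i)); near=> r.
- by rewrite /slope !mxE.
- by rewrite /slope !mxE.
Unshelve. all: by end_near. Qed.

End isD.

(** * Mean value theorem and second-order sign tests on [0, 1] *)

Section MVT01.
Context {R : realType}.
Implicit Types (f df ddf : R -> R).

Lemma isD_within (V : normedModType R) (g : R -> V) s l : isD g s l ->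
  g r @[r --> within `[0, 1]%classic (nbhs s)] --> g s.
Proof.
move=> /isD_cont/cvgrPdist_le h; apply/cvgrPdist_le => e e0.
apply/near_within_nbhsE; have /near_nb01E := h e e0.
apply: filterS => r hr r01; have [->|rs] := eqVneq r s; last exact: hr.
by rewrite subrr normr0 ltW.
Qed.

Lemma isD_is_derive f s l : s \in `]0, 1[ -> isD f s l -> is_derive s 1 f l.
Proof.
rewrite in_itv /= => /andP[s0 s1] hf.
suff h : h^-1 *: ((f \o shift s) (h *: 1) - f s) @[h --> 0^'] --> l.
  by split; [apply/cvg_ex; exists l|exact: (@cvg_lim R (@norm_hausdorff _ _))].
apply/cvgrPdist_le => e e0; move/cvgrPdist_le : hf => /(_ e e0) /near_nb01E.
move=> /nbhs_ballP[d /= d0 hd].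
(* The bounds [s] and [1 - s] keep [h + s] inside [0, 1], where the one-sided slope is the usual
   difference quotient. *)
apply/nbhs_ballP; exists (Num.min d (Num.min s (1 - s))) => /=.
  by rewrite !lt_min d0 s0 subr_gt0.
move=> h; rewrite /ball /= sub0r normrN !lt_min => /and3P[h1 h2 h3] h0.
have := hd (h + s); rewrite /ball /= opprD addrCA subrr addr0 normrN => /(_ h1).
have hs : h + s != s by rewrite -subr_eq0 addrK.
move=> /(_ hs); rewrite /slope addrK /GRing.scale /= mulr1; apply.
by move: h2 h3; rewrite !ltr_norml in_itv /= => /andP[? ?] /andP[? ?]; lra.
Qed.

Lemma MVT01 f df a b : (forall s, s \in `[0, 1] -> isD f s (df s)) ->
  0 <= a -> a < b -> b <= 1 ->
  exists2 c, a < c < b & f b - f a = df c * (b - a).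
Proof.
move=> hf a0 ab b1.
have [|||c] := @MVT _ f df a b.
- by [].
- move=> x; rewrite in_itv /= => /andP[? ?]; apply: isD_is_derive.
    by rewrite in_itv /=; lra.
  by apply: hf; rewrite in_itv /=; lra.
- apply/subspace_continuousP => x; rewrite /= in_itv /= => /andP[xa xb].
  have /hf/isD_within h : x \in `[0, 1] by rewrite in_itv /=; lra.
  apply: cvg_trans h; apply: cvg_app; apply: within_subset.
  by move=> r; rewrite /= !in_itv /= => /andP[ra rb]; lra.
- by rewrite in_itv /= => ? ?; exists c.
Qed.

Lemma homo_isD f df : (forall s, s \in `[0, 1] -> isD f s (df s)) ->
  (forall s, s \in `[0, 1] -> df s <= 0) ->
  forall a b, 0 <= a -> a <= b -> b <= 1 -> f b <= f a.
Proof.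
move=> hf hdf a b a0; rewrite le_eqVlt => /predU1P[->//|ab] b1.
have [c /andP[ac cb] h] := MVT01 hf a0 ab b1.
rewrite -subr_le0 h mulr_le0_ge0//; last by rewrite subr_ge0 ltW.
by apply: hdf; rewrite in_itv /=; lra.
Qed.

(** Monotonicity twice: [df] is nonincreasing from 0, hence nonpositive, hence [f] is nonincreasing
    from 0. *)
Lemma second_derivative_le0 f df ddf :
  (forall s, s \in `[0, 1] -> isD f s (df s)) ->
  (forall s, s \in `[0, 1] -> isD df s (ddf s)) ->
  (forall s, s \in `[0, 1] -> ddf s <= 0) ->
  f 0 = 0 -> df 0 = 0 -> f 1 <= 0.
Proof.
move=> hf hdf hddf f0 df0; rewrite -f0; apply: (@homo_isD f df) => //.
move=> s; rewrite in_itv /= => /andP[? ?]; rewrite -df0.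
exact: (@homo_isD df ddf).
Qed.

(** If [l] were positive, [df] would be positive just to the right of 0, and by the mean value
    theorem so would [f]. A second derivative at the single point 0 suffices. *)
Lemma second_derivative_max0 f df l :
  (forall s, s \in `[0, 1] -> isD f s (df s)) -> isD df 0 l ->
  f 0 = 0 -> df 0 = 0 -> (forall s, s \in `[0, 1] -> f s <= 0) -> l <= 0.
Proof.
move=> hf hdf f0 df0 fle; rewrite leNgt; apply/negP => l0.
have : \forall r \near nb01 0, 0 < slope df 0 r.
  by apply: (cvgr_gt l) => //; exact: hdf.
move=> /near_nb01E/nbhs_ballP[d /= d0 hd].
pose e := Num.min (d / 2) 1.
have e0 : 0 < e by rewrite lt_min divr_gt0//=.
have ed : e <= d / 2 by rewrite ge_min lexx.
have e1 : e <= 1 by rewrite ge_min lexx orbT.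
have [c /andP[c0 ce]] := MVT01 hf (lexx 0) e0 e1.
have : 0 < slope df 0 c.
  apply: hd; rewrite /ball /= ?sub0r ?normrN ?gtr0_norm//; first lra.
    by rewrite gt_eqF.
  by rewrite in_itv /=; lra.
rewrite /slope df0 f0 !subr0 /GRing.scale /= pmulr_rgt0 ?invr_gt0// => dfc h.
have : f e <= 0 by apply: fle; rewrite in_itv /=; lra.
by rewrite h leNgt mulr_gt0.
Qed.

End MVT01.

(** * Convexity and second derivatives *)

Section convexity.
Context {R : realType}.
Implicit Types (f df ddf : R -> R).

Lemma convex_setP (V : lmodType R) (A : set V) (a b : V) (t : R) :
  convex_set A -> A a -> A b -> 0 <= t -> t <= 1 -> A ((1 - t) *: a + t *: b).
Proof.
move=> cA Aa Ab t0 t1.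
have := cA b a (Itv01 t0 t1) (mem_set Ab) (mem_set Aa).
by rewrite addrC => /set_mem.
Qed.

Lemma convex_function01P f : convex_function (E := R^o) `[0, 1]%classic f <->
  forall a b t, a \in `[0, 1] -> b \in `[0, 1] -> t \in `[0, 1] ->
    f (t * a + (1 - t) * b) <= t * f a + (1 - t) * f b.
Proof.
split=> [cf a b t ha hb|cf t a b /set_mem ha /set_mem hb].
  rewrite in_itv /= => /andP[t0 t1].
  exact: (cf (Itv01 t0 t1) a b (mem_set ha) (mem_set hb)).
by apply: cf => //; rewrite in_itv /= ge0 le1.
Qed.

(** At an intermediate point [m] the mean slopes on the two sides are values of [df] at points
    [c1 < c2], and [df] is nondecreasing; the convexity defect is a nonnegative multiple of
    [df c2 - df c1]. *)
Lemma convex_of_second_derivative f df ddf :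
  (forall s, s \in `[0, 1] -> isD f s (df s)) ->
  (forall s, s \in `[0, 1] -> isD df s (ddf s)) ->
  (forall s, s \in `[0, 1] -> 0 <= ddf s) ->
  convex_function (E := R^o) `[0, 1]%classic f.
Proof.
move=> hf hdf hddf; apply/convex_function01P.
have mono a b : 0 <= a -> a <= b -> b <= 1 -> df a <= df b.
  move=> a0 ab b1; rewrite -lerN2.
  apply: (@homo_isD _ (fun s => - df s) (fun s => - ddf s)) => // s si.
    have := isDZ (a := -1) (hdf s si); rewrite /GRing.scale /= mulN1r.
    by apply: isD_eq => // r _; rewrite mulN1r.
  by rewrite oppr_le0 hddf.
have key a b t : 0 <= a -> a < b -> b <= 1 -> 0 < t -> t < 1 ->
    f (t * a + (1 - t) * b) <= t * f a + (1 - t) * f b.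
  move=> a0 ab b1 t0 t1; pose m := t * a + (1 - t) * b.
  have mE : m - a = (1 - t) * (b - a) by rewrite /m; ring.
  have mE' : b - m = t * (b - a) by rewrite /m; ring.
  have am : a < m by rewrite -subr_gt0 mE mulr_gt0// subr_gt0.
  have mb : m < b by rewrite -subr_gt0 mE' mulr_gt0// subr_gt0.
  have [c1 /andP[ac1 c1m] h1] := MVT01 hf a0 am (ltW (lt_le_trans mb b1)).
  have [c2 /andP[mc2 c2b] h2] := MVT01 hf (le_trans a0 (ltW am)) mb b1.
  have c12 : df c1 <= df c2 by apply: mono; lra.
  rewrite -/m -subr_ge0.
  have -> : t * f a + (1 - t) * f b - f m =
    (1 - t) * (f b - f m) - t * (f m - f a) by ring.
  rewrite h1 h2 mE mE'.
  have -> : (1 - t) * (df c2 * (t * (b - a))) - t * (df c1 * ((1 - t) * (b - a)))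
    = (1 - t) * t * (b - a) * (df c2 - df c1) by ring.
  by apply: mulr_ge0; [apply: mulr_ge0; [apply: mulr_ge0|]|]; lra.
move=> a b t; rewrite !in_itv /= => /andP[a0 a1] /andP[b0 b1] /andP[t0 t1].
have [->|tn0] := eqVneq t 0; first by rewrite !mul0r !add0r subr0 !mul1r.
have [->|tn1] := eqVneq t 1; first by rewrite !subrr !mul0r !addr0 !mul1r.
have {}t0 : 0 < t by rewrite lt_neqAle eq_sym tn0.
have {}t1 : t < 1 by rewrite lt_neqAle tn1.
case: (ltgtP a b) => [ab|ba|->]; first exact: key.
- have := key b a (1 - t) b0 ba a1; rewrite subr_gt0 t1 ltrBlDr ltrDl t0.
  move=> /(_ isT isT); rewrite subKr.
  by rewrite [X in f X]addrC [leRHS]addrC.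
- by rewrite -!mulrDl addrC subrK !mul1r.
Qed.

(** The chord from 0 to [t] has slope between [df 0] and [df t] ([lo] and [hi]), so the slopes of
    [df] at 0 are nonnegative. *)
Lemma second_derivative_of_convex f df l :
  convex_function (E := R^o) `[0, 1]%classic f ->
  (forall s, s \in `[0, 1] -> isD f s (df s)) -> isD df 0 l -> 0 <= l.
Proof.
move=> /convex_function01P cf hf hl.
have i0 : 0 \in `[0, 1 : R] by rewrite in_itv /= lexx ler01.
(* Convexity on [[0, t]] with the denominator [t] cleared, so that the chord estimates become
   polynomial inequalities. *)
have cf0 r t : 0 < r -> r < t -> t <= 1 -> t * f r <= r * f t + (t - r) * f 0.
  move=> r0 rt t1; have t0 : 0 < t by lra.
  have ti : t \in `[0, 1] by rewrite in_itv /= ltW.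
  have rti : r / t \in `[0, 1].
    by rewrite in_itv /= ler_pdivrMr// mul1r (ltW rt) divr_ge0// ltW.
  have := cf t 0 (r / t) ti i0 rti.
  rewrite mulr0 addr0 divfK ?gt_eqF// => h.
  rewrite -(ler_pM2l (_ : 0 < t^-1)) ?invr_gt0//.
  rewrite mulKf ?gt_eqF//; apply: le_trans h _.
  rewrite le_eqVlt; apply/orP; left; apply/eqP; field.
  by rewrite gt_eqF.
have lo t : 0 < t -> t <= 1 -> df 0 <= (f t - f 0) / t.
  move=> t0 t1; rewrite leNgt; apply/negP => h.
  have h1 : \forall r \near nb01 0, (f t - f 0) / t < slope f 0 r.
    by apply: (cvgr_gt (df 0)) => //; exact: hf.
  have h2 : \forall r \near nb01 0, r < t.
    by apply: (cvgr_lt 0) => //; exact: cvg_id01.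
  have h3 := near_nb01 (0 : R).
  have P := nb01_proper i0.
  have [r [[h1r h2r] [ri r0]]] := filter_ex (filterI (filterI h1 h2) h3).
  move: ri; rewrite in_itv /= => /andP[]; rewrite le_eqVlt eq_sym (negbTE r0) /=.
  move=> {}r0 r1; move: h1r; rewrite /slope subr0 /GRing.scale /=.
  rewrite [X in _ < X]mulrC ltr_pdivlMr// mulrAC ltr_pdivrMr//.
  have := cf0 r t r0 h2r t1; nra.
have hi t : 0 < t -> t <= 1 -> (f t - f 0) / t <= df t.
  move=> t0 t1; rewrite leNgt; apply/negP => h.
  have it : t \in `[0, 1] by rewrite in_itv /= ltW.
  have h1 : \forall r \near nb01 t, slope f t r < (f t - f 0) / t.
    by apply: (cvgr_lt (df t)) => //; exact: hf.
  have h2 : \forall r \near nb01 t, 0 < r.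
    by apply: (cvgr_gt t) => //; exact: cvg_id01.
  have h3 := near_nb01 t.
  have P := nb01_proper it.
  have [r [[h1r h2r] [ri rt]]] := filter_ex (filterI (filterI h1 h2) h3).
  move: ri; rewrite in_itv /= => /andP[_ r1]; move: h1r.
  rewrite /slope /GRing.scale /= mulrC ltr_pdivlMr//.
  case: (ltgtP r t) rt => // rt _.
    rewrite -[r - t]opprB -[f r - f t]opprB invrN mulrNN mulrAC ltr_pdivrMr ?subr_gt0//.
    have := cf0 r t h2r rt t1; nra.
  rewrite mulrAC ltr_pdivrMr ?subr_gt0//.
  have := cf0 t r t0 rt r1; nra.
rewrite leNgt; apply/negP => h.
have h1 : \forall r \near nb01 0, slope df 0 r < 0.
  by apply: (cvgr_lt l) => //; exact: hl.
have P := nb01_proper i0.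
have [r [h1r [ri r0]]] := filter_ex (filterI h1 (near_nb01 (0 : R))).
move: ri; rewrite in_itv /= => /andP[]; rewrite le_eqVlt eq_sym (negbTE r0) /=.
move=> {}r0 r1; move: h1r; rewrite /slope subr0 /GRing.scale /=.
rewrite pmulr_rlt0 ?invr_gt0// subr_lt0 ltNge => /negP; apply.
exact: le_trans (lo r r0 r1) (hi r r0 r1).
Qed.

End convexity.
(** * Functions of class C^k up to the boundary *)

Section smooth.
Context {R : realType} {V : normedModType R}.
Implicit Types (U : set V) (f g : V -> R) (p : V).

(** A predicate and not a bundled structure: [D_cl U v f p] is known to be linear in [v] only for
    [p] in the closure of [U]. *)
Definition lin (E W : lmodType R) (L : E -> W) :=
  forall (a : R) (u v : E), L (a *: u + v) = a *: L u + L v.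

Definition small_o (E W : normedModType R) (A : set E) (f : E -> W) (L : E -> W) (p : E) :=
  forall e : R, 0 < e -> \forall q \near within A (nbhs p),
    `|f q - f p - L (q - p)| <= e * `|q - p|.

(* [C_cl] with the derivatives normalized to [D_cl], so that no choice of
   derivatives is involved. *)
Fixpoint smooth (k : nat) U f : Prop :=
  {within closure U, continuous f} /\
  if k is k'.+1 then
  [/\ forall p v, U p -> derivable f p v /\ 'D_v f p = D_cl U v f p,
      forall p, closure U p -> lin (fun v => D_cl U v f p : R^o),
      forall p, closure U p -> small_o (closure U) f (fun v => D_cl U v f p) p
    & forall v, smooth k' U (D_cl U v f)]
  else True.

Lemma within_nbhs_cvg U f p : {within closure U, continuous f} -> closure U p ->
  f q @[q --> within (closure U) (nbhs p)] --> f p.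
Proof. by move=> /subspace_continuousP; exact. Qed.

Lemma within_open_cvg U f p : {within closure U, continuous f} -> closure U p ->
  f q @[q --> within U (nbhs p)] --> f p.
Proof.
move=> cf Kp; apply: cvg_trans (within_nbhs_cvg cf Kp).
by apply: cvg_app; apply: within_subset; exact: subset_closure.
Qed.

Lemma near_within_self U p : \forall q \near within U (nbhs p), U q.
Proof. exact: near_withinT. Qed.

Lemma o_small (A : set V) (f : V -> R) (p : V) (L : V -> R) :
  (forall q, f q = f p + L (q - p) +o_(q \near within A (nbhs p)) (q - p)) ->
  small_o A f L p.
Proof.
move=> h; set F := within A (nbhs p).
have : f = (fun q => f p + L (q - p)) +o_ F (fun q => q - p).
  by apply/funext => q; rewrite {1}h.
move/eqaddoP => h' e e0; have := h' e e0; apply: filterS => q /=.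
by rewrite [_ q in X in X -> _]/= opprD addrA.
Qed.

(** [Df v] is continuous on the closure and is the directional derivative on [U], so its boundary
    values are the limits defining [D_cl]. The second function [g] serves the induction, since
    [D_cl U v g] and [Df v] agree on the closure only. *)
Lemma C_cl_smooth k U f g : open U -> C_cl k U f ->
  (forall p, closure U p -> f p = g p) -> smooth k U g.
Proof.
move=> oU; elim: k f g => [|k IH] f g /=.
  move=> cf fg; split=> //.
  by apply: subspace_eq_continuous cf => p /set_mem /fg.
move=> [cf [Df [hD ho hC]]] fg.
have cD v : {within closure U, continuous (Df v)}.
  by case: k {IH} hC => [|k] /(_ v) //= [].
have sUK : U `<=` closure U by exact: subset_closure.
have nfg p : U p -> \forall q \near p, f q = g q.
  move=> Up; have : nbhs p U by exact: open_nbhs_nbhs.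
  by apply: filterS => q /sUK /fg.
have hU p v : U p -> derivable g p v /\ 'D_v g p = Df v p.
  move=> Up; have [dfp /(_ v) <-] := hD p Up; split.
    apply: (near_eq_derivable (nfg p Up)); exact: diff_derivable.
  apply: esym; apply: near_eq_derive; exact: nfg.
have gD p v : closure U p -> D_cl U v g p = Df v p.
  move=> Kp; have P := within_nbhs_proper Kp.
  apply: (@cvg_lim R (@norm_hausdorff _ _)).
  apply: (cvg_near_eq (within_open_cvg (cD v) Kp)).
  by near=> q; rewrite (hU q v _).2//; near: q; exact: near_within_self.
split; first by apply: subspace_eq_continuous cf => p /set_mem /fg.
split.
- by move=> p v Up; rewrite gD//; [exact: hU|exact: sUK].
(* Inside [U] this is linearity of the differential; it passes to closure points in the limit. *)
- move=> p Kp a u v; rewrite !gD//.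
  have P := within_nbhs_proper Kp.
  have h1 := within_open_cvg (cD (a *: u + v)) Kp.
  have h2 : a * Df u q + Df v q @[q --> within U (nbhs p)] -->
      a * Df u p + Df v p.
    apply: cvgD; first (apply: cvgM; first exact: cvg_cst);
      exact: within_open_cvg.
  apply: (cvg_unique _ h1); first exact: norm_hausdorff.
  apply: (cvg_near_eq h2); near=> q.
  have Uq : U q by near: q; exact: near_within_self.
  have [dfq hDq] := hD q Uq.
  by rewrite -!hDq !deriveE// linearD linearZ.
- move=> p Kp; have := @o_small (closure U) f p (fun v => Df v p) (ho p Kp).
  move=> h e e0; have := h e e0.
  move/near_within_nbhsE => h1; apply/near_within_nbhsE; apply: filterS h1.
  by move=> q /[swap] Kq; rewrite -!fg// gD//; exact.
- by move=> v; apply: (IH (Df v)) => // p Kp; rewrite gD.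
Unshelve. all: by end_near. Qed.

End smooth.

(** * Linear maps, uniform convergence of forms, and the chain rule *)

Section lin.
Context {R : realType}.
Implicit Types (E W : lmodType R).

Lemma lin0 E W (L : E -> W) : lin L -> L 0 = 0.
Proof. by move=> h; have := h (-1) 0 0; rewrite scaler0 addr0 scaleN1r addNr. Qed.

Lemma linZ E W (L : E -> W) a u : lin L -> L (a *: u) = a *: L u.
Proof. by move=> h; have := h a u 0; rewrite !addr0 lin0 ?addr0. Qed.

Lemma linD E W (L : E -> W) u v : lin L -> L (u + v) = L u + L v.
Proof. by move=> h; have := h 1 u v; rewrite !scale1r. Qed.

Lemma linB E W (L : E -> W) u v : lin L -> L (u - v) = L u - L v.
Proof. by move=> h; rewrite linD// -scaleN1r linZ// scaleN1r. Qed.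

Lemma lin_sum E W (L : E -> W) n (v : 'I_n -> E) : lin L ->
  L (\sum_i v i) = \sum_i L (v i).
Proof.
move=> h; apply: (big_morph L) => [u w|]; [exact: linD|exact: lin0].
Qed.

Lemma lin_row n W (L : 'rV[R]_n -> W) v : lin L ->
  L v = \sum_i v ord0 i *: L (delta_mx 0 i).
Proof.
by move=> h; rewrite {1}(row_sum_delta v) lin_sum//; apply: eq_bigr => i _; rewrite linZ.
Qed.

End lin.

Section unif_lin.
Context {R : realType}.
Implicit Types (E W : normedModType R).

(* Pointwise convergence to zero of linear forms is uniform on the unit ball;
   this characterizes finite-dimensional spaces. *)
Definition unif_lin E := forall T (F : set_system T) (FF : Filter F)
  (L : T -> E -> R),
  (\forall t \near F, lin (L t : E -> R^o)) ->
  (forall v, L t v @[t --> F] --> 0) ->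
  forall e : R, 0 < e -> \forall t \near F, forall v, `|L t v| <= e * `|v|.

Lemma unif_lin_R : unif_lin R.
Proof.
move=> T F FF L linL L0 e e0.
have := L0 1; move=> /cvgrPdist_le /(_ e e0) h.
apply: filterS2 linL h => t lt; rewrite sub0r normrN => h v.
have -> : v = v *: (1 : R) by rewrite /GRing.scale /= mulr1.
rewrite linZ// {1}/GRing.scale /= normrM mulrC [v *: _]mulr1.
by rewrite ler_wpM2r.
Qed.

Lemma norm_coord n (v : 'rV[R]_n) i : `|v ord0 i| <= `|v|.
Proof.
rewrite {2}/Num.norm /= mx_normrE.
exact: (@le_bigmax _ _ _ 0 (fun ij : 'I_1 * 'I_n => `|v ij.1 ij.2|) (ord0, i)).
Qed.

Lemma norm_row_le n (v : 'rV[R]_n) (e : R) : 0 <= e ->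
  (forall i, `|v ord0 i| <= e) -> `|v| <= e.
Proof.
move=> e0 h; rewrite {1}/Num.norm /= mx_normrE; apply/bigmax_leP; split => //.
by move=> [i j] _; rewrite ord1; exact: h.
Qed.

Lemma unif_lin_row n : unif_lin 'rV[R]_n.
Proof.
move=> T F FF L linL L0 e e0.
(* The divisor [n.+1] instead of [n] keeps the bound positive when [n = 0]. *)
have e1 : 0 < e / n.+1%:R by rewrite divr_gt0.
have h : \forall t \near F, forall i : 'I_n, `|L t (delta_mx 0 i)| <= e / n.+1%:R.
  apply: filter_forall => i.
  have := L0 (delta_mx 0 i); move=> /cvgrPdist_le /(_ _ e1); apply: filterS => t.
  by rewrite sub0r normrN.
apply: filterS2 linL h => t lt ht v; rewrite lin_row//.
apply: le_trans (ler_norm_sum _ _ _) _.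
apply: (@le_trans _ _ (\sum_(i < n) `|v| * (e / n.+1%:R))).
  apply: ler_sum => i _; rewrite normrZ; apply: ler_pM => //; exact: norm_coord.
rewrite sumr_const card_ord -[_ *+ n]mulr_natr -mulrA mulrC ler_wpM2r//.
by rewrite mulrAC ler_pdivrMr// ler_wpM2l ?ltW// ltr_nat.
Qed.

Lemma norm_fst_le E W (v : E * W) : `|v.1| <= `|v|.
Proof. by rewrite prod_normE le_max lexx. Qed.

Lemma norm_snd_le E W (v : E * W) : `|v.2| <= `|v|.
Proof. by rewrite prod_normE le_max lexx orbT. Qed.

Lemma unif_lin_prod E W : unif_lin E -> unif_lin W -> unif_lin (E * W)%type.
Proof.
move=> hE hW T F FF L linL L0 e e0.
have e2 : 0 < e / 2 by rewrite divr_gt0.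
have l1 : \forall t \near F, lin (fun u : E => L t (u, 0) : R^o).
  apply: filterS linL => t lt a u v.
  by rewrite -lt; congr (L t (_, _)); rewrite /= scaler0 addr0.
have l2 : \forall t \near F, lin (fun u : W => L t (0, u) : R^o).
  apply: filterS linL => t lt a u v.
  by rewrite -lt; congr (L t (_, _)); rewrite /= scaler0 addr0.
have h1 := hE T F FF _ l1 (fun v => L0 (v, 0)) _ e2.
have h2 := hW T F FF _ l2 (fun v => L0 (0, v)) _ e2.
near=> t => -[u v].
have -> : (u, v) = (u, 0) + (0, v) by congr (_, _); rewrite /= ?addr0 ?add0r.
rewrite linD; last by near: t.
rewrite (_ : (u, 0) + (0, v) = (u, v)); last first.
  by congr (_, _); rewrite /= ?addr0 ?add0r.
apply: le_trans (ler_normD _ _) _.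
have a1 : `|L t (u, 0)| <= e / 2 * `|u| by move: (u); near: t.
have a2 : `|L t (0, v)| <= e / 2 * `|v| by move: (v); near: t.
have b1 := norm_fst_le (u, v); have b2 := norm_snd_le (u, v).
apply: le_trans (lerD a1 a2) _; rewrite [e in leRHS]splitr mulrDl.
by apply: lerD; apply: ler_wpM2l => //; exact: ltW.
Unshelve. all: by end_near. Qed.

(** The family [t * L] tends to 0 pointwise as [t] tends to 0; uniformity at one nonzero [t] bounds
    [L] itself. *)
Lemma lin_bounded E (L : E -> R) : unif_lin E -> lin (L : E -> R^o) ->
  exists2 C : R, 0 < C & forall v, `|L v| <= C * `|v|.
Proof.
move=> uE lL.
have h v : (t * L v : R) @[t --> (0:R)] --> 0.
  by rewrite -[X in _ --> X](mul0r (L v)); apply: cvgM => //; exact: cvg_cst.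
have l : \forall t \near (0 : R), lin (fun v => t * L v : R^o).
  by apply: filterE => t a u v; rewrite lL /GRing.scale /=; ring.
have hn : nbhs (0 : R) [set t | forall v, `|t * L v| <= 1 * `|v|].
  exact: (uE R (nbhs (0 : R)) _ _ l h 1 ltr01).
move/nbhs_ballP : hn => [d /= d0 hd].
have d2 : 0 < d / 2 by rewrite divr_gt0.
have {}hd : forall v, `|d / 2 * L v| <= 1 * `|v|.
  by apply: hd; rewrite /ball /= sub0r normrN gtr0_norm//; lra.
exists (d / 2)^-1; first by rewrite invr_gt0.
move=> v; have := hd v; rewrite mul1r normrM gtr0_norm// => hv.
by rewrite mulrC ler_pdivlMr// mulrC.
Qed.

(** The forms and their argument move together. The difference [L t - L0] is uniformly small on
    bounded sets, where [w t] eventually lies, and [L0] is bounded. *)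
Lemma cvg_lin E T (F : set_system T) {FF : Filter F} (L : T -> E -> R)
    (L0 : E -> R) (w : T -> E) (w0 : E) : unif_lin E ->
  (\forall t \near F, lin (L t : E -> R^o)) -> lin (L0 : E -> R^o) ->
  (forall v, L t v @[t --> F] --> L0 v) ->
  w t @[t --> F] --> w0 -> L t (w t) @[t --> F] --> L0 w0.
Proof.
move=> uE lL lL0 hL hw; have [C C0 hC] := lin_bounded uE lL0.
have lD : \forall t \near F, lin (fun v => L t v - L0 v : R^o).
  apply: filterS lL => t lt a u v; rewrite lt lL0 scalerBr.
  by rewrite opprD addrACA.
have hD v : L t v - L0 v @[t --> F] --> 0.
  by rewrite -(subrr (L0 v)); apply: cvgB => //; exact: cvg_cst.
apply/cvgrPdist_le => e e0.
have e1 : 0 < e / 2 / (`|w0| + 1) by rewrite !divr_gt0// ltr_wpDl.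
have e2 : 0 < Num.min 1 (e / 2 / C) by rewrite lt_min ltr01 !divr_gt0.
have h1 := uE T F FF _ lD hD _ e1.
move/cvgrPdist_le : hw => /(_ _ e2) h2.
near=> t.
have a1 : forall v, `|L t v - L0 v| <= e / 2 / (`|w0| + 1) * `|v| by near: t.
have a2 : `|w0 - w t| <= Num.min 1 (e / 2 / C) by near: t.
move: a2; rewrite le_min => /andP[a2 a3].
have a4 : `|w t| <= `|w0| + 1.
  by rewrite -[w t](subKr w0); apply: le_trans (ler_normB _ _) _; rewrite lerD2l.
have -> : L0 w0 - L t (w t) = L0 (w0 - w t) - (L t (w t) - L0 (w t)).
  rewrite linB//; ring.
apply: le_trans (ler_normB _ _) _; rewrite [e]splitr; apply: lerD.
  apply: le_trans (hC _) _; rewrite mulrC -ler_pdivlMr//.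
apply: le_trans (a1 _) _; rewrite mulrAC ler_pdivrMr ?ltr_wpDl//.
by rewrite ler_wpM2l// ltW// divr_gt0.
Unshelve. all: by end_near. Qed.

Lemma isD_lin E (L : R -> E -> R) (v : R -> E) s v' k : unif_lin E ->
  s \in `[0, 1] -> (forall r, r \in `[0, 1] -> lin (L r : E -> R^o)) ->
  (forall u, L r u @[r --> nb01 s] --> L s u) ->
  isD v s v' -> isD (fun r => L r (v s)) s k ->
  isD (fun r => L r (v r)) s (L s v' + k).
Proof.
move=> uE si lL cL hv hk; rewrite /isD.
have h : L r (slope v s r) + slope (fun r => L r (v s)) s r @[r --> nb01 s] -->
    L s v' + k.
  apply: cvgD => //; apply: cvg_lin => //; last exact: lL.
  by apply: filterS (near_nb01 s) => r [ri _]; exact: lL.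
apply: (cvg_near_eq h); near=> r.
have [ri _] : r \in `[0, 1] /\ r != s by near: r; exact: near_nb01.
rewrite /slope (linZ _ _ (lL r ri)) (linB _ _ (lL r ri)).
by rewrite -scalerDr addrA subrK.
Unshelve. all: by end_near. Qed.

(** Chain rule with a differential relative to [A] only, so that the curve may touch or follow the
    boundary. *)
Lemma isD_comp E (A : set E) (f L : E -> R) (c : R -> E) s l : unif_lin E ->
  s \in `[0, 1] -> small_o A f L (c s) -> lin (L : E -> R^o) ->
  (forall r, r \in `[0, 1] -> A (c r)) -> isD c s l ->
  isD (fun r => f (c r)) s (L l).
Proof.
move=> uE si ho lL cA hc; rewrite /isD.
have hL : L (slope c s r) @[r --> nb01 s] --> L l.
  by apply: (@cvg_lin _ _ _ _ (fun=> L)) => //; [exact: filterE|move=> v; exact: cvg_cst].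
suff h : slope (fun r => f (c r)) s r - L (slope c s r) @[r --> nb01 s] --> 0.
  have h2 : slope (fun r => f (c r)) s r - L (slope c s r) + L (slope c s r)
      @[r --> nb01 s] --> 0 + L l by exact: cvgD.
  rewrite add0r in h2; apply: (cvg_near_eq h2).
  by near=> r; rewrite subrK.
apply/cvgrPdist_le => e e0.
have e1 : 0 < e / (`|l| + 1) by rewrite divr_gt0// ltr_wpDl.
have h1 : \forall r \near nb01 s,
    `|f (c r) - f (c s) - L (c r - c s)| <= e / (`|l| + 1) * `|c r - c s|.
  have h : \forall r \near nb01 s, A (c r) ->
      `|f (c r) - f (c s) - L (c r - c s)| <= e / (`|l| + 1) * `|c r - c s|.
    exact: (isD_cont hc (ho _ e1)).
  by apply: filterS2 h (near_nb01 s) => r hr [ri _]; apply: hr; exact: cA.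
have h2 : \forall r \near nb01 s, `|slope c s r| <= `|l| + 1.
  move/cvgrPdist_le : hc => /(_ 1 ltr01); apply: filterS => r hr.
  by rewrite -[slope c s r](subKr l); apply: le_trans (ler_normB _ _) _; rewrite lerD2l.
near=> r; rewrite sub0r normrN.
have [ri rs] : r \in `[0, 1] /\ r != s by near: r; exact: near_nb01.
have a1 : `|f (c r) - f (c s) - L (c r - c s)| <= e / (`|l| + 1) * `|c r - c s|.
  by near: r.
have a2 : `|slope c s r| <= `|l| + 1 by near: r.
have -> : slope (fun r => f (c r)) s r - L (slope c s r) =
    (r - s)^-1 * (f (c r) - f (c s) - L (c r - c s)).
  by rewrite /slope (linZ _ _ lL) mulrBr.
rewrite normrM.
move: a2; rewrite /slope normrZ => a2.
apply: le_trans (ler_wpM2l _ a1) _ => //; rewrite mulrCA.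
by rewrite mulrAC ler_pdivrMr ?ltr_wpDl//; apply: ler_wpM2l => //; exact: ltW.
Unshelve. all: by end_near. Qed.

End unif_lin.

(** * Calculus up to the boundary and symmetry of second derivatives *)

Section smooth_theory.
Context {R : realType} {V : normedModType R}.
Variable U : set V.
Hypothesis oU : open U.
Hypothesis uV : unif_lin V.
Implicit Types (f g : V -> R) (p q v w : V).
Local Notation K := (closure U).
Local Notation D v f := (D_cl U v f).

Lemma smooth_cont k f : smooth k U f -> {within K, continuous f}.
Proof. by case: k => [|k] []. Qed.

Lemma smooth_D k v f : smooth k.+1 U f -> smooth k U (D v f).
Proof. by case=> _ [_ _ _ h]; exact: h. Qed.

Lemma smooth_lin k f p : smooth k.+1 U f -> K p -> lin (fun v => D v f p : R^o).
Proof. by move=> + Kp; case=> _ [_ h _ _]; exact: h. Qed.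

Lemma smooth_o k f p : smooth k.+1 U f -> K p -> small_o K f (fun v => D v f p) p.
Proof. by move=> + Kp; case=> _ [_ _ h _]; exact: h. Qed.

Lemma smooth_derive k f p v : smooth k.+1 U f -> U p ->
  derivable f p v /\ 'D_v f p = D v f p.
Proof. by move=> + Up; case=> _ [h _ _ _]; exact: h. Qed.

Lemma smoothW k f : smooth k.+1 U f -> smooth k U f.
Proof.
elim: k f => [|k IH] f [cf [h1 h2 h3 h4]]; split => //; split => // v.
by apply: IH; exact: h4.
Qed.

Lemma eq_D_cl f g v p : (forall q, U q -> f q = g q) -> D v f p = D v g p.
Proof.
move=> fg; rewrite /D_cl; congr (lim _).
rewrite eqEsubset; split; apply/near_eq_cvg;
 near=> q; have Uq : U q by near: q; exact: near_within_self.
- apply: near_eq_derive; have : nbhs q U by exact: open_nbhs_nbhs.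
  by apply: filterS => r /fg ->.
- apply: near_eq_derive; have : nbhs q U by exact: open_nbhs_nbhs.
  by apply: filterS => r /fg ->.
Unshelve. all: by end_near. Qed.

Lemma eq_closure f g p : {within K, continuous f} -> {within K, continuous g} ->
  (forall q, U q -> f q = g q) -> K p -> f p = g p.
Proof.
move=> cf cg fg Kp; have P := within_nbhs_proper Kp.
have h1 := within_open_cvg cf Kp; have h2 := within_open_cvg cg Kp.
apply: (cvg_unique _ h1); first exact: norm_hausdorff.
apply: (cvg_near_eq h2); near=> q; rewrite fg//; near: q.
exact: near_within_self.
Unshelve. all: by end_near. Qed.

Lemma D_cl_cvg f v p : smooth 1 U f -> K p ->
  'D_v f q @[q --> within U (nbhs p)] --> D v f p.
Proof.
move=> sf Kp.
have h := within_open_cvg (smooth_cont (smooth_D v sf)) Kp.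
apply: (cvg_near_eq h); near=> q.
by rewrite (smooth_derive v sf _).2//; near: q; exact: near_within_self.
Unshelve. all: by end_near. Qed.

Lemma D_cl_lin f g (a : R) v p : smooth 1 U f -> smooth 1 U g -> K p ->
  D v (fun q => a * f q + g q) p = a * D v f p + D v g p.
Proof.
move=> sf sg Kp; have P := within_nbhs_proper Kp.
apply: (@cvg_lim R (@norm_hausdorff _ _)).
have h : a * 'D_v f q + 'D_v g q @[q --> within U (nbhs p)] -->
    a * D v f p + D v g p.
  by apply: cvgD; [apply: cvgM; [exact: cvg_cst|]|]; exact: D_cl_cvg.
apply: (cvg_near_eq h); near=> q.
have Uq : U q by near: q; exact: near_within_self.
have [df _] := smooth_derive v sf Uq; have [dg _] := smooth_derive v sg Uq.
by apply: esym; rewrite (deriveD (derivableZ (k := a) df) dg) deriveZ.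
Unshelve. all: by end_near. Qed.

Lemma isD_smooth f (c : R -> V) s l : smooth 1 U f -> s \in `[0, 1] ->
  (forall r, r \in `[0, 1] -> K (c r)) -> isD c s l ->
  isD (fun r => f (c r)) s (D l f (c s)).
Proof.
move=> sf si cK hc; apply: (@isD_comp R V K f (fun v => D v f (c s))) => //.
- exact: (smooth_o sf (cK s si)).
- exact: (smooth_lin sf (cK s si)).
Qed.

Lemma isD_smoothD f (c v : R -> V) s l k : smooth 2 U f -> s \in `[0, 1] ->
  (forall r, r \in `[0, 1] -> K (c r)) -> isD c s l -> isD v s k ->
  isD (fun r => D (v r) f (c r)) s (D k f (c s) + D l (D (v s) f) (c s)).
Proof.
move=> sf si cK hc hv; apply: (@isD_lin R V (fun r u => D u f (c r))) => //.
- by move=> r ri; exact: (smooth_lin sf (cK r ri)).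
- by move=> u; apply: isD_cont; apply: (isD_smooth _ si cK hc); exact: smooth_D.
- apply: (isD_smooth _ si cK hc); exact: smooth_D.
Qed.

(* The limit of the second difference quotient is symmetric in [v] and [w],
   hence Schwarz's theorem [D_cl_comm]. *)
Lemma second_difference f p v w (e : R) : smooth 2 U f -> U p -> 0 < e ->
  exists2 d : R, 0 < d & forall h, 0 < h -> h < d ->
    `|f (p + h *: v + h *: w) - f (p + h *: v) - f (p + h *: w) + f p
      - h ^+ 2 * D w (D v f) p| <= e * h ^+ 2.
Proof.
move=> sf Up e0.
have sfv := smooth_D v sf.
have Kp : K p by exact: subset_closure.
(* The parallelogram with sides [h *: v] and [h *: w] at [p] lies within [h * M] of [p]; the summand
   1 makes [M] positive. *)
pose M := `|v| + `|w| + 1.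
have M0 : 0 < M by rewrite ltr_wpDl// addr_ge0.
have e1 : 0 < e / (2 * M) by rewrite divr_gt0// mulr_gt0.
have ho : nbhs p [set q | K q -> `|D v f q - D v f p - D (q - p) (D v f) p| <=
    e / (2 * M) * `|q - p|] by exact: (smooth_o sfv Kp e1).
have : nbhs p U by exact: open_nbhs_nbhs.
move/nbhs_ballP: ho => [d1 /= d10 hd1].
move=> /nbhs_ballP [d2 /= d20 hd2].
exists (Num.min d1 d2 / M); first by rewrite divr_gt0// lt_min d10.
move=> h h0; rewrite ltr_pdivlMr// lt_min => /andP[hM1 hM2].
have pK (x y : V) : p + x + y - p = x + y.
  by rewrite -[p + x + y]addrA [p + _]addrC addrK.
have near_p (a b : R) : 0 <= a <= 1 -> 0 <= b <= 1 ->
    `|p + (a * h) *: v + (b * h) *: w - p| <= h * M.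
  move=> /andP[a0 a1] /andP[b0 b1].
  rewrite pK; apply: le_trans (ler_normD _ _) _.
  rewrite !normrZ (ger0_norm a0) (ger0_norm b0) (gtr0_norm h0).
  have nv : 0 <= `|v| by []. have nw : 0 <= `|w| by [].
  rewrite /M !mulrDr mulr1.
  have : a * h * `|v| <= h * `|v| by rewrite -mulrA ler_piMl// mulr_ge0// ltW.
  have : b * h * `|w| <= h * `|w| by rewrite -mulrA ler_piMl// mulr_ge0// ltW.
  by lra.
have inU (a b : R) : 0 <= a <= 1 -> 0 <= b <= 1 ->
    U (p + (a * h) *: v + (b * h) *: w).
  move=> a01 b01; apply: hd2; rewrite -ball_normE /= -normrN opprB.
  exact: le_lt_trans (near_p _ _ a01 b01) hM2.
have oo a b : 0 <= a <= 1 -> 0 <= b <= 1 ->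
    `|D v f (p + (a * h) *: v + (b * h) *: w) - D v f p -
      D ((a * h) *: v + (b * h) *: w) (D v f) p| <= e / 2 * h.
  move=> a01 b01.
  set q := p + _ + _.
  have qb : `|p - q| <= h * M by rewrite distrC; exact: near_p.
  have bq : ball p d1 q by rewrite -ball_normE /=; exact: le_lt_trans qb hM1.
  have Kq : K q by exact/subset_closure/inU.
  have hq : `|D v f q - D v f p - D (q - p) (D v f) p| <= e / (2 * M) * `|q - p|.
    exact: (hd1 q bq Kq).
  rewrite -(pK ((a * h) *: v)) -/q; apply: le_trans hq _.
  rewrite distrC; apply: le_trans (ler_wpM2l (ltW e1) qb) _.
  rewrite le_eqVlt; apply/orP; left; apply/eqP; field.
  by rewrite gt_eqF.
(* The second difference is [phi 1 - phi 0]. One mean value step in the direction [v] leaves a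
   difference of two values of [D v f], which is then expanded at [p]. *)
pose phi := fun t : R => f (p + (t * h) *: v + (1 * h) *: w)
   - f (p + (t * h) *: v + (0 * h) *: w).
pose dphi := fun t : R => h * (D v f (p + (t * h) *: v + (1 * h) *: w)
   - D v f (p + (t * h) *: v + (0 * h) *: w)).
have i0 : 0 <= (0 : R) <= 1 by rewrite lexx ler01.
have i1 : 0 <= (1 : R) <= 1 by rewrite lexx ler01.
have dc b s : 0 <= b <= 1 -> s \in `[0, 1] ->
    isD (fun t => f (p + (t * h) *: v + (b * h) *: w)) s
      (h * D v f (p + (s * h) *: v + (b * h) *: w)).
  move=> b01 si.
  have hc : isD (fun t => p + (t * h) *: v + (b * h) *: w) s (h *: v).
    have := @isD_affine R V (p + (b * h) *: w) (h *: v) s.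
    by apply: isD_eq => // r _; rewrite scalerA addrAC.
  have := @isD_smooth f _ s _ (smoothW sf) si _ hc.
  rewrite (linZ _ _ (smooth_lin sf _)); last first.
    by apply/subset_closure/inU => //; move: si; rewrite in_itv.
  apply=> r; rewrite in_itv /= => ri; exact/subset_closure/inU.
have hphi s : s \in `[0, 1] -> isD phi s (dphi s).
  move=> si; rewrite /dphi mulrBr.
  have h1 := dc 1 s i1 si; have h2 := isDZ (a := -1) (dc 0 s i0 si).
  have := isDD h1 h2; rewrite /GRing.scale /= mulN1r.
  by apply: isD_eq => // r _; rewrite /phi mulN1r.
have [t /andP[t0 t1]] := MVT01 hphi (lexx 0) ltr01 (lexx 1).
rewrite /phi /dphi !mul0r !scale0r !addr0 !mul1r subr0 mulr1 => E.
have t01 : 0 <= t <= 1 by rewrite !ltW.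
have o1 := oo t 1 t01 i1; have o0 := oo t 0 t01 i0.
have Lv := smooth_lin sfv Kp.
move: o1 o0; rewrite mul0r scale0r !addr0 mul1r.
rewrite (linD _ _ Lv) (linZ h w Lv).
set A := D v f _; set B := D v f (_ + _).
set X := D ((t * h) *: v) _ _; set Y := D w _ _; set Z := D v f p.
move=> o1 o0.
have -> : f (p + h *: v + h *: w) - f (p + h *: v) - f (p + h *: w) + f p
   = h * (A - B) by rewrite -E; ring.
have -> : h * (A - B) - h ^+ 2 * Y = h * ((A - Z - (X + h * Y)) - (B - Z - X)).
  by ring.
rewrite normrM gtr0_norm// expr2 mulrCA ler_pM2l//.
apply: le_trans (ler_normB _ _) _.
by rewrite [e]splitr mulrDl lerD.
Qed.

Lemma D_cl_comm f v w p : smooth 2 U f -> K p -> D w (D v f) p = D v (D w f) p.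
Proof.
move=> sf; apply: eq_closure.
- exact/(smooth_cont (k := 0))/smooth_D/smooth_D.
- exact/(smooth_cont (k := 0))/smooth_D/smooth_D.
move=> q Uq; apply/eqP; rewrite -subr_eq0 -normr_le0 leNgt; apply/negP => d0.
(* With an error [d / 3] in each of the two expansions the derivatives would differ by at most
   [2 * d / 3], a contradiction. *)
move: d0; set d := `|_| => d0; have d3 : 0 < d / 3 by rewrite divr_gt0.
have [d1 d10 h1] := second_difference v w sf Uq d3.
have [d2 d20 h2] := second_difference w v sf Uq d3.
pose h := Num.min d1 d2 / 2.
have m0 : 0 < Num.min d1 d2 by rewrite lt_min d10.
have h0 : 0 < h by rewrite divr_gt0.
have hm : h < Num.min d1 d2 by rewrite /h; lra.
move: hm; rewrite lt_min => /andP[hd1 hd2].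
have := h1 _ h0 hd1; have := h2 _ h0 hd2.
rewrite [q + h *: w + _]addrAC.
set F := f (q + h *: v + h *: w); set F1 := f (q + h *: v).
set F2 := f (q + h *: w).
move: d0; rewrite {}/d in h1 h2 d3 *.
move: (D w _ q) (D v _ q) F F1 F2 (f q) => A B F F1 F2 x d0 g2 g1.
have : `|A - B| * h ^+ 2 <= (`|A - B| / 3 + `|A - B| / 3) * h ^+ 2.
  have -> : `|A - B| * h ^+ 2 = `|(F - F2 - F1 + x - h ^+ 2 * B) -
      (F - F1 - F2 + x - h ^+ 2 * A)|.
    rewrite -[X in _ * X]ger0_norm ?sqr_ge0// -normrM; congr (`|_|); ring.
  apply: le_trans (ler_normB _ _) _; rewrite mulrDl.
  by apply: lerD; [exact: g2|exact: g1].
by rewrite ler_pM2r ?exprn_gt0//; lra.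
Qed.

Lemma D_cl_scale f g (a : R) w q : smooth 1 U g -> K q ->
  (forall q, U q -> f q = a * g q) -> D w f q = a * D w g q.
Proof.
move=> sg Kq fg; have -> : D w f q = D w (fun q => (a - 1) * g q + g q) q.
  by apply: eq_D_cl => r Ur; rewrite fg//; ring.
by rewrite D_cl_lin// mulrBl mul1r subrK.
Qed.

Lemma D2_cl_scale f g (a : R) w q : smooth 2 U g -> K q ->
  (forall q, U q -> f q = a * g q) -> D w (D w f) q = a * D w (D w g) q.
Proof.
move=> sg Kq fg; apply: D_cl_scale => //; first exact: smooth_D.
move=> r Ur; apply: D_cl_scale => //; first exact: smoothW.
exact: subset_closure.
Qed.

(** Linearity in the direction extracts one factor [a] from the outer derivative; symmetry brings
    the inner direction outside to extract the other. *)
Lemma D2_cl_dir_scale g (a : R) w q : smooth 2 U g -> K q ->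
  D (a *: w) (D (a *: w) g) q = a ^+ 2 * D w (D w g) q.
Proof.
move=> sg Kq.
apply: etrans (linZ a w (smooth_lin (smooth_D (a *: w) sg) Kq)) _.
apply: etrans (congr1 (fun z => a * z) (D_cl_comm _ _ sg Kq)) _.
apply: etrans (congr1 (fun z => a * z) (linZ a w (smooth_lin (smooth_D w sg) Kq))) _.
exact: mulrA.
Qed.

End smooth_theory.
(** * Local inversion *)

Section inverse.
Context {R : realType}.
Implicit Types (E W : normedModType R).

(** Differentiability with two moving points; this is what makes the simplified Newton map a
    contraction near [p]. *)
Definition strict_diff E W (F L : E -> W) (p : E) :=
  forall e : R, 0 < e -> exists2 r : R, 0 < r & forall a b,
    `|a - p| <= r -> `|b - p| <= r -> `|F a - F b - L (a - b)| <= e * `|a - b|.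

Definition locally_onto E W (F : E -> W) (p : E) :=
  forall r : R, 0 < r -> exists2 d : R, 0 < d & forall w,
    `|w - F p| <= d -> exists2 a, `|a - p| <= r & F a = w.

Definition lin_inverse E W (L : E -> W) (M : W -> E) (C : R) :=
  [/\ lin M, cancel L M, cancel M L, 0 < C & forall w, `|M w| <= C * `|w|].

Lemma strict_diff_row E n (F L : E -> 'rV[R]_n) p :
  (forall i, strict_diff (fun a => F a ord0 i) (fun a => L a ord0 i) p) ->
  strict_diff F L p.
Proof.
move=> h e e0; have {}h i := h i e e0.
have [r hr] : exists r : 'I_n -> R, forall i, 0 < r i /\ forall a b,
    `|a - p| <= r i -> `|b - p| <= r i ->
    `|F a ord0 i - F b ord0 i - L (a - b) ord0 i| <= e * `|a - b|.
  exists (fun i => s2val (cid2 (h i))) => i.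
  by split; [exact: (s2valP (cid2 (h i)))|exact: (s2valP' (cid2 (h i)))].
(* The base value 1 covers the empty minimum. *)
exists (\big[Num.min/1]_i r i).
  by apply: lt_bigmin => // i _; have [] := hr i.
move=> a b ha hb; apply: norm_row_le => [|i]; first by rewrite mulr_ge0// ltW.
have ri : \big[Num.min/1]_i r i <= r i by exact: bigmin_le.
by rewrite !mxE; apply: (hr i).2; [exact: le_trans ha ri|exact: le_trans hb ri].
Qed.

Lemma strict_diff_pair E W W' (F L : E -> W) (F' L' : E -> W') p :
  strict_diff F L p -> strict_diff F' L' p ->
  strict_diff (fun a => (F a, F' a)) (fun a => (L a, L' a)) p.
Proof.
move=> h h' e e0; have [r r0 hr] := h e e0; have [r' r'0 hr'] := h' e e0.
exists (Num.min r r'); first by rewrite lt_min r0.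
move=> a b; rewrite !le_min => /andP[a1 a2] /andP[b1 b2].
by rewrite prod_normE ge_max hr//= hr'.
Qed.

Lemma strict_diff_small_o E W (F L : E -> W) p (A : set E) :
  strict_diff F L p -> small_o A F L p.
Proof.
move=> h e e0; have [r r0 hr] := h e e0.
have hp : nbhs p [set q | A q -> `|F q - F p - L (q - p)| <= e * `|q - p|].
  apply/nbhs_ballP; exists r => //= q; rewrite -ball_normE /= => pq _.
  by apply: hr; [rewrite distrC ltW|rewrite subrr normr0 ltW].
exact: hp.
Qed.

(* [Phi v a] is the derivative of [F] at [a] in the direction [v]. *)
Lemma MVT_strict_diff E (A : set E) (F : E -> R) (Phi : E -> E -> R) p :
  unif_lin E -> nbhs p A ->
  (forall a, A a -> lin (fun v => Phi v a : R^o)) ->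
  (forall v, Phi v a @[a --> p] --> Phi v p) ->
  (forall (c : R -> E) s l, s \in `[0, 1] -> (forall r, r \in `[0, 1] -> A (c r)) ->
     isD c s l -> isD (fun r => F (c r)) s (Phi l (c s))) ->
  strict_diff F (fun v => Phi v p) p.
Proof.
move=> uE nA lPhi cPhi hD e e0.
have Ap : A p := nbhs_singleton nA.
have lD : \forall a \near nbhs p, lin (fun v => Phi v a - Phi v p : R^o).
  apply: filterS nA => a Aa t u v; rewrite lPhi// lPhi// scalerBr.
  by rewrite opprD addrACA.
have cD v : Phi v a - Phi v p @[a --> p] --> 0.
  by rewrite -(subrr (Phi v p)); apply: cvgB => //; exact: cvg_cst.
have hn : nbhs p [set a | A a /\ forall v, `|Phi v a - Phi v p| <= e * `|v|].
  exact: (filterI nA (uE E (nbhs p) _ _ lD cD e e0)).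
move/nbhs_ballP : hn => [r /= r0 hr].
exists (r / 2); first by rewrite divr_gt0.
move=> a b ha hb.
have inA s : s \in `[0, 1] -> ball p r (b + s *: (a - b)).
  rewrite in_itv /= => /andP[s0 s1]; rewrite -ball_normE /= -normrN opprB.
  have -> : b + s *: (a - b) - p = (1 - s) *: (b - p) + s *: (a - p).
    have -> : a - b = (a - p) - (b - p) by rewrite opprB addrA subrK.
    rewrite addrAC; move: (a - p) (b - p) => y x.
    by rewrite scalerBr scalerBl scale1r -addrA [- _ + _]addrC.
  apply: le_lt_trans (ler_normD _ _) _; rewrite !normrZ (ger0_norm s0).
  rewrite ger0_norm ?subr_ge0//; apply: (@le_lt_trans _ _ (r / 2)); last by lra.
  rewrite [leRHS](_ : _ = (1 - s) * (r / 2) + s * (r / 2)); last by ring.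
  by apply: lerD; rewrite ler_wpM2l ?subr_ge0.
have hd s : s \in `[0, 1] ->
    isD (fun t => F (b + t *: (a - b))) s (Phi (a - b) (b + s *: (a - b))).
  move=> si; apply: (hD (fun t => b + t *: (a - b))) => //.
    by move=> t /inA/hr[].
  exact: isD_affine.
have [c /andP[c0 c1]] := MVT01 hd (lexx 0) ltr01 (lexx 1).
rewrite scale1r scale0r addr0 [b + (a - b)]addrC subrK subr0 mulr1 => ->.
have /inA/hr[_] : c \in `[0, 1] by rewrite in_itv /= !ltW.
exact.
Qed.

(** A continuous curve inherits differentiability from its image. Invertibility of [L] first bounds
    the slopes of [g] ([Lip]); the remainder of [F] is then negligible and the limit is read off
    through [M]. *)
Lemma isD_inverse E W (A : set E) (F L : E -> W) (M : W -> E) (C : R)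
    (g : R -> E) s (l : E) :
  lin L -> lin_inverse L M C -> small_o A F L (g s) ->
  (forall r, r \in `[0, 1] -> A (g r)) ->
  g r @[r --> nb01 s] --> g s -> isD (fun r => F (g r)) s (L l) -> isD g s l.
Proof.
move=> lL [lM LM ML C0 hM] ho gA cg hF.
(* With this error, at most half of the norm of [g r - g s] returns on the right-hand side and is
   absorbed on the left. *)
have e0 : 0 < (2 * C)^-1 by rewrite invr_gt0 mulr_gt0.
have bnd e : 0 < e -> \forall r \near nb01 s,
    `|F (g r) - F (g s) - L (g r - g s)| <= e * `|g r - g s|.
  move=> e1; have h : \forall r \near nb01 s, A (g r) ->
      `|F (g r) - F (g s) - L (g r - g s)| <= e * `|g r - g s|.
    exact: (cg _ (ho _ e1)).
  by apply: filterS2 h (near_nb01 s) => r hr [ri _]; apply: hr; exact: gA.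
have hb : \forall r \near nb01 s, `|slope (fun r => F (g r)) s r| <= `|L l| + 1.
  move/cvgrPdist_le : hF => /(_ 1 ltr01); apply: filterS => r hr.
  rewrite -[slope _ s r](subKr (L l)); apply: le_trans (ler_normB _ _) _.
  by rewrite lerD2l.
have Lip : \forall r \near nb01 s,
    `|slope g s r| <= 2 * C * (`|L l| + 1).
  near=> r.
  have [ri rs] : r \in `[0, 1] /\ r != s by near: r; exact: near_nb01.
  have b1 : `|F (g r) - F (g s) - L (g r - g s)| <= (2 * C)^-1 * `|g r - g s|.
    by near: r; exact: bnd.
  have b2 : `|slope (fun r => F (g r)) s r| <= `|L l| + 1 by near: r.
  have b3 : `|g r - g s| <= C * `|L (g r - g s)| by rewrite -{1}(LM (g r - g s)).
  have b4 : `|L (g r - g s)| <= `|F (g r) - F (g s)| + (2 * C)^-1 * `|g r - g s|.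
    rewrite -[L _](subKr (F (g r) - F (g s))); apply: le_trans (ler_normB _ _) _.
    by rewrite lerD2l.
  have b5 : `|g r - g s| <= 2 * C * `|F (g r) - F (g s)|.
    have := le_trans b3 (ler_wpM2l (ltW C0) b4); rewrite mulrDr mulrA invfM mulrCA.
    by rewrite mulfV ?gt_eqF// mulr1; lra.
  rewrite /slope normrZ in b2; rewrite /slope normrZ.
  apply: le_trans (ler_wpM2l _ b5) _ => //.
  by rewrite mulrCA; apply: ler_wpM2l b2; rewrite mulr_ge0// ltW.
have hk : 0 < 2 * C * (`|L l| + 1) by rewrite !mulr_gt0// ltr_wpDl.
set k := 2 * C * _ in hk Lip.
apply/cvgrPdist_le => e e1.
have e2 : 0 < e / C / 2 by rewrite !divr_gt0.
have e3 : 0 < e / C / 2 / k by rewrite divr_gt0.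
near=> r.
have [ri rs] : r \in `[0, 1] /\ r != s by near: r; exact: near_nb01.
have b1 : `|F (g r) - F (g s) - L (g r - g s)| <= e / C / 2 / k * `|g r - g s|.
  by near: r; exact: bnd.
have b2 : `|slope g s r| <= k by near: r.
have b3 : `|L l - slope (fun r => F (g r)) s r| <= e / C / 2.
  by near: r; move/cvgrPdist_le : hF; exact.
rewrite -(LM (l - slope g s r)); apply: le_trans (hM _) _.
rewrite mulrC -ler_pdivlMr//.
have -> : L (l - slope g s r) = (L l - slope (fun r => F (g r)) s r) +
    (r - s)^-1 *: (F (g r) - F (g s) - L (g r - g s)).
  by rewrite linB// {1}/slope (linZ _ _ lL) scalerBr addrA subrK.
rewrite [leRHS]splitr; apply: le_trans (ler_normD _ _) _; apply: lerD => //.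
rewrite normrZ; apply: le_trans (ler_wpM2l _ b1) _ => //.
rewrite mulrCA -normrZ -/(slope g s r) mulrAC ler_pdivrMr//.
by apply: ler_wpM2l => //; exact: ltW.
Unshelve. all: by end_near. Qed.

(** Convergence in operator norm. *)
Definition unif_cvg E W T (F : set_system T) (L : T -> E -> W) (L0 : E -> W) :=
  forall e : R, 0 < e -> \forall t \near F, forall v, `|L t v - L0 v| <= e * `|v|.

Lemma unif_cvg_lin E T (F : set_system T) {FF : Filter F} (L : T -> E -> R)
    (L0 : E -> R) : unif_lin E ->
  (\forall t \near F, lin (L t : E -> R^o)) -> lin (L0 : E -> R^o) ->
  (forall v, L t v @[t --> F] --> L0 v) -> unif_cvg F L L0.
Proof.
move=> uE lL lL0 hL; apply: uE.
  apply: filterS lL => t lt a u v; rewrite lt lL0 scalerBr.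
  by rewrite opprD addrACA.
move=> v; rewrite -(subrr (L0 v)); apply: cvgB => //; exact: cvg_cst.
Qed.

Lemma unif_cvg_row E n T (F : set_system T) {FF : Filter F}
    (L : T -> E -> 'rV[R]_n) (L0 : E -> 'rV[R]_n) :
  (forall i, unif_cvg F (fun t v => L t v ord0 i) (fun v => L0 v ord0 i)) ->
  unif_cvg F L L0.
Proof.
move=> h e e0; have /filter_forall : forall i : 'I_n, \forall t \near F,
    forall v, `|L t v ord0 i - L0 v ord0 i| <= e * `|v| by move=> i; exact: h.
apply: filterS => t ht v; apply: norm_row_le => [|i].
  by rewrite mulr_ge0// ltW.
by rewrite !mxE; exact: ht.
Qed.

Lemma unif_cvg_pair E W W' T (F : set_system T) {FF : Filter F}
    (L : T -> E -> W) L0 (L' : T -> E -> W') L0' :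
  unif_cvg F L L0 -> unif_cvg F L' L0' ->
  unif_cvg F (fun t v => (L t v, L' t v)) (fun v => (L0 v, L0' v)).
Proof.
move=> h h' e e0; apply: filterS2 (h e e0) (h' e e0) => t a a' v.
by rewrite prod_normE ge_max a a'.
Qed.

(** The lower bound that [M] gives for [L0] persists for nearby [L t] with [C] replaced by [2 * C],
    so convergence of the images forces convergence of the points. No bound on [x t] is assumed. *)
Lemma cvg_lin_inverse E W T (F : set_system T) {FF : Filter F}
    (L : T -> E -> W) (L0 : E -> W) (M : W -> E) (C : R) (x : T -> E) (x0 : E) :
  lin_inverse L0 M C -> unif_cvg F L L0 -> (\forall t \near F, lin (L t)) ->
  L t (x t) @[t --> F] --> L0 x0 -> x t @[t --> F] --> x0.
Proof.
move=> [lM LM ML C0 hM] hL lL hx.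
have e0 : 0 < (2 * C)^-1 by rewrite invr_gt0 mulr_gt0.
have lim0 : L t x0 @[t --> F] --> L0 x0.
  apply/cvgrPdist_le => e e1.
  have e2 : 0 < e / (`|x0| + 1) by rewrite divr_gt0// ltr_wpDl.
  apply: filterS (hL _ e2) => t ht; rewrite distrC; apply: le_trans (ht _) _.
  rewrite mulrAC ler_pdivrMr ?ltr_wpDl//; apply: ler_wpM2l; first exact: ltW.
  by rewrite lerDl.
apply/cvgrPdist_le => e e1.
have e2 : 0 < e / (2 * C) / 2 by rewrite !divr_gt0// mulr_gt0.
near=> t.
have b1 : forall v, `|L t v - L0 v| <= (2 * C)^-1 * `|v| by near: t; exact: hL.
have b2 : `|L0 x0 - L t (x t)| <= e / (2 * C) / 2.
  by near: t; move/cvgrPdist_le : hx; exact.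
have b3 : `|L0 x0 - L t x0| <= e / (2 * C) / 2.
  by near: t; move/cvgrPdist_le : lim0; exact.
have lt : lin (L t) by near: t.
set y := x0 - x t.
have b4 : `|y| <= C * `|L0 y| by rewrite -{1}(LM y).
have b5 : `|L0 y| <= `|L t y| + (2 * C)^-1 * `|y|.
  rewrite -[L0 y](subKr (L t y)); apply: le_trans (ler_normB _ _) _.
  by rewrite lerD2l.
have b6 : `|L t y| <= e / (2 * C).
  rewrite /y linB//.
  have -> : L t x0 - L t (x t) = (L0 x0 - L t (x t)) - (L0 x0 - L t x0).
    by rewrite opprB [RHS]addrC addrA subrK.
  by apply: le_trans (ler_normB _ _) _; rewrite [leRHS]splitr lerD.
have := le_trans b4 (ler_wpM2l (ltW C0) b5); rewrite mulrDr mulrA invfM mulrCA.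
rewrite mulfV ?gt_eqF// mulr1 => b7.
have : C * `|L t y| <= e / 2.
  apply: le_trans (ler_wpM2l (ltW C0) b6) _; rewrite invfM mulrCA [C * _]mulrCA.
  by rewrite mulfV ?gt_eqF// mulr1.
lra.
Unshelve. all: by end_near. Qed.

Lemma isD_implicit E W (L : R -> E -> W) (M : W -> E) (C : R) (u : R -> E) s
    (v : W) (k : E) : s \in `[0, 1] ->
  lin_inverse (L s) M C -> unif_cvg (nb01 s) L (L s) ->
  (forall r, r \in `[0, 1] -> lin (L r)) ->
  (forall r, r \in `[0, 1] -> L r (u r) = v) ->
  isD (fun r => L r (u s)) s (- L s k) -> isD u s k.
Proof.
move=> si LM hL lL hv hD.
have near_lin : \forall r \near nb01 s, lin (L r).
  by apply: filterS (near_nb01 s) => r [ri _]; exact: lL.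
apply: (cvg_lin_inverse LM hL near_lin).
have h : - slope (fun r => L r (u s)) s r @[r --> nb01 s] --> L s k.
  by rewrite -[L s k]opprK; exact: cvgN.
apply: (cvg_near_eq h); near=> r.
have [ri rs] : r \in `[0, 1] /\ r != s by near: r; exact: near_nb01.
rewrite /slope (linZ _ _ (lL r ri)) (linB _ _ (lL r ri)) (hv r ri) -(hv s si).
by rewrite -scalerN opprB.
Unshelve. all: by end_near. Qed.

Lemma lin_inverse_inj E W (L : E -> W) M C u v : lin_inverse L M C ->
  L u = L v -> u = v.
Proof. by case=> _ LM _ _ _ /(congr1 M); rewrite !LM. Qed.

End inverse.

(** * Linear inverses and the contraction principle in finite dimension *)

HB.instance Definition _ (R : realType) (n : nat) := Complete.on 'rV[R]_n.

Section row_spaces.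
Context {R : realType}.
Implicit Types (E W : normedModType R).

Lemma lin_bounded_row E n (L : E -> 'rV[R]_n) : unif_lin E -> lin L ->
  exists2 C : R, 0 < C & forall v, `|L v| <= C * `|v|.
Proof.
move=> uE lL.
have h i : exists2 C : R, 0 < C & forall v, `|L v ord0 i| <= C * `|v|.
  by apply: lin_bounded => // a u v; rewrite lL !mxE.
exists (1 + \sum_i s2val (cid2 (h i))).
  by rewrite ltr_pwDl// sumr_ge0// => i _; apply/ltW/(s2valP (cid2 (h i))).
move=> v; apply: norm_row_le => [|i].
  apply: mulr_ge0 => //; apply: addr_ge0 => //.
  by apply: sumr_ge0 => i _; apply/ltW/(s2valP (cid2 (h i))).
apply: le_trans (s2valP' (cid2 (h i)) v) _; apply: ler_wpM2r => //.
rewrite (bigD1 i)//= addrCA lerDl addr_ge0// sumr_ge0// => j _.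
exact/ltW/(s2valP (cid2 (h j))).
Qed.

Lemma lin_inverse_row n (L : 'rV[R]_n -> 'rV[R]_n) : lin L ->
  (forall u, L u = 0 -> u = 0) -> exists M C, lin_inverse L M C.
Proof.
move=> lL injL; pose A := \matrix_i L (delta_mx 0 i).
have LA u : L u = u *m A.
  rewrite (lin_row _ lL) mulmx_sum_row; apply: eq_bigr => i _.
  by rewrite rowK.
have uA : A \in unitmx.
  rewrite -row_free_unit -kermx_eq0; apply/rowV0P => v /sub_kermxP vA.
  by apply: injL; rewrite LA.
pose M (w : 'rV[R]_n) := w *m invmx A.
have lM : lin M by move=> a u v; rewrite /M mulmxDl scalemxAl.
have [C C0 hC] := lin_bounded_row (@unif_lin_row _ _) lM.
exists M, C; split => // u; rewrite /M LA; first by rewrite mulmxK.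
by rewrite mulmxKV.
Qed.

(** The equation [F a = w] is the fixed-point equation of the simplified Newton map
    [T a = a - M (F a - w)], a contraction of ratio 1/2 on a small closed ball. *)
Lemma strict_diff_onto_row n W (F L : 'rV[R]_n -> W) M C p :
  lin_inverse L M C -> strict_diff F L p -> locally_onto F p.
Proof.
move=> [lM LM ML C0 hM] sF r0 r00.
have e0 : 0 < (2 * C)^-1 by rewrite invr_gt0 mulr_gt0.
have [r1 r10 hr1] := sF _ e0.
pose r := Num.min r0 r1; have r0' : 0 < r by rewrite lt_min r00.
have rr0 : r <= r0 by rewrite ge_min lexx.
have rr1 : r <= r1 by rewrite ge_min lexx orbT.
(* This radius moves the centre by at most [r / 2], and the contraction adds at most [r / 2], so [T]
   preserves the ball. *)
exists (r / (2 * C)); first by rewrite divr_gt0// mulr_gt0.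
move=> w hw.
pose B := closed_ball p r.
have BE a : B a <-> `|a - p| <= r.
  by rewrite /B closed_ballE// /closed_ball_ /= distrC.
pose T a := a - M (F a - w).
have TT a b : `|a - p| <= r -> `|b - p| <= r -> `|T a - T b| <= 2^-1 * `|a - b|.
  move=> ha hb.
  have -> : T a - T b = - M (F a - F b - L (a - b)).
    rewrite (linB _ _ lM) LM opprB /T.
    have -> : F a - F b = (F a - w) - (F b - w) by rewrite opprB addrA subrK.
    rewrite (linB (F a - w) _ lM); move: (M (F a - w)) (M (F b - w)) => x y.
    by rewrite opprB [- (x - y)]opprB addrACA [RHS]addrACA [- x - b]addrC.
  rewrite normrN; apply: le_trans (hM _) _.
  apply: le_trans (ler_wpM2l (ltW C0) (hr1 _ _ _ _)) _;
    [exact: le_trans ha rr1|exact: le_trans hb rr1|].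
  by rewrite invfM mulrA [C * _]mulrCA mulfV ?gt_eqF// mulr1.
have Bp : `|p - p| <= r by rewrite subrr normr0 ltW.
have Tp : `|T p - p| <= r / 2.
  rewrite /T addrAC subrr add0r normrN; apply: le_trans (hM _) _.
  rewrite distrC; apply: le_trans (ler_wpM2l (ltW C0) hw) _.
  by rewrite invfM mulrCA [C * _]mulrCA mulfV ?gt_eqF// mulr1.
have fB : set_fun B B T.
  move=> a /BE ha; apply/BE.
  have -> : T a - p = (T a - T p) + (T p - p) by rewrite addrA subrK.
  apply: le_trans (ler_normD _ _) _; apply: le_trans (lerD (TT _ _ ha Bp) Tp) _.
  by lra.
pose mT := isFun.Build _ _ B B T fB.
pose f : {fun B >-> B} := HB.pack T mT.
have cf : is_contraction f.
  exists (2^-1)%:nng; split => /=; first by rewrite invf_lt1// ltr1n.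
  by move=> [a b] [/= /BE ha /BE hb]; exact: TT.
have [||a Ba fa] := banach_fixed_point cf.
- exact: closed_ball_closed.
- by exists p; apply/BE.
exists a; first by apply: le_trans rr0; exact/BE.
apply/eqP; rewrite -subr_eq0; apply/eqP.
have : M (F a - w) = 0 by apply: (@addrI _ (a - M (F a - w))); rewrite subrK addr0.
by move=> /(congr1 L); rewrite ML => ->; rewrite -[RHS]ML (lin0 lM).
Qed.

(** Both spaces carry the maximum norm, so this identification is isometric and transports matrix
    inversion and the contraction argument to pairs. The coordinates match the index set of
    [D2Gbar]. *)
Definition row_of_pair n (u : 'rV[R]_n * R) : 'rV[R]_(n + 1) := row_mx u.1 u.2%:M.
Definition pair_of_row n (v : 'rV[R]_(n + 1)) : 'rV[R]_n * R :=
  (lsubmx v, rsubmx v ord0 ord0).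

Lemma row_of_pairK n : cancel (@row_of_pair n) (@pair_of_row n).
Proof.
by move=> [a b]; rewrite /pair_of_row row_mxKl row_mxKr mxE eqxx mulr1n.
Qed.

Lemma pair_of_rowK n : cancel (@pair_of_row n) (@row_of_pair n).
Proof.
move=> v; rewrite /row_of_pair /= -mx11_scalar hsubmxK//.
Qed.

Lemma row_of_pair_lin n : lin (@row_of_pair n).
Proof.
move=> a u v; rewrite /row_of_pair /= scale_row_mx add_row_mx.
by rewrite scale_scalar_mx -raddfD.
Qed.

Lemma pair_of_row_lin n : lin (@pair_of_row n).
Proof.
by move=> a u v; rewrite -[RHS]row_of_pairK row_of_pair_lin !pair_of_rowK.
Qed.

Lemma norm_row_of_pair n (u : 'rV[R]_n * R) : `|row_of_pair u| <= `|u|.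
Proof.
apply: norm_row_le => // i; rewrite -(splitK i); case: fintype.split => j /=.
  by rewrite row_mxEl; apply: le_trans (norm_fst_le u); exact: norm_coord.
rewrite row_mxEr mxE !ord1 eqxx mulr1n; exact: norm_snd_le.
Qed.

Lemma norm_pair_of_row n (v : 'rV[R]_(n + 1)) : `|pair_of_row v| <= `|v|.
Proof.
rewrite prod_normE ge_max; apply/andP; split => /=.
  by apply: norm_row_le => // i; rewrite mxE; exact: norm_coord.
by rewrite mxE; exact: norm_coord.
Qed.

Lemma lin_inverse_pair n (L : 'rV[R]_n * R -> 'rV[R]_n * R) : lin L ->
  (forall u, L u = 0 -> u = 0) -> exists M C, lin_inverse L M C.
Proof.
move=> lL injL.
pose L' v := row_of_pair (L (pair_of_row v)).
have lL' : lin L'.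
  by move=> a u v; rewrite /L' pair_of_row_lin lL row_of_pair_lin.
have [|M [C [lM LM ML C0 hM]]] := lin_inverse_row lL'.
  move=> u /(congr1 (@pair_of_row n)); rewrite row_of_pairK (lin0 (@pair_of_row_lin n)).
  by move=> /injL/(congr1 (@row_of_pair n)); rewrite pair_of_rowK (lin0 (@row_of_pair_lin n)).
exists (fun w => pair_of_row (M (row_of_pair w))), C; split => //.
- by move=> a u v; rewrite row_of_pair_lin lM pair_of_row_lin.
- move=> u; have := LM (row_of_pair u); rewrite /L' row_of_pairK => ->.
  by rewrite row_of_pairK.
- move=> u; have := ML (row_of_pair u); rewrite /L'.
  by move=> /(congr1 (@pair_of_row n)); rewrite !row_of_pairK.
- move=> w; apply: le_trans (norm_pair_of_row _) _.
  apply: le_trans (hM _) _; apply: ler_wpM2l; first exact: ltW.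
  exact: norm_row_of_pair.
Qed.

Lemma strict_diff_onto_pair n W (F L : 'rV[R]_n * R -> W) M C p :
  lin_inverse L M C -> strict_diff F L p -> locally_onto F p.
Proof.
move=> [lM LM ML C0 hM] sF.
pose J := @pair_of_row n; pose K := @row_of_pair n.
have JB (u v : 'rV[R]_(n + 1)) : J (u - v) = J u - J v by exact: (linB _ _ (@pair_of_row_lin n)).
have KB u v : K (u - v) = K u - K v by exact: (linB _ _ (@row_of_pair_lin n)).
have JK : cancel K J := @row_of_pairK n.
have KJ : cancel J K := @pair_of_rowK n.
have inv' : lin_inverse (fun v => L (J v)) (fun w => K (M w)) C.
  split => //.
  - by move=> a u v; rewrite lM /K row_of_pair_lin.
  - by move=> u; rewrite LM KJ.
  - by move=> w; rewrite JK ML.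
  - by move=> w; apply: le_trans (norm_row_of_pair _) _.
have sF' : strict_diff (fun v => F (J v)) (fun v => L (J v)) (K p).
  move=> e e0; have [r r0 hr] := sF e e0; exists r => // a b ha hb.
  rewrite JB; apply: le_trans (hr _ _ _ _) _.
  - by rewrite -(JK p) -JB; apply: le_trans (norm_pair_of_row _) _.
  - by rewrite -(JK p) -JB; apply: le_trans (norm_pair_of_row _) _.
  - apply: ler_wpM2l; first exact: ltW.
    by rewrite -JB; exact: norm_pair_of_row.
move=> r r0; have [d d0 hd] := strict_diff_onto_row inv' sF' r0.
exists d => // w; rewrite -{1}(JK p) => /hd [a ha <-].
exists (J a) => //; rewrite -(JK p) -JB.
by apply: le_trans (norm_pair_of_row _) _.
Qed.

End row_spaces.
Lemma rowE (R : realType) n (f : 'I_n -> R) i : (\row_j f j) ord0 i = f i.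
Proof. by rewrite mxE. Qed.

Lemma lin_rowP (R : realType) (E : lmodType R) n (L : E -> 'I_n -> R) :
  (forall i, lin (fun u => L u i : R^o)) -> lin (fun u => \row_i L u i).
Proof. by move=> h a u v; apply/rowP => i; rewrite !mxE h. Qed.

Lemma lin_pair (R : realType) (E W W' : lmodType R) (L : E -> W) (L' : E -> W') :
  lin L -> lin L' -> lin (fun u => (L u, L' u)).
Proof. by move=> h h' a u v; rewrite h h'. Qed.

(** * The generating function and non-degeneracy *)

Section model.
Context {R : realType} {n : nat}.
Variables (X Y : set 'rV[R]_n) (zl : R) (zu : \bar R).
Variable G : 'rV[R]_n * ('rV[R]_n * R) -> R.
Local Notation U := (XYZ X Y zl zu).
Local Notation P := (closure (YZ Y zl zu)).
Local Notation D v f := (D_cl U v f).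
Local Notation V := ('rV[R]_n * ('rV[R]_n * R))%type.
Local Notation E := ('rV[R]_n * R)%type.
Local Notation B x p := (Gz X Y zl zu G x p).

Hypothesis oX : open X.
Hypothesis oY : open Y.
Hypothesis sG : smooth 4 U G.

Definition ix (v : 'rV[R]_n) : V := (v, 0).
Definition ip (v : E) : V := (0, v).

Lemma ix_lin (a : R) u v : ix (a *: u + v) = a *: ix u + ix v.
Proof. by congr (_, _); rewrite /= scaler0 addr0. Qed.

Lemma ip_lin (a : R) u v : ip (a *: u + v) = a *: ip u + ip v.
Proof. by congr (_, _); rewrite /= scaler0 addr0. Qed.

Lemma unif_lin_E : unif_lin E.
Proof. by apply: unif_lin_prod; [exact: unif_lin_row|exact: unif_lin_R]. Qed.

Lemma unif_lin_V : unif_lin V.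
Proof. by apply: unif_lin_prod; [exact: unif_lin_row|exact: unif_lin_E]. Qed.

Lemma open_Zset : open (Zset zl zu).
Proof.
case: zu => [r| |]; rewrite /Zset.
- have -> : [set z : R | zl < z /\ (z%:E < r%:E)%E] = `]zl, r[%classic.
    apply/funext => z; apply/propext; rewrite /= in_itv /= lte_fin.
    by split => [[-> ->]|/andP[]].
  exact: interval_open.
- have -> : [set z : R | zl < z /\ (z%:E < +oo)%E] = `]zl, +oo[%classic.
    apply/funext => z; apply/propext; rewrite /= in_itv /= ltry andbT.
    by split => [[]|].
  exact: interval_open.
- have -> : [set z : R | zl < z /\ (z%:E < -oo)%E] = set0.
    by apply/seteqP; split => z //= [_]; rewrite ltNge leNye.
  exact: open0.
Qed.

Lemma open_prod (S T : topologicalType) (A : set S) (C : set T) :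
  open A -> open C -> open (A `*` C).
Proof.
move=> oA oC; rewrite openE => -[a c] [/= Aa Cc].
by exists (A, C) => //=; split; exact: open_nbhs_nbhs.
Qed.

Lemma open_YZ : open (YZ Y zl zu).
Proof. exact: open_prod open_Zset. Qed.

Lemma open_U : open U.
Proof. exact: open_prod open_YZ. Qed.

Lemma closure_prod (S T : topologicalType) (A : set S) (C : set T) a c :
  closure A a -> closure C c -> closure (A `*` C) (a, c).
Proof.
move=> Aa Cc N [[N1 N2] /= [n1 n2] sN].
have [a' [Aa' Na']] := Aa _ n1; have [c' [Cc' Nc']] := Cc _ n2.
by exists (a', c'); split => //; apply: sN.
Qed.

Lemma inK x p : X x -> P p -> closure U (x, p).
Proof. by move=> Xx Pp; apply: closure_prod => //; exact: subset_closure. Qed.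

Lemma P_prod p : P p -> closure Y p.1 /\ closure (Zset zl zu) p.2.
Proof.
move=> Pp; split => N Np.
  have [q [[Yq _] Nq]] := Pp (fst @^-1` N) (cvg_fst Np).
  by exists q.1.
have [q [[_ Zq] Nq]] := Pp (snd @^-1` N) (cvg_snd Np).
by exists q.2.
Qed.

Lemma isD_x k f (x : R -> 'rV[R]_n) p s v : smooth k.+1 U f -> s \in `[0, 1] ->
  (forall r, r \in `[0, 1] -> X (x r)) -> P p -> isD x s v ->
  isD (fun r => f (x r, p)) s (D (ix v) f (x s, p)).
Proof.
move=> sf si xX Pp hx.
apply: (isD_smooth (c := fun r => (x r, p)) unif_lin_V _ si).
- by elim: k sf => [//|k IH] sf; exact/IH/smoothW.
- by move=> r ri; apply: inK => //; exact: xX.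
- by apply: isD_pair => //; exact: isD_cst.
Qed.

Lemma isD_x2 k f (x v : R -> 'rV[R]_n) p s w : smooth k.+2 U f -> s \in `[0, 1] ->
  (forall r, r \in `[0, 1] -> X (x r)) -> P p -> isD x s (v s) -> isD v s w ->
  isD (fun r => D (ix (v r)) f (x r, p)) s
    (D (ix w) f (x s, p) + D (ix (v s)) (D (ix (v s)) f) (x s, p)).
Proof.
move=> sf si xX Pp hx hv.
apply: (isD_smoothD (c := fun r => (x r, p)) (v := fun r => ix (v r)) unif_lin_V _ si).
- by elim: k sf => [//|k IH] sf; exact/IH/smoothW.
- by move=> r ri; apply: inK => //; exact: xX.
- by apply: isD_pair => //; exact: isD_cst.
- by apply: isD_pair => //; exact: isD_cst.
Qed.

Lemma isD_p k f x (p : R -> E) s v : smooth k.+1 U f -> s \in `[0, 1] ->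
  X x -> (forall r, r \in `[0, 1] -> P (p r)) -> isD p s v ->
  isD (fun r => f (x, p r)) s (D (ip v) f (x, p s)).
Proof.
move=> sf si xX Pp hx.
apply: (isD_smooth (c := fun r => (x, p r)) unif_lin_V _ si).
- by elim: k sf => [//|k IH] sf; exact/IH/smoothW.
- by move=> r ri; apply: inK => //; exact: Pp.
- by apply: isD_pair => //; exact: isD_cst.
Qed.

Lemma isD_p2 k f x (p v : R -> E) s w : smooth k.+2 U f -> s \in `[0, 1] ->
  X x -> (forall r, r \in `[0, 1] -> P (p r)) -> isD p s (v s) -> isD v s w ->
  isD (fun r => D (ip (v r)) f (x, p r)) s
    (D (ip w) f (x, p s) + D (ip (v s)) (D (ip (v s)) f) (x, p s)).
Proof.
move=> sf si xX Pp hx hv.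
apply: (isD_smoothD (c := fun r => (x, p r)) (v := fun r => ip (v r)) unif_lin_V _ si).
- by elim: k sf => [//|k IH] sf; exact/IH/smoothW.
- by move=> r ri; apply: inK => //; exact: Pp.
- by apply: isD_pair => //; exact: isD_cst.
- by apply: isD_pair => //; exact: isD_cst.
Qed.

Definition dGx_G x p (k : E) : E :=
  (\row_i D (ip k) (D (ix (e_ i)) G) (x, p), D (ip k) G (x, p)).

Lemma lin_ip k f q : smooth k.+1 U f -> closure U q ->
  lin (fun v => D (ip v) f q : R^o).
Proof. by move=> sf Kq a u v; rewrite ip_lin; exact: (smooth_lin sf Kq). Qed.

Lemma lin_ix k f q : smooth k.+1 U f -> closure U q ->
  lin (fun v => D (ix v) f q : R^o).
Proof. by move=> sf Kq a u v; rewrite ix_lin; exact: (smooth_lin sf Kq). Qed.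

Lemma dGx_G_row x p k i : (dGx_G x p k).1 ord0 i = D (ip k) (D (ix (e_ i)) G) (x, p).
Proof. exact: rowE. Qed.

Lemma dGx_G_lin x p : X x -> P p -> lin (dGx_G x p).
Proof.
move=> Xx Pp; apply: lin_pair; last exact: (lin_ip sG (inK Xx Pp)).
by apply: lin_rowP => i; exact: (lin_ip (smooth_D (ix (e_ i)) sG) (inK Xx Pp)).
Qed.

Lemma pair_of_row_delta k : pair_of_row (delta_mx 0 k) = @ebar_ R n k.
Proof.
rewrite /ebar_ -{1}(splitK k); case: (fintype.split k) => j /=; congr (_, _).
- apply/rowP => i; rewrite !mxE /= eq_lshift//.
- by rewrite !mxE /= eq_rlshift.
- by apply/rowP => i; rewrite !mxE /= eq_lrshift.
- by rewrite !mxE /= !ord1 !eqxx.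
Qed.

Lemma lin_ebar (L : E -> R) v : lin (L : E -> R^o) ->
  L v = \sum_k row_of_pair v ord0 k * L (@ebar_ R n k).
Proof.
move=> lL; have lL' : lin (fun w => L (pair_of_row w) : R^o).
  by move=> a u w; rewrite pair_of_row_lin lL.
have := lin_row (row_of_pair v) lL'; rewrite row_of_pairK => ->.
by apply: eq_bigr => k _; rewrite pair_of_row_delta.
Qed.

(** * Non-degeneracy as invertibility of [dGx_G] *)

Section nondegenerate.
Variables a b : R.
Hypotheses (ha : a < -1) (hb : -1 < b).
Local Notation X0 := (`]a, b[%classic : set R).
Local Notation W := ((X `*` X0) `*` YZ Y zl zu).
Local Notation Gb := (Gbar G).

Lemma open_W : open W.
Proof.
apply: open_prod open_YZ; apply: open_prod => //; exact: interval_open.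
Qed.

Lemma closure_W x p : X x -> P p -> closure W ((x, -1), p).
Proof.
move=> Xx Pp; apply: closure_prod => //; apply: subset_closure; split => //=.
by rewrite in_itv /= ha.
Qed.

Lemma W_U q : W q -> U (q.1.1, q.2).
Proof. by move=> [[? ?] ?]. Qed.

Lemma cvg_W_U f (q : ('rV[R]_n * R) * E) : smooth 0 U f -> closure U (q.1.1, q.2) ->
  f (r.1.1, r.2) @[r --> within W (nbhs q)] --> f (q.1.1, q.2).
Proof.
move=> [cf _] Kq; have h := within_nbhs_cvg cf Kq.
apply: (@cvg_comp _ _ _ (fun r : ('rV[R]_n * R) * E => (r.1.1, r.2)) f _ _ _ _ h).
move=> A hA; change (nbhs q [set r | W r -> A (r.1.1, r.2)]).
have : (r.1.1, r.2) @[r --> nbhs q] --> (q.1.1, q.2).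
  apply: (@cvg_pair _ _ _ (nbhs q) (nbhs q.1.1) (nbhs q.2) _ _ _
    (fun r => r.1.1) snd).
    apply: (@cvg_comp _ _ _ fst fst (nbhs q) (nbhs q.1)).
      exact: (@cvg_fst _ _ (nbhs q.1) (nbhs q.2)).
    exact: (@cvg_fst _ _ (nbhs q.1.1) (nbhs q.1.2)).
  exact: (@cvg_snd _ _ (nbhs q.1) (nbhs q.2)).
move=> hc.
have hN : nbhs q [set r | closure U (r.1.1, r.2) -> A (r.1.1, r.2)].
  exact: (hc [set r | closure U r -> A r] hA).
apply: filterS hN => r hr Wr; apply: hr.
exact/subset_closure/W_U.
Qed.

Lemma derive_Gbar_scaled (f : V -> R) v1 v2 (q : ('rV[R]_n * R) * E) :
  derivable f (q.1.1, q.2) (v1, v2) ->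
  'D_((v1, 0), v2) (fun r : ('rV[R]_n * R) * E => r.1.2 * f (r.1.1, r.2)) q =
    q.1.2 * 'D_(v1, v2) f (q.1.1, q.2).
Proof.
move=> df; apply: (@cvg_lim R (@norm_hausdorff _ _)).
have h : q.1.2 * (t^-1 *: ((f \o shift (q.1.1, q.2)) (t *: (v1, v2)) -
    f (q.1.1, q.2))) @[t --> 0^'] --> q.1.2 * 'D_(v1, v2) f (q.1.1, q.2).
  by apply: cvgM => //; exact: cvg_cst.
apply: (cvg_near_eq h); near=> t.
rewrite /shift /= [t *: 0 + q.1.2](_ : _ = q.1.2); last first.
  by rewrite scaler0 add0r.
by rewrite -mulrBr /GRing.scale /= mulrCA.
Unshelve. all: by end_near. Qed.

Lemma derive_Gbar_x0 (q : ('rV[R]_n * R) * E) :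
  'D_((0, 1), 0) Gb q = G (q.1.1, q.2).
Proof.
apply: (@cvg_lim R (@norm_hausdorff _ _)).
have h : (fun _ : R => G (q.1.1, q.2)) t @[t --> 0^'] --> G (q.1.1, q.2).
  exact: cvg_cst.
apply: (cvg_near_eq h); near=> t.
have t0 : t != 0 by near: t; exact: nbhs_dnbhs_neq.
rewrite /Gbar /= !scaler0 !add0r -mulrBl addrK /GRing.scale /= mulr1.
by rewrite mulrA mulVf// mul1r.
Unshelve. all: by end_near. Qed.

Lemma D_cl_W_scaled f v1 v2 q : smooth 1 U f -> closure W q ->
  closure U (q.1.1, q.2) ->
  D_cl W ((v1, 0), v2) (fun r : ('rV[R]_n * R) * E => r.1.2 * f (r.1.1, r.2)) q =
    q.1.2 * D (v1, v2) f (q.1.1, q.2).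
Proof.
move=> sf cW Kq; have PF := within_nbhs_proper cW.
apply: (@cvg_lim R (@norm_hausdorff _ _)).
have h : r.1.2 * D (v1, v2) f (r.1.1, r.2) @[r --> within W (nbhs q)] -->
    q.1.2 * D (v1, v2) f (q.1.1, q.2).
  apply: cvgM; last by apply: cvg_W_U => //; exact: smooth_D.
  apply: cvg_within_filter.
  apply: (@cvg_comp _ _ _ fst snd (nbhs q) (nbhs q.1)).
    exact: (@cvg_fst _ _ (nbhs q.1) (nbhs q.2)).
  exact: (@cvg_snd _ _ (nbhs q.1.1) (nbhs q.1.2)).
apply: (cvg_near_eq h); near=> r.
have Wr : W r by near: r; exact: near_within_self.
have [df <-] := smooth_derive (v1, v2) sf (W_U Wr).
by rewrite derive_Gbar_scaled.
Unshelve. all: by end_near. Qed.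

Lemma D_cl_W_snd f v1 v2 q : smooth 1 U f -> closure W q ->
  closure U (q.1.1, q.2) ->
  D_cl W ((v1, 0), v2) (fun r : ('rV[R]_n * R) * E => f (r.1.1, r.2)) q = D (v1, v2) f (q.1.1, q.2).
Proof.
move=> sf cW Kq; have PF := within_nbhs_proper cW.
apply: (@cvg_lim R (@norm_hausdorff _ _)).
have h : D (v1, v2) f (r.1.1, r.2) @[r --> within W (nbhs q)] -->
    D (v1, v2) f (q.1.1, q.2).
  by apply: cvg_W_U => //; exact: smooth_D.
apply: (cvg_near_eq h); near=> r.
have Wr : W r by near: r; exact: near_within_self.
by have [df <-] := smooth_derive (v1, v2) sf (W_U Wr).
Unshelve. all: by end_near. Qed.

Lemma D_cl_W_x0 q : closure W q -> closure U (q.1.1, q.2) ->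
  D_cl W ((0, 1), 0) Gb q = G (q.1.1, q.2).
Proof.
move=> cW Kq; have PF := within_nbhs_proper cW.
apply: (@cvg_lim R (@norm_hausdorff _ _)).
have h : G (r.1.1, r.2) @[r --> within W (nbhs q)] --> G (q.1.1, q.2).
  by apply: cvg_W_U => //; split => //; exact: smooth_cont sG.
apply: (cvg_near_eq h); near=> r.
by rewrite derive_Gbar_x0.
Unshelve. all: by end_near. Qed.

(** [Gbar] is [G] times the coordinate [x0], which directions in [x] and [p] do not move; its value
    -1 gives the sign. *)
Lemma D2Gbar_lshift x p i k : X x -> P p ->
  D2Gbar X Y zl zu G X0 ((x, -1), p) (lshift 1 i) k =
    - D (ip (@ebar_ R n k)) (D (ix (e_ i)) G) (x, p).
Proof.
move=> Xx Pp; rewrite mxE.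
have -> : @ebar_ R n (lshift 1 i) = (e_ i, 0) by rewrite /ebar_ (unsplitK (inl i)).
have E1 r : W r -> D_cl W (e_ i, 0, 0) Gb r = r.1.2 * D (ix (e_ i)) G (r.1.1, r.2).
  move=> Wr; apply: D_cl_W_scaled; first by do 3!apply: smoothW.
    exact: subset_closure.
  exact/subset_closure/W_U.
rewrite (eq_D_cl _ _ _ E1); last exact: open_W.
rewrite D_cl_W_scaled ?mulN1r//.
- by do 2!apply: smoothW; exact: smooth_D.
- exact: closure_W.
- exact: inK.
Qed.

Lemma D2Gbar_rshift x p i k : X x -> P p ->
  D2Gbar X Y zl zu G X0 ((x, -1), p) (rshift n i) k =
    D (ip (@ebar_ R n k)) G (x, p).
Proof.
move=> Xx Pp; rewrite mxE.
have -> : @ebar_ R n (rshift n i) = (0, 1) by rewrite /ebar_ (unsplitK (inr i)).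
have E1 r : W r -> D_cl W ((0, 1), 0) Gb r = G (r.1.1, r.2).
  move=> Wr; apply: D_cl_W_x0; first exact: subset_closure.
  exact/subset_closure/W_U.
rewrite (eq_D_cl _ _ _ E1); last exact: open_W.
apply: D_cl_W_snd.
- by do 3!apply: smoothW.
- exact: closure_W.
- exact: inK.
Qed.

(** Up to the sign of its first [n] rows, [D2Gbar] at [x0 = -1] is the matrix of [dGx_G x p], the
    last row arising because the derivative of [Gbar] in [x0] is [G]. Full rank thus excludes a
    kernel. *)
Lemma dGx_G_inverse x p : nondegeneracy X Y zl zu G X0 -> X x -> P p ->
  exists M C, lin_inverse (dGx_G x p) M C.
Proof.
move=> [_ nd] Xx Pp; apply: lin_inverse_pair; first exact: dGx_G_lin.
move=> u u0; have := nd x p.1 p.2.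
rewrite -surjective_pairing => /(_ (inK Xx Pp)) /eqP rk.
have uA : D2Gbar X Y zl zu G X0 ((x, -1), p) \in unitmx by rewrite -row_free_unit.
suff : (row_of_pair u)^T = 0.
  move=> /(congr1 trmx); rewrite trmxK trmx0 => /(congr1 (@pair_of_row _ _)).
  by rewrite row_of_pairK (lin0 (@pair_of_row_lin _ _)).
rewrite -[LHS](mulKmx uA) [X in _ *m X](_ : _ = 0) ?mulmx0//.
apply/colP => i; rewrite !mxE -(splitK i); case: (fintype.split i) => j /=.
- under eq_bigr => k _ do rewrite D2Gbar_lshift// mxE mulNr mulrC.
  rewrite sumrN -(lin_ebar u (L := fun v => D (ip v) (D (ix (e_ j)) G) (x, p))).
    by have /(congr1 (fun v : E => v.1 ord0 j)) := u0; rewrite /= !mxE => ->; rewrite oppr0.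
  exact: (lin_ip (smooth_D _ sG) (inK Xx Pp)).
- under eq_bigr => k _ do rewrite D2Gbar_rshift// mxE mulrC.
  rewrite -(lin_ebar u (L := fun v => D (ip v) G (x, p))).
    by have /(congr1 (fun v : E => v.2)) := u0.
  exact: (lin_ip sG (inK Xx Pp)).
Qed.

End nondegenerate.

End model.

(** * Auxiliary facts on quotients, affine curves and lines *)

Lemma isD_quot (R : realType) (a b : R -> R) (a1 b1 : R) s : b s != 0 ->
  isD a s a1 -> isD b s b1 ->
  isD (fun r => (b r)^-1 * a r) s (- (b s) ^-2 * b1 * a s + (b s)^-1 * a1).
Proof. by move=> b0 ha hb; apply: isDM => //; exact: isDV. Qed.

(** In general only existence of the second derivative of [a / b] is wanted; where [a] and [a1]
    vanish, every term but [a2 / b] drops out. *)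
Lemma isD_quot2 (R : realType) (a b a1 b1 : R -> R) (a2 b2 : R) s :
  s \in `[0, 1] -> b s != 0 ->
  isD a s (a1 s) -> isD b s (b1 s) -> isD a1 s a2 -> isD b1 s b2 ->
  exists2 l, isD (fun r => - (b r) ^-2 * b1 r * a r + (b r)^-1 * a1 r) s l &
    a s = 0 -> a1 s = 0 -> l = (b s)^-1 * a2.
Proof.
move=> si b0 ha hb ha1 hb1.
have hV := isDV b0 hb.
have [c hc] : exists c : R, isD (fun r => - (b r) ^-2) s c.
  eexists; apply: isD_eq si _ (isDM (isD_cst (-1 : R) s) (isDM hV hV)) => r _.
  by rewrite mulN1r expr2 invfM.
have h := isDD (isDM (isDM hc hb1) ha) (isDM hV ha1).
exists (((c * b1 s + - (b s) ^-2 * b2) * a s + - (b s) ^-2 * b1 s * a1 s) +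
  (- (b s) ^-2 * b1 s * a1 s + (b s)^-1 * a2)); first exact: h.
by move=> -> ->; rewrite !mulr0 !add0r.
Qed.

Lemma lin_add (R : realType) (E W : lmodType R) (L L' : E -> W) :
  lin L -> lin L' -> lin (fun u => L u + L' u).
Proof. by move=> h h' a u v; rewrite h h' scalerDr addrACA. Qed.

Lemma opp_fst_row (R : realType) n (w : 'rV[R]_n * R) i :
  (- w).1 ord0 i = - (w.1 ord0 i).
Proof. by rewrite mxE. Qed.

Lemma isD_affine01 (R : realType) (V : normedModType R) (f : R -> V) s :
  s \in `[0, 1] -> affine01 f -> isD f s (f 1 - f 0).
Proof.
move=> si af; apply: isD_eq si _ (@isD_affine R V (f 0) (f 1 - f 0) s) => r ri.
by rewrite (af r ri) scalerBr scalerBl scale1r addrA addrAC.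
Qed.

Lemma affine01_second (R : realType) (V : normedModType R) (f f1 : R -> V) f2 s :
  affine01 f -> (forall s, s \in `[0, 1] -> isD f s (f1 s)) ->
  s \in `[0, 1] -> isD f1 s f2 -> f2 = 0.
Proof.
move=> af hf si hf1; apply: (isD_uniq si hf1).
apply: isD_eq si _ (isD_cst (f 1 - f 0) s) => r ri.
exact: isD_uniq ri (isD_affine01 ri af) (hf r ri).
Qed.

Lemma isD_D01_eq (R : realType) (V : normedModType R) (f g g1 : R -> V) l s :
  (forall r, r \in `[0, 1] -> f r = g r) ->
  (forall r, r \in `[0, 1] -> isD g r (g1 r)) -> s \in `[0, 1] ->
  isD g1 s l -> isD (D01 f) s l.
Proof.
move=> fg hg si; apply: isD_eq => // r ri; apply: esym.
exact: eq_D01 ri fg (hg r ri).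
Qed.

Lemma scale_rowE (R : realType) n (a : R) (f : 'I_n -> R) i :
  (a *: \row_j f j) ord0 i = a * f i.
Proof. by rewrite !mxE. Qed.

Lemma lin_pairE (R : realType) n (L : 'rV[R]_n * R -> R) v : lin (L : _ -> R^o) ->
  L v = \sum_i v.1 ord0 i * L (e_ i, 0) + v.2 * L (0, 1).
Proof.
move=> lL; rewrite (lin_ebar v lL) big_split_ord /= big_ord_recl big_ord0 addr0.
have -> : @ebar_ R n (rshift n ord0) = (0, 1) by rewrite /ebar_ (unsplitK (inr ord0)).
rewrite /row_of_pair row_mxEr mxE eqxx mulr1n; congr (_ + _).
apply: eq_bigr => i _; rewrite row_mxEl.
by have -> : @ebar_ R n (lshift 1 i) = (e_ i, 0) by rewrite /ebar_ (unsplitK (inl i)).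
Qed.

Lemma affine_sum (R : realType) n (m h0 h1 : 'rV[R]_n) (c r : R) :
  \sum_i m ord0 i * ((1 - r) *: h0 + r *: h1) ord0 i + c =
  (1 - r) * (\sum_i m ord0 i * h0 ord0 i + c) +
  r * (\sum_i m ord0 i * h1 ord0 i + c).
Proof.
rewrite !mulrDr !mulr_sumr addrACA -mulrDl subrK mul1r -big_split /=.
by congr (_ + _); apply: eq_bigr => i _; rewrite !mxE; ring.
Qed.

Lemma small_o_row (R : realType) (E : normedModType R) n (A : set E)
    (F L : E -> 'rV[R]_n) p :
  (forall i, small_o A (fun q => F q ord0 i) (fun v => L v ord0 i) p) ->
  small_o A F L p.
Proof.
move=> h e e0.
have /filter_forall : forall i : 'I_n, \forall q \near within A (nbhs p),
    `|F q ord0 i - F p ord0 i - L (q - p) ord0 i| <= e * `|q - p|.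
  by move=> i; exact: h.
apply: filterS => q hq; apply: norm_row_le => [|i].
  by rewrite mulr_ge0// ltW.
by rewrite !mxE; exact: hq.
Qed.

Lemma small_o_pair (R : realType) (E W W' : normedModType R) (A : set E)
    (F L : E -> W) (F' L' : E -> W') p :
  small_o A F L p -> small_o A F' L' p ->
  small_o A (fun q => (F q, F' q)) (fun v => (L v, L' v)) p.
Proof.
move=> h h' e e0; apply: filterS2 (h e e0) (h' e e0) => q a a'.
by rewrite prod_normE ge_max a a'.
Qed.

Section algebra.
Context {R : realType}.

Lemma sub_divfK (b b1 : R) : b != 0 -> b1 - b1 / b * b = 0.
Proof. by move=> b0; rewrite divfK// subrr. Qed.

Lemma quotient_rule_eq0 (b b1 a a1 : R) : b != 0 ->
  - b ^-2 * b1 * a + b^-1 * a1 = 0 -> a1 - b1 / b * a = 0.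
Proof.
move=> b0 e; have -> : a1 - b1 / b * a = b * (- b ^-2 * b1 * a + b^-1 * a1).
  by field.
by rewrite e mulr0.
Qed.

Lemma lin_subM (E : lmodType R) (f g : E -> R) (c : R) :
  lin (f : E -> R^o) -> lin (g : E -> R^o) -> lin (fun k => f k - c * g k : R^o).
Proof. by move=> lf lg t k k'; rewrite lf lg /GRing.scale /=; ring. Qed.

Lemma lin_comb (E : lmodType R) (f g : E -> R) (c d a : R) :
  lin (f : E -> R^o) -> lin (g : E -> R^o) ->
  lin (fun u => c * f u * a + d * g u : R^o).
Proof. by move=> lf lg t u v; rewrite lf lg /GRing.scale /=; ring. Qed.

End algebra.

Lemma isD_D01_line (R : realType) (V : normedModType R) (a w : V) s :
  s \in `[0, 1] -> isD (fun r => a + r *: w) s w /\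
    isD (D01 (fun r => a + r *: w)) s 0.
Proof.
move=> si; split; first exact: isD_affine.
apply: isD_eq si _ (isD_cst w s) => r ri.
exact/esym/(isD_D01 ri)/isD_affine.
Qed.

(** The velocity is shortened so that the whole parameter interval [0, 1] stays in [A]; the tensor
    is insensitive to the sign-preserving rescaling. *)
Lemma line_germ (R : realType) (V : normedModType R) (A : set V) (a v : V) :
  open A -> A a -> exists d : R, [/\ 0 < d,
    twice_derivable01 (fun s => a + s *: (d *: v)) &
    forall s, s \in `[0, 1] -> A (a + s *: (d *: v))].
Proof.
move=> oA Aa; have : nbhs a A by exact: open_nbhs_nbhs.
move=> /nbhs_ballP[r /= r0 hr].
have v1 : 0 < `|v| + 1 by rewrite ltr_wpDl.
(* Adding 1 covers [v = 0]; halving gives the strict inequality of an open ball. *)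
pose d := r / (`|v| + 1) / 2; have d0 : 0 < d by rewrite !divr_gt0.
have h : d * `|v| <= r / 2.
  have -> : d * `|v| = r / 2 * (`|v| / (`|v| + 1)) by rewrite /d; ring.
  apply: ler_piMr; first by rewrite divr_ge0// ltW.
  by rewrite ler_pdivrMr// mul1r lerDl.
exists d; split; first exact: d0.
  move=> s si; have [h1 h2] := isD_D01_line a (d *: v) si.
  by split; apply: isD_derivable01; [exact: h1|exact: h2].
clearbody d; move=> s; rewrite in_itv /= => /andP[s0 s1]; apply: hr.
rewrite -ball_normE /= opprD addrA subrr sub0r normrN !normrZ (ger0_norm s0).
rewrite gtr0_norm//.
have h2 : s * (d * `|v|) <= 1 * (r / 2).
  by apply: ler_pM => //; apply: mulr_ge0 => //; exact: ltW.
by apply: le_lt_trans h2 _; lra.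
Qed.

(** * The cross-curvature tensor *)

Local Opaque D_cl.

Section equivalence.
Context {R : realType} {n : nat}.
Variables (X Y : set 'rV[R]_n) (zl : R) (zu : \bar R).
Variable G : 'rV[R]_n * ('rV[R]_n * R) -> R.
Local Notation U := (XYZ X Y zl zu).
Local Notation P := (closure (YZ Y zl zu)).
Local Notation D v f := (D_cl U v f).
Local Notation V := ('rV[R]_n * ('rV[R]_n * R))%type.
Local Notation E := ('rV[R]_n * R)%type.
Local Notation B x p := (Gz X Y zl zu G x p).
Local Notation dGx_G := (dGx_G X Y zl zu G).
Local Notation GttGz := (GttGz X Y zl zu G).
Local Notation Gx_G := (Gx_G X Y zl zu G).
Local Notation Gy_Gz := (Gy_Gz X Y zl zu G).
Implicit Types (x u : 'rV[R]_n) (p v k : E).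

Hypothesis oX : open X.
Hypothesis oY : open Y.
Hypothesis sG : smooth 4 U G.
Hypothesis Gz_lt0 : forall x p, X x -> P p -> B x p < 0.
Hypothesis dGx_G_inv : forall x p, X x -> P p -> exists M C, lin_inverse (dGx_G x p) M C.

Let oU : open U := @open_U R n X Y zl zu oX oY.
Let uV : unif_lin V := @unif_lin_V R n.
Let sD (v : V) : smooth 3 U (D v G) := smooth_D v sG.
Let sDD (v w : V) : smooth 2 U (D w (D v G)) := smooth_D w (sD v).
Let Gz_neq0 x p : X x -> P p -> B x p != 0.
Proof. by move=> Xx Pp; rewrite lt_eqF// Gz_lt0. Qed.

Definition d2Gx_G x p (v : E) : E :=
  (\row_i D (ip v) (D (ip v) (D (ix (e_ i)) G)) (x, p), D (ip v) (D (ip v) G) (x, p)).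

Lemma d2Gx_G_row x p v i :
  (d2Gx_G x p v).1 ord0 i = D (ip v) (D (ip v) (D (ix (e_ i)) G)) (x, p).
Proof. exact: rowE. Qed.

(* The second-order equation satisfied at [p] by a curve with velocity [v] and
   acceleration [k] along which [Gx_G x] is affine. *)
Definition G_accel x p (v k : E) := dGx_G x p k = - d2Gx_G x p v.

(** [v] and [k] play the velocity and acceleration of a curve through [p]. They are free parameters
    here, so that [k] may be replaced by an acceleration that the given curve does not have. *)
Definition Gtt (v k : E) x p := D (ip v) (D (ip v) G) (x, p) + D (ip k) G (x, p).

Definition Gttx (v k : E) u x p :=
  D (ix u) (D (ip v) (D (ip v) G)) (x, p) + D (ix u) (D (ip k) G) (x, p).

Definition Gttxx (v k : E) u x p :=
  D (ix u) (D (ix u) (D (ip v) (D (ip v) G))) (x, p) +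
  D (ix u) (D (ix u) (D (ip k) G)) (x, p).

Lemma isD_Gtt (p : R -> E) x : twice_derivable01 p ->
  (forall t, t \in `[0, 1] -> P (p t)) -> X x -> forall t, t \in `[0, 1] ->
  isD (fun t => G (x, p t)) t (D01 (fun t => G (x, p t)) t) /\
  isD (D01 (fun t => G (x, p t))) t (Gtt (D01 p t) (D01 (D01 p) t) x (p t)).
Proof.
move=> dp Pp Xx.
have h1 t : t \in `[0, 1] ->
    isD (fun t => G (x, p t)) t (D (ip (D01 p t)) G (x, p t)).
  by move=> ti; apply: (isD_p sG) => //; exact: (dp t ti).1.
move=> t ti; split; first by rewrite (isD_D01 ti (h1 t ti)); exact: h1.
rewrite /Gtt addrC.
apply: (isD_eq ti _ (isD_p2 sG ti Xx Pp (dp t ti).1 (dp t ti).2)) => r ri.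
by rewrite (isD_D01 ri (h1 r ri)).
Qed.

Lemma GttGzE (x : R -> 'rV[R]_n) (p : R -> E) s t : twice_derivable01 p ->
  (forall t, t \in `[0, 1] -> P (p t)) -> X (x s) -> t \in `[0, 1] ->
  GttGz x p s t = (B (x s) (p t))^-1 * Gtt (D01 p t) (D01 (D01 p) t) (x s) (p t).
Proof.
move=> dp Pp Xx ti; rewrite /Defs.GttGz.
by rewrite (isD_D01 ti (isD_Gtt dp Pp Xx ti).2).
Qed.

Lemma isD_Gttx (x : R -> 'rV[R]_n) p v k s : twice_derivable01 x ->
  (forall s, s \in `[0, 1] -> X (x s)) -> P p -> s \in `[0, 1] ->
  isD (fun r => Gtt v k (x r) p) s (Gttx v k (D01 x s) (x s) p).
Proof.
move=> dx Xx Pp si; apply: isDD.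
  by apply: (isD_x (sDD _ _)) => //; exact: (dx s si).1.
by apply: (isD_x (sD _)) => //; exact: (dx s si).1.
Qed.

Lemma isD_Gttxx (x : R -> 'rV[R]_n) p v k s : twice_derivable01 x ->
  (forall s, s \in `[0, 1] -> X (x s)) -> P p -> s \in `[0, 1] ->
  isD (fun r => Gttx v k (D01 x r) (x r) p) s
    (Gttx v k (D01 (D01 x) s) (x s) p + Gttxx v k (D01 x s) (x s) p).
Proof.
move=> dx Xx Pp si; rewrite /Gttx /Gttxx addrACA; apply: isDD.
  by apply: (isD_x2 (sDD _ _)) => //; [exact: (dx s si).1|exact: (dx s si).2].
by apply: (isD_x2 (sD _)) => //; [exact: (dx s si).1|exact: (dx s si).2].
Qed.

Lemma G_accel_Gtt x p v k : G_accel x p v k -> Gtt v k x p = 0.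
Proof.
move=> hs; have h : D (ip k) G (x, p) = - D (ip v) (D (ip v) G) (x, p).
  exact: (congr1 snd hs).
by rewrite /Gtt h subrr.
Qed.

(** By linearity in [u] it is enough to treat basis vectors; there, after exchanging derivatives,
    the claim is one coordinate of [G_accel]. *)
Lemma G_accel_Gttx x p v k u : X x -> P p -> G_accel x p v k -> Gttx v k u x p = 0.
Proof.
move=> Xx Pp hs; have Kq := inK Xx Pp.
have lL : lin (fun u => Gttx v k u x p : R^o).
  exact: (lin_add (lin_ix (sDD _ _) Kq) (lin_ix (sD _) Kq)).
have -> : Gttx v k u x p = \sum_i u ord0 i * Gttx v k (e_ i) x p := lin_row u lL.
rewrite big1// => i _.
suff -> : Gttx v k (e_ i) x p = 0 by rewrite mulr0.
have h : D (ip k) (D (ix (e_ i)) G) (x, p) =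
    - D (ip v) (D (ip v) (D (ix (e_ i)) G)) (x, p).
  apply: etrans (esym (dGx_G_row X Y zl zu G x p k i)) _.
  apply: etrans (congr1 (fun w : E => w.1 ord0 i) hs) _.
  apply: etrans (opp_fst_row _ _) _; congr (- _); exact: d2Gx_G_row.
have e1 := D_cl_comm oU uV (ip v) (ix (e_ i)) (smoothW (sD (ip v))) Kq.
have e2 : D (ip v) (D (ix (e_ i)) (D (ip v) G)) (x, p) =
    D (ip v) (D (ip v) (D (ix (e_ i)) G)) (x, p).
  apply: (eq_D_cl oU) => q Uq; apply: (D_cl_comm oU uV); last exact: subset_closure.
  by do 2!apply: smoothW.
have e3 := D_cl_comm oU uV (ip k) (ix (e_ i)) (smoothW (smoothW sG)) Kq.
exact: etrans (congr2 +%R (etrans e1 e2) (etrans e3 h)) (subrr _).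
Qed.

Section along_curve.
Variables (x : R -> 'rV[R]_n) (p v k : E).
Hypotheses (dx : twice_derivable01 x) (Xx : forall s, s \in `[0, 1] -> X (x s)).
Hypothesis Pp : P p.

(** Two derivatives must exist at every [s] for the iterated [D01] to be meaningful, but a value is
    needed only where [G_accel] holds. There the numerator vanishes to first order, and the
    acceleration of [x] enters only through a vanishing [Gttx]. *)
Lemma isD_GttGz : exists f1 : R -> R,
  (forall s, s \in `[0, 1] ->
     isD (fun r => (B (x r) p)^-1 * Gtt v k (x r) p) s (f1 s)) /\
  (forall s, s \in `[0, 1] -> exists2 l, isD f1 s l &
     G_accel (x s) p v k -> f1 s = 0 /\ l = (B (x s) p)^-1 * Gttxx v k (D01 x s) (x s) p).
Proof.
pose b r := B (x r) p.
pose b1 r := D (ix (D01 x r)) (D (0, (0, 1)) G) (x r, p).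
have hb s : s \in `[0, 1] -> isD b s (b1 s).
  by move=> si; apply: (isD_x (sD _)) => //; exact: (dx si).1.
have hb1 s : s \in `[0, 1] -> exists b2, isD b1 s b2.
  move=> si; eexists.
  by apply: (isD_x2 (sD _)) => //; [exact: (dx si).1|exact: (dx si).2].
have b0 s : s \in `[0, 1] -> b s != 0 by move=> si; apply: Gz_neq0 => //; exact: Xx.
pose a r := Gtt v k (x r) p.
pose a1 r := Gttx v k (D01 x r) (x r) p.
have ha s : s \in `[0, 1] -> isD a s (a1 s) by exact: isD_Gttx.
have ha1 s : s \in `[0, 1] -> isD a1 s
    (Gttx v k (D01 (D01 x) s) (x s) p + Gttxx v k (D01 x s) (x s) p).
  exact: isD_Gttxx.
exists (fun r => - (b r) ^-2 * b1 r * a r + (b r)^-1 * a1 r); split=> s si.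
  exact: (isD_quot (b0 s si) (ha s si) (hb s si)).
have [b2 hb2] := hb1 s si.
have [l hl lE] := isD_quot2 si (b0 s si) (ha s si) (hb s si) (ha1 s si) hb2.
exists l => // hs.
have as0 : a s = 0 by exact: G_accel_Gtt.
have a1s0 : a1 s = 0 by apply: G_accel_Gttx => //; exact: Xx.
split; first by rewrite as0 a1s0 !mulr0 addr0.
have h0 : Gttx v k (D01 (D01 x) s) (x s) p = 0 by apply: G_accel_Gttx => //; exact: Xx.
apply: etrans (lE as0 a1s0) (congr1 (fun w => (b s)^-1 * w) _).
exact: etrans (congr1 (fun w => w + _) h0) (add0r _).
Qed.

End along_curve.

(* [Gttxx v k u x p / Gz x p] is the fourth-order cross derivative of (ii) and
   (iii); it depends on the two curves only through their velocities [u] and [v],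
   since [k] is determined by [v]. *)
Definition cross_curvature (A : set E) := forall x p, X x -> A p ->
  forall u v k, G_accel x p v k -> 0 <= Gttxx v k u x p.

Lemma G_accel_exists x p v : X x -> P p -> exists k, G_accel x p v k.
Proof.
move=> Xx Pp; have [M [C [_ _ ML _ _]]] := dGx_G_inv Xx Pp.
by exists (M (- d2Gx_G x p v)); exact: ML.
Qed.

Lemma dGx_G_inj x p v k : X x -> P p -> dGx_G x p v = dGx_G x p k -> v = k.
Proof.
by move=> Xx Pp; have [M [C h]] := dGx_G_inv Xx Pp; exact: (lin_inverse_inj h).
Qed.

Lemma isD_Gx_G x (p : R -> E) t v : X x -> t \in `[0, 1] ->
  (forall t, t \in `[0, 1] -> P (p t)) -> isD p t v ->
  isD (fun t => Gx_G x (p t)) t (dGx_G x (p t) v).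
Proof.
move=> Xx ti Pp hp; apply: isD_pair; last exact: (isD_p sG).
apply/isD_rowP => i.
have h : isD (fun t => D (ix (e_ i)) G (x, p t)) t
  (D (ip v) (D (ix (e_ i)) G) (x, p t)) := isD_p (sD _) ti Xx Pp hp.
rewrite [X in isD _ _ X](_ : _ = D (ip v) (D (ix (e_ i)) G) (x, p t)); last exact: rowE.
by apply: isD_eq ti _ h => r _; exact/esym/rowE.
Qed.

Lemma isD_dGx_G x (p v : R -> E) t k : X x -> t \in `[0, 1] ->
  (forall t, t \in `[0, 1] -> P (p t)) -> isD p t (v t) -> isD v t k ->
  isD (fun t => dGx_G x (p t) (v t)) t (dGx_G x (p t) k + d2Gx_G x (p t) (v t)).
Proof.
move=> Xx ti Pp hp hv; apply: isD_pair; last exact: (isD_p2 sG).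
apply/isD_rowP => i.
have h := isD_p2 (sD (ix (e_ i))) ti Xx Pp hp hv.
rewrite [X in isD _ _ X](_ : _ = D (ip k) (D (ix (e_ i)) G) (x, p t) +
  D (ip (v t)) (D (ip (v t)) (D (ix (e_ i)) G)) (x, p t)).
  by apply: isD_eq ti _ h => r _; exact/esym/rowE.
by apply: etrans (mxE _ _ _ _) _; congr (_ + _); exact: rowE.
Qed.

(** The second derivative of an affine curve is zero, and the chain rule computes it as the sum of
    the two sides' terms. *)
Lemma affine_G_accel x (p : R -> E) t : twice_derivable01 p -> X x ->
  (forall t, t \in `[0, 1] -> P (p t)) -> t \in `[0, 1] ->
  affine01 (fun t => Gx_G x (p t)) -> G_accel x (p t) (D01 p t) (D01 (D01 p) t).
Proof.
move=> dp Xx Pp ti aff; apply/eqP; rewrite -addr_eq0; apply/eqP.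
apply: (affine01_second aff _ ti (isD_dGx_G Xx ti Pp (dp t ti).1 (dp t ti).2)).
by move=> s si; apply: isD_Gx_G => //; exact: (dp s si).1.
Qed.

Section along_curves.
Variables (x : R -> 'rV[R]_n) (p : R -> E).
Hypotheses (dx : twice_derivable01 x) (Xx : forall s, s \in `[0, 1] -> X (x s)).
Hypotheses (dp : twice_derivable01 p) (Pp : forall t, t \in `[0, 1] -> P (p t)).
Variable t : R.
Hypothesis ti : t \in `[0, 1].

Let f s := GttGz x p s t.

Let fE s : s \in `[0, 1] ->
  f s = (B (x s) (p t))^-1 * Gtt (D01 p t) (D01 (D01 p) t) (x s) (p t).
Proof. by move=> si; apply: GttGzE => //; exact: Xx. Qed.

Lemma isD_GttGz_accel s : s \in `[0, 1] ->
  isD f s (D01 f s) /\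
  (G_accel (x s) (p t) (D01 p t) (D01 (D01 p) t) -> [/\ f s = 0, D01 f s = 0 &
   isD (D01 f) s ((B (x s) (p t))^-1 *
     Gttxx (D01 p t) (D01 (D01 p) t) (D01 x s) (x s) (p t))]).
Proof.
move=> si; have [f1 [hf1 hf2]] :=
  isD_GttGz (D01 p t) (D01 (D01 p) t) dx Xx (Pp ti).
have hf r : r \in `[0, 1] -> isD f r (f1 r).
  by move=> ri; apply: isD_eq ri _ (hf1 r ri) => q qi; rewrite fE.
rewrite (isD_D01 si (hf s si)); split; first exact: hf.
move=> hs; have [l hl /(_ hs) [f10 lE]] := hf2 s si; split => //.
  exact: etrans (fE si) (etrans (congr1 (fun w => (B (x s) (p t))^-1 * w)
    (G_accel_Gtt hs)) (mulr0 _)).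
by rewrite -lE; apply: isD_D01_eq hl.
Qed.

(** Division by [G_z] turns the coefficient of the [z]-component into the constant 1; the other
    coefficients are those of [Gy_Gz], affine along a dual segment. *)
Lemma lin_dual x' q v : X x' -> P q -> (B x' q)^-1 * D (ip v) G (x', q) =
  \sum_i v.1 ord0 i * Gy_Gz x' q ord0 i + v.2.
Proof.
move=> Xx' Pq; have Kq := inK Xx' Pq.
have lL : lin (fun w => (B x' q)^-1 * D (ip w) G (x', q) : R^o).
  move=> a w w'; have := lin_ip sG Kq a w w' => /(congr1 (fun z => (B x' q)^-1 * z)).
  move=> h; apply: etrans h _; rewrite mulrDr; congr (_ + _).
  by rewrite /GRing.scale /= mulrCA.
apply: etrans (lin_pairE v lL) _; congr (_ + _).
  apply: eq_bigr => i _; congr (_ * _); exact/esym/scale_rowE.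
apply: etrans (congr1 (fun w => v.2 * w) _) (mulr1 _).
by apply: mulVf; exact: Gz_neq0.
Qed.

Lemma isD_dual q v s : P q -> s \in `[0, 1] ->
  affine01 (fun r => Gy_Gz (x r) q) ->
  isD (fun r => (B (x r) q)^-1 * D (ip v) G (x r, q)) s
    ((B (x 1) q)^-1 * D (ip v) G (x 1, q) - (B (x 0) q)^-1 * D (ip v) G (x 0, q)).
Proof.
move=> Pq si aff; apply: isD_affine01 => // r ri.
have i0 : 0 \in `[0, 1 : R] by rewrite in_itv /= lexx ler01.
have i1 : 1 \in `[0, 1 : R] by rewrite in_itv /= lexx ler01.
apply: etrans (lin_dual v (Xx ri) Pq) _.
apply: etrans _ (congr2 (fun a b => (1 - r) * a + r * b)
  (esym (lin_dual v (Xx i0) Pq)) (esym (lin_dual v (Xx i1) Pq))).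
by rewrite (aff r ri); exact: affine_sum.
Qed.

(* Replacing the acceleration of [p] by the solution [k] of [G_accel] changes [f]
   by a combination of the coordinates of [Gy_Gz], which is affine in [s]. *)
Lemma dual_second_derivative s k : s \in `[0, 1] ->
  affine01 (fun r => Gy_Gz (x r) (p t)) -> G_accel (x s) (p t) (D01 p t) k ->
  isD (D01 f) s ((B (x s) (p t))^-1 * Gttxx (D01 p t) k (D01 x s) (x s) (p t)).
Proof.
move=> si aff hs; pose v := D01 p t; pose k' := D01 (D01 p) t.
have [f1 [hf1 hf2]] := isD_GttGz v k dx Xx (Pp ti).
have [l hl /(_ hs) [_ lE]] := hf2 s si.
set c := (B (x 1) (p t))^-1 * D (ip (k' - k)) G (x 1, p t)
  - (B (x 0) (p t))^-1 * D (ip (k' - k)) G (x 0, p t).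
pose g r := (B (x r) (p t))^-1 * Gtt v k (x r) (p t) +
  (B (x r) (p t))^-1 * D (ip (k' - k)) G (x r, p t).
have fg r : r \in `[0, 1] -> f r = g r.
  move=> ri; have hl' := linB k' k (lin_ip sG (inK (Xx ri) (Pp ti))).
  have alg (b w l1 l2 m : R) : m = l1 - l2 -> b * (w + l1) = b * (w + l2) + b * m.
    by move=> ->; ring.
  exact: etrans (fE ri) (alg _ _ _ _ _ hl').
have hg r : r \in `[0, 1] -> isD g r (f1 r + c).
  by move=> ri; apply: isDD; [exact: hf1|exact: isD_dual (Pp ti) ri aff].
rewrite -lE; apply: isD_D01_eq fg hg si _.
by rewrite -[l]addr0; apply: isDD => //; exact: isD_cst.
Qed.

End along_curves.

Lemma curvature_dual_segment : cross_curvature P ->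
  cross_diff_dual_segment X Y zl zu G.
Proof.
move=> A x0 x1 _ _ p0 p1 p [dp Pp _ _] x [dx Xx _ _] t0 t0i aff s si.
(* The acceleration is solved for at the current [x s], so [k] depends on [s] and each [s] is
   treated separately. *)
have [k hk] := G_accel_exists (D01 p t0) (Xx s si) (Pp t0 t0i).
rewrite (isD_D01 si (dual_second_derivative dx Xx dp Pp t0i si aff hk)).
rewrite mulr_le0_ge0//; last exact: (A _ _ (Xx s si) (Pp t0 t0i)).
by rewrite invr_le0 ltW// Gz_lt0//; [exact: Xx|exact: Pp].
Qed.

Lemma curvature_G_segment : cross_curvature P -> cross_diff_G_segment X Y zl zu G.
Proof.
move=> A x0 x1 x [dx Xx _ _] p0 p1 _ _ p [dp Pp _ _] s0 s0i aff t ti.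
have hs := affine_G_accel dp (Xx s0 s0i) Pp ti aff.
have [_ /(_ hs) [_ _ h]] := isD_GttGz_accel dx Xx dp Pp ti s0i.
rewrite (isD_D01 s0i h) mulr_le0_ge0//.
  by rewrite invr_le0 ltW// Gz_lt0//; [exact: Xx|exact: Pp].
exact: (A _ _ (Xx s0 s0i) (Pp t ti)).
Qed.

(** * Existence and regularity of G-segments *)

Hypothesis htwist : twist X Y zl zu G.
Hypothesis hconv : convex_range X Y zl zu G.

Lemma small_o_slice (m : nat) f x p : smooth m.+1 U f -> X x -> P p ->
  small_o P (fun q => f (x, q)) (fun v => D (ip v) f (x, p)) p.
Proof.
move=> sf Xx Pp e e0.
have hN : nbhs ((x, p) : V) [set q | closure U q ->
    `|f q - f (x, p) - D (q - (x, p)) f (x, p)| <= e * `|q - (x, p)|].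
  exact: (smooth_o sf (inK Xx Pp) e0).
have cx : (x, q) @[q --> p] --> (x, p).
  apply: (@cvg_pair _ _ _ (nbhs p) (nbhs x) (nbhs p) _ _ _ (fun=> x) id).
    exact: cvg_cst.
  exact: cvg_id.
have hN' : nbhs p [set q | closure U (x, q) ->
    `|f (x, q) - f (x, p) - D ((x, q) - (x, p)) f (x, p)| <= e * `|(x, q) - (x, p)|].
  exact: (cx _ hN).
have hN2 : nbhs p [set q | P q ->
    `|f (x, q) - f (x, p) - D (ip (q - p)) f (x, p)| <= e * `|q - p|].
  apply: filterS hN' => q hq Pq; have := hq (inK Xx Pq).
  have -> : (x, q) - (x, p) = ip (q - p) :> V by congr (_, _); rewrite /= subrr.
  move=> h; apply: le_trans h _; rewrite ler_pM2l// prod_normE ge_max /= normr0.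
  by rewrite normr_ge0 lexx.
exact: hN2.
Qed.

Lemma small_o_Gx_G x p : X x -> P p -> small_o P (Gx_G x) (dGx_G x p) p.
Proof.
move=> Xx Pp; apply: small_o_pair; last exact: (small_o_slice sG).
apply: small_o_row => i e e0.
apply: filterS (small_o_slice (sD (ix (e_ i))) Xx Pp e0) => q.
have E1 (q0 : E) : (\row_i D_cl U (e_ i, 0) G (x, q0)) ord0 i = D (ix (e_ i)) G (x, q0).
  exact: rowE.
have E2 : (\row_i D (ip (q - p)) (D (ix (e_ i)) G) (x, p)) ord0 i =
  D (ip (q - p)) (D (ix (e_ i)) G) (x, p) by exact: rowE.
move=> h; apply: le_trans h; rewrite le_eqVlt; apply/orP; left; apply/eqP.
exact: (congr1 Num.norm (congr2 (fun a b => a - b)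
  (congr2 (fun a b => a - b) (E1 q) (E1 p)) E2)).
Qed.

Lemma cvg_slice_p (m : nat) f x p T (F : set_system T) (FF : Filter F) (g : T -> E) :
  smooth m U f -> X x -> P p -> (\forall t \near F, P (g t)) ->
  g t @[t --> F] --> p -> f (x, g t) @[t --> F] --> f (x, p).
Proof.
move=> sf Xx Pp Pg hg A hA.
have hA' : nbhs ((x, p) : V) [set q | closure U q -> A (f q)].
  exact: (within_nbhs_cvg (smooth_cont sf) (inK Xx Pp) hA).
have cx : (x, g t) @[t --> F] --> (x, p).
  apply: (@cvg_pair _ _ _ F (nbhs x) (nbhs p) _ _ _ (fun=> x) g); last exact: hg.
  exact: cvg_cst.
have hA2 : F [set t | closure U (x, g t) -> A (f (x, g t))] by exact: (cx _ hA').
change (F [set t | A (f (x, g t))]).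
by apply: filterS2 hA2 Pg => t ht Pt; apply: ht; exact: inK.
Qed.

Lemma unif_cvg_dGx_G x p T (F : set_system T) (FF : Filter F) (g : T -> E) :
  X x -> P p -> (\forall t \near F, P (g t)) -> g t @[t --> F] --> p ->
  unif_cvg F (fun t => dGx_G x (g t)) (dGx_G x p).
Proof.
move=> Xx Pp Pg hg.
have ulin (m : nat) f : smooth m.+2 U f ->
    unif_cvg F (fun r v => D (ip v) f (x, g r)) (fun v => D (ip v) f (x, p)).
  move=> sf; apply: unif_cvg_lin.
  - exact: unif_lin_E.
  - by apply: filterS Pg => r Pr; exact: (lin_ip sf (inK Xx Pr)).
  - exact: (lin_ip sf (inK Xx Pp)).
  - by move=> w; exact: (cvg_slice_p FF (smooth_D (ip w) sf) Xx Pp Pg hg).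
apply: unif_cvg_pair; last exact: (ulin _ _ sG).
apply: unif_cvg_row => i e e0.
apply: filterS (ulin _ _ (sD (ix (e_ i))) e e0) => r h w; apply: le_trans (h w).
rewrite le_eqVlt; apply/orP; left; apply/eqP; congr Num.norm.
have E1 q : (\row_i D (ip w) (D (ix (e_ i)) G) (x, q)) ord0 i =
  D (ip w) (D (ix (e_ i)) G) (x, q) by exact: rowE.
exact: (congr2 (fun a b => a - b) (E1 (g r)) (E1 p)).
Qed.

(** A G-segment is only given pointwise by its image under [Gx_G x]. Its regularity is gained in
    three stages: continuity, first derivative by [isD_inverse], second derivative by
    [isD_implicit]. Boundary points are allowed. *)
Lemma G_segment_curve x p0 p1 g : X x -> P p0 -> P p1 ->
  G_segment X Y zl zu G x p0 p1 g ->
  [/\ twice_derivable01 g, (forall t, t \in `[0, 1] -> P (g t)),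
      affine01 (fun t => Gx_G x (g t)) &
      forall t, t \in `[0, 1] -> dGx_G x (g t) (D01 g t) = Gx_G x p1 - Gx_G x p0].
Proof.
move=> Xx Pp0 Pp1 hg.
have Pg t : t \in `[0, 1] -> P (g t) by move=> /hg[].
have i0 : 0 \in `[0, 1 : R] by rewrite in_itv /= lexx ler01.
have i1 : 1 \in `[0, 1 : R] by rewrite in_itv /= lexx ler01.
have F0 : Gx_G x (g 0) = Gx_G x p0.
  by have [_ ->] := hg 0 i0; rewrite subr0 scale1r scale0r addr0.
have F1 : Gx_G x (g 1) = Gx_G x p1.
  by have [_ ->] := hg 1 i1; rewrite subrr scale1r scale0r add0r.
have aff : affine01 (fun t => Gx_G x (g t)).
  by move=> t ti; have [_ h] := hg t ti; rewrite F0 F1.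
have dF t (ti : t \in `[0, 1]) := isD_affine01 ti aff.
(* The twist inverse is continuous on the range, and the image curve is affine. *)
have cg s : s \in `[0, 1] -> g r @[r --> nb01 s] --> g s.
  move=> si; have [_ [F' cF' F'K]] := htwist Xx.
  have RF t : t \in `[0, 1] -> (Gx_G x @` P) (Gx_G x (g t)).
    by move=> ti; exact: (ex_intro2 _ _ (g t) (Pg t ti) erefl).
  have h1 : F' w @[w --> within (Gx_G x @` P) (nbhs (Gx_G x (g s)))] --> g s.
    rewrite -[in X in _ --> X](F'K (g s) (Pg s si)).
    by move/subspace_continuousP : cF'; apply; exact: RF.
  have h2 : F' (Gx_G x (g r)) @[r --> nb01 s] --> g s.
    move=> A /h1 hA; have hA' : nbhs (Gx_G x (g s))
      [set w | (Gx_G x @` P) w -> A (F' w)] by exact: hA.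
    have h3 : nb01 s [set r | (Gx_G x @` P) (Gx_G x (g r)) -> A (F' (Gx_G x (g r)))].
      exact: (isD_cont (dF s si) hA').
    by apply: filterS2 h3 (near_nb01 s) => r hr [ri _]; apply: hr; exact: RF.
  apply: (cvg_near_eq h2); apply: filterS (near_nb01 s) => r [ri _].
  exact: (F'K (g r) (Pg r ri)).
have dg s : s \in `[0, 1] -> exists v, isD g s v.
  move=> si; have [M [C hM]] := dGx_G_inv Xx (Pg s si).
  exists (M (Gx_G x (g 1) - Gx_G x (g 0))).
  have hF : isD (fun r => Gx_G x (g r)) s
      (dGx_G x (g s) (M (Gx_G x (g 1) - Gx_G x (g 0)))).
    by have [_ _ -> _ _] := hM; exact: dF.
  exact: (isD_inverse (A := P) (dGx_G_lin sG Xx (Pg s si)) hM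
    (small_o_Gx_G Xx (Pg s si)) Pg (cg s si) hF).
have dg' s : s \in `[0, 1] -> isD g s (D01 g s).
  by move=> si; have [v hv] := dg s si; rewrite (isD_D01 si hv).
have dGg t : t \in `[0, 1] -> dGx_G x (g t) (D01 g t) = Gx_G x p1 - Gx_G x p0.
  move=> ti; rewrite -F0 -F1.
  exact: (isD_uniq ti (isD_Gx_G Xx ti Pg (dg' t ti)) (dF t ti)).
split; [|exact: Pg|exact: aff|exact: dGg].
move=> s si; split; first exact: dg'.
have [M [C hM]] := dGx_G_inv Xx (Pg s si).
have [k hk] := G_accel_exists (D01 g s) Xx (Pg s si).
apply: isD_derivable01.
(* With the velocity frozen at [s], differentiating [dGx_G] along [g] leaves the quadratic term,
   which [G_accel] expresses by the acceleration [k]. *)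
have hk' : isD (fun r => dGx_G x (g r) (D01 g s)) s (- dGx_G x (g s) k).
  have := isD_dGx_G Xx si Pg (v := fun _ => D01 g s) (dg' s si) (isD_cst _ s).
  by rewrite (lin0 (dGx_G_lin sG Xx (Pg s si))) add0r hk opprK.
have Pgn : \forall r \near nb01 s, P (g r).
  by apply: filterS (near_nb01 s) => r [ri _]; exact: Pg.
exact: (isD_implicit (L := fun r => dGx_G x (g r)) si hM
  (unif_cvg_dGx_G _ Xx (Pg s si) Pgn (cg s si)) (fun r ri => dGx_G_lin sG Xx (Pg r ri)) dGg hk').
Qed.

Lemma G_segment_exists x p0 p1 : X x -> P p0 -> P p1 ->
  exists2 g, G_segment X Y zl zu G x p0 p1 g & g 0 = p0.
Proof.
move=> Xx Pp0 Pp1; have [_ [F' _ F'K]] := htwist Xx.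
exists (fun t => F' ((1 - t) *: Gx_G x p0 + t *: Gx_G x p1)); last first.
  by rewrite subr0 scale1r scale0r addr0 F'K.
move=> t; rewrite in_itv /= => /andP[t0 t1].
have R0 : (Gx_G x @` P) (Gx_G x p0) by exists p0.
have R1 : (Gx_G x @` P) (Gx_G x p1) by exists p1.
have [q Pq <-] := convex_setP (hconv Xx) R0 R1 t0 t1.
by rewrite F'K.
Qed.

Lemma strict_diff_Gx_G x p : X x -> YZ Y zl zu p -> strict_diff (Gx_G x) (dGx_G x p) p.
Proof.
move=> Xx YZp.
have oYZ : open (YZ Y zl zu) by exact: open_YZ.
have sub : YZ Y zl zu `<=` P by exact: subset_closure.
have nA : nbhs p (YZ Y zl zu) by exact: open_nbhs_nbhs.
have str (m : nat) f : smooth m.+2 U f ->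
    strict_diff (fun q => f (x, q)) (fun v => D (ip v) f (x, p)) p.
  move=> sf; apply: (@MVT_strict_diff R E (YZ Y zl zu) (fun q => f (x, q))
    (fun v q => D (ip v) f (x, q))) => //.
  - exact: unif_lin_E.
  - by move=> q /sub Pq; exact: (lin_ip sf (inK Xx Pq)).
  - move=> v; have sDf := smooth_D (ip v) sf.
    have h := within_nbhs_cvg (smooth_cont sDf) (inK Xx (sub _ YZp)).
    have cx : (x, q) @[q --> p] --> (x, p).
      apply: (@cvg_pair _ _ _ (nbhs p) (nbhs x) (nbhs p) _ _ _ (fun=> x) id).
        exact: cvg_cst.
      exact: cvg_id.
    move=> A /h hA; have hA' : nbhs ((x, p) : V)
      [set q | closure U q -> A (D (ip v) f q)] by exact: hA.
    have hA2 : nbhs p [set q | closure U (x, q) -> A (D (ip v) f (x, q))].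
      exact: (cx _ hA').
    change (nbhs p [set q | A (D (ip v) f (x, q))]).
    by apply: filterS2 hA2 nA => q hq /sub Pq; apply: hq; exact: inK.
  - move=> c s l si cA hc; apply: (isD_p sf si Xx) => // r ri.
    exact/sub/cA.
apply: strict_diff_pair; last exact: (str _ _ sG).
apply: strict_diff_row => i e e0.
have [r r0 hr] := str _ _ (sD (ix (e_ i))) e e0.
exists r => // q q' hq hq'; apply: le_trans (hr q q' hq hq').
have E1 (q0 : E) : (\row_i D_cl U (e_ i, 0) G (x, q0)) ord0 i = D (ix (e_ i)) G (x, q0).
  exact: rowE.
have E2 : (\row_i D (ip (q - q')) (D (ix (e_ i)) G) (x, p)) ord0 i =
  D (ip (q - q')) (D (ix (e_ i)) G) (x, p) by exact: rowE.
rewrite le_eqVlt; apply/orP; left; apply/eqP.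
exact: (congr1 Num.norm (congr2 (fun a b => a - b)
  (congr2 (fun a b => a - b) (E1 q) (E1 q')) E2)).
Qed.

(** The endpoint [p1] is chosen so that the constant velocity of the image under [Gx_G x] is a
    multiple of [dGx_G x p v]; injectivity of [dGx_G x p] then gives the initial velocity. *)
Lemma G_segment_germ x p v : X x -> YZ Y zl zu p ->
  exists d p1 g, [/\ 0 < d, P p1, G_segment X Y zl zu G x p p1 g,
    g 0 = p & D01 g 0 = d *: v].
Proof.
move=> Xx YZp; have Pp : P p by exact: subset_closure.
have oYZ : open (YZ Y zl zu) by exact: open_YZ.
have i0 : 0 \in `[0, 1 : R] by rewrite in_itv /= lexx ler01.
have [M [C hM]] := dGx_G_inv Xx Pp.
have onto := strict_diff_onto_pair hM (strict_diff_Gx_G Xx YZp).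
have : nbhs p (YZ Y zl zu) by exact: open_nbhs_nbhs.
move=> /nbhs_ballP[r /= r0 hr].
have [d d0 hd] := onto (r / 2) (divr_gt0 r0 (ltr0n _ 2)).
(* This [c] keeps the target within the distance [d] on which [onto] applies, also when [w = 0]. *)
pose w := dGx_G x p v; pose c := d / (`|w| + 1).
have w1 : 0 < `|w| + 1 by rewrite ltr_wpDl.
have c0 : 0 < c by rewrite divr_gt0.
have [] := hd (Gx_G x p + c *: w).
  rewrite addrAC subrr add0r normrZ gtr0_norm// /c mulrAC ler_pdivrMr//.
  by rewrite ler_pM2l// lerDl.
move=> p1 hp1 F1.
have Pp1 : P p1.
  apply: subset_closure; apply: hr; rewrite -ball_normE /= distrC.
  by apply: le_lt_trans hp1 _; lra.
have [g hg g0] := G_segment_exists Xx Pp Pp1.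
exists c, p1, g; split; [exact: c0|exact: Pp1|exact: hg|exact: g0|].
have [_ Pg _ /(_ 0 i0)] := G_segment_curve Xx Pp Pp1 hg.
rewrite g0 F1 addrAC subrr add0r -(linZ c v (dGx_G_lin sG Xx Pp)).
exact: (dGx_G_inj Xx Pp).
Qed.

(** * Existence and regularity of dual segments *)

Hypothesis hdtwist : dual_twist X Y zl zu G.
Hypothesis hdconv : dual_convex_range X Y zl zu G.

Section fixed_p.
Variable p : E.
Hypothesis Pp : P p.

Local Notation Bz := (D ((0, (0, 1)) : V) G).
Local Notation A i := (D ((0, (e_ i, 0)) : V) G).

(** The quotient rule for the [i]-th coordinate of [Gy_Gz] in the direction [u] of [x]. *)
Definition dual_diff_coord x u i : R :=
  - (B x p) ^-2 * D (ix u) Bz (x, p) * A i (x, p) + (B x p)^-1 * D (ix u) (A i) (x, p).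

Definition dual_diff x u : 'rV[R]_n := \row_i dual_diff_coord x u i.

Lemma dual_coord x i : Gy_Gz x p ord0 i = (B x p)^-1 * A i (x, p).
Proof. exact: scale_rowE. Qed.

Lemma isD_dual_coord (x : R -> 'rV[R]_n) s u i :
  (forall r, r \in `[0, 1] -> X (x r)) -> s \in `[0, 1] -> isD x s u ->
  isD (fun r => Gy_Gz (x r) p ord0 i) s (dual_diff_coord (x s) u i).
Proof.
move=> Xx si hx.
have hA := isD_x (sD (0, (e_ i, 0))) si Xx Pp hx.
have hB := isD_x (sD (0, (0, 1))) si Xx Pp hx.
apply: isD_eq si _ (isD_quot (Gz_neq0 (Xx s si) Pp) hA hB) => r ri.
exact/esym/dual_coord.
Qed.

Lemma isD_dual_map (x : R -> 'rV[R]_n) s u :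
  (forall r, r \in `[0, 1] -> X (x r)) -> s \in `[0, 1] -> isD x s u ->
  isD (fun r => Gy_Gz (x r) p) s (dual_diff (x s) u).
Proof.
move=> Xx si hx; apply/isD_rowP => i.
rewrite [X in isD _ _ X](_ : _ = dual_diff_coord (x s) u i); last exact: rowE.
exact: isD_dual_coord.
Qed.

Lemma dual_diff_coord_lin x i : X x -> lin (fun u => dual_diff_coord x u i : R^o).
Proof.
move=> Xx; have Kq := inK Xx Pp.
exact: (lin_comb _ _ _ (lin_ix (sD _) Kq) (lin_ix (sD _) Kq)).
Qed.

Lemma dual_diff_lin x : X x -> lin (dual_diff x).
Proof. by move=> Xx; apply: lin_rowP => i; exact: dual_diff_coord_lin. Qed.

Lemma ip_ix_sum x u k : X x ->
  D (ix u) (D (ip k) G) (x, p) = \sum_i u ord0 i * (dGx_G x p k).1 ord0 i.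
Proof.
move=> Xx; have Kq := inK Xx Pp.
apply: etrans (lin_row u (lin_ix (sD (ip k)) Kq)) _.
apply: eq_bigr => i _; congr (_ * _).
apply: etrans (D_cl_comm oU uV _ _ (smoothW (smoothW sG)) Kq) _.
exact/esym/dGx_G_row.
Qed.

(* If the differential of [Gy_Gz] kills [u], then the mixed second differential
   of [G] at [u] is a multiple of that of [G] in [p], so that a nonzero row
   combination of the matrix of [dGx_G] would vanish. *)
Lemma dual_diff_inj x u : X x -> dual_diff x u = 0 -> u = 0.
Proof.
move=> Xx hu; have Kq := inK Xx Pp.
have b0 : B x p != 0 := Gz_neq0 Xx Pp.
(* The multiple is fixed by the [z]-direction: this [l] makes [L (0, 1)] vanish. *)
pose l := D (ix u) Bz (x, p) / B x p.
pose L k := D (ip k) (D (ix u) G) (x, p) - l * D (ip k) G (x, p).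
have comm k : D (ix u) (D (ip k) G) (x, p) = D (ip k) (D (ix u) G) (x, p).
  exact: (D_cl_comm oU uV _ _ (smoothW (smoothW sG)) Kq).
have lL : lin (L : E -> R^o).
  exact: (lin_subM l (lin_ip (sD (ix u)) Kq) (lin_ip sG Kq)).
have L0 k : L k = 0.
  rewrite (lin_pairE k lL) big1 => [|i _].
    have -> : L (0, 1) = 0.
      have h : D (ip (0, 1)) (D (ix u) G) (x, p) = D (ix u) Bz (x, p).
        exact/esym/comm.
      apply: etrans (congr1 (fun w => w - l * B x p) h) _.
      exact: sub_divfK.
    by rewrite mulr0 addr0.
  have -> : L (e_ i, 0) = 0; last by rewrite mulr0.
  have h : D (ip (e_ i, 0)) (D (ix u) G) (x, p) = D (ix u) (A i) (x, p).
    exact/esym/comm.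
  have hi : dual_diff_coord x u i = 0.
    have := congr1 (fun w : 'rV[R]_n => w ord0 i) hu.
    move=> h0; apply: etrans (esym (rowE (dual_diff_coord x u) i)) (etrans h0 _).
    by rewrite mxE.
  apply: etrans (congr1 (fun w => w - l * A i (x, p)) h) _.
  exact: (quotient_rule_eq0 b0 hi).
have [M [C [_ _ ML _ _]]] := dGx_G_inv Xx Pp.
(* For this [k] the identity [L k = 0] reads [u_j = 0]. *)
apply/rowP => j; rewrite [RHS]mxE; pose k := M (delta_mx 0 j, 0).
have hk : dGx_G x p k = (delta_mx 0 j, 0) by exact: ML.
have h1 : \sum_i u ord0 i * (dGx_G x p k).1 ord0 i - l * (dGx_G x p k).2 = 0.
  apply: etrans (L0 k); congr (_ - _).
  by rewrite -ip_ix_sum//; exact: comm.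
move: h1; rewrite hk /= mulr0 subr0 (bigD1 j)//= big1 => [|i ij].
  by rewrite mxE !eqxx mulr1 addr0.
by rewrite mxE eqxx /= (negbTE ij) mulr0.
Qed.

Lemma dual_diff_inverse x : X x -> exists M C, lin_inverse (dual_diff x) M C.
Proof.
move=> Xx; apply: lin_inverse_row; first exact: dual_diff_lin.
by move=> u; exact: dual_diff_inj.
Qed.

Lemma cvg_slice_x (m : nat) f x : smooth m U f -> X x ->
  f (a, p) @[a --> x] --> f (x, p).
Proof.
move=> sf Xx; have h := within_nbhs_cvg (smooth_cont sf) (inK Xx Pp).
have cx : (a, p) @[a --> x] --> (x, p).
  apply: (@cvg_pair _ _ _ (nbhs x) (nbhs x) (nbhs p) _ _ _ id (fun=> p)).
    exact: cvg_id.
  exact: cvg_cst.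
move=> S /h hS; have hS' : nbhs ((x, p) : V) [set q | closure U q -> S (f q)].
  by exact: hS.
have hS2 : nbhs x [set a | closure U (a, p) -> S (f (a, p))] by exact: (cx _ hS').
change (nbhs x [set a | S (f (a, p))]).
have nX : nbhs x X by exact: open_nbhs_nbhs.
by apply: filterS2 hS2 nX => a ha Xa; apply: ha; exact: inK.
Qed.

Lemma cvg_dual_diff x u i : X x ->
  dual_diff_coord a u i @[a --> x] --> dual_diff_coord x u i.
Proof.
move=> Xx.
have cB : B a p @[a --> x] --> B x p by exact: (cvg_slice_x (sD _)).
have cB' := cvg_slice_x (smooth_D (ix u) (sD (0, (0, 1)))) Xx.
have cA := cvg_slice_x (sD (0, (e_ i, 0))) Xx.
have cA' := cvg_slice_x (smooth_D (ix u) (sD (0, (e_ i, 0)))) Xx.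
have b0 := Gz_neq0 Xx Pp.
have b2 : B x p ^+ 2 != 0 by exact: expf_neq0.
have cB2 : B a p ^+ 2 @[a --> x] --> B x p ^+ 2 by exact: (cvgM cB cB).
have cV2 : - (B a p) ^-2 @[a --> x] --> - (B x p) ^-2.
  exact: (cvgN (cvgV b2 cB2)).
have cV : (B a p)^-1 @[a --> x] --> (B x p)^-1 by exact: (cvgV b0 cB).
exact: (cvgD (cvgM (cvgM cV2 cB') cA) (cvgM cV cA')).
Qed.

Lemma strict_diff_dual x : X x -> strict_diff (fun y => Gy_Gz y p) (dual_diff x) x.
Proof.
move=> Xx; apply: strict_diff_row => i e e0.
have nX : nbhs x X by exact: open_nbhs_nbhs.
have str : strict_diff (fun y => Gy_Gz y p ord0 i) (fun u => dual_diff_coord x u i) x.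
  apply: (@MVT_strict_diff R _ X (fun y => Gy_Gz y p ord0 i)
    (fun u y => dual_diff_coord y u i)).
  - exact: unif_lin_row.
  - exact: nX.
  - by move=> y; exact: dual_diff_coord_lin.
  - by move=> u; exact: cvg_dual_diff.
  - by move=> c s l si cX hc; exact: isD_dual_coord.
have [r r0 hr] := str e e0.
exists r => // a b ha hb; apply: le_trans (hr a b ha hb).
rewrite le_eqVlt; apply/orP; left; apply/eqP.
exact: (congr1 (fun w => `|_ - w|) (rowE (dual_diff_coord x (a - b)) i)).
Qed.

(** The convex dual range supplies the points and injectivity fixes the endpoints. The velocity
    equation is exported because [dual_segment_germ] reads the initial velocity from it. *)
Lemma dual_segment_exists x0 x1 : X x0 -> X x1 ->
  exists x : R -> 'rV[R]_n, [/\ curve X x0 x1 x, affine01 (fun s => Gy_Gz (x s) p) &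
    forall s, s \in `[0, 1] ->
      dual_diff (x s) (D01 x s) = Gy_Gz x1 p - Gy_Gz x0 p].
Proof.
move=> Xx0 Xx1.
have inj y z : X y -> X z -> Gy_Gz y p = Gy_Gz z p -> y = z.
  by move=> Xy Xz; apply: (hdtwist Pp); exact: mem_set.
have i0 : 0 \in `[0, 1 : R] by rewrite in_itv /= lexx ler01.
have i1 : 1 \in `[0, 1 : R] by rewrite in_itv /= lexx ler01.
have /boolp.choice [x hx] : forall s, exists y : 'rV[R]_n, s \in `[0, 1] ->
    X y /\ Gy_Gz y p = (1 - s) *: Gy_Gz x0 p + s *: Gy_Gz x1 p.
  move=> s.
  have [|ns] := boolP (s \in `[0, 1]); last by exists 0.
  rewrite in_itv /= => /andP[s0 s1].
  have R0 : ((fun y => Gy_Gz y p) @` X) (Gy_Gz x0 p) by exists x0.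
  have R1 : ((fun y => Gy_Gz y p) @` X) (Gy_Gz x1 p) by exists x1.
  have [y Xy hy] := convex_setP (hdconv Pp) R0 R1 s0 s1.
  by exists y => _; exact: (conj Xy hy).
have Xx s : s \in `[0, 1] -> X (x s) by move=> /hx[].
have e0 : x 0 = x0.
  apply: (inj _ _ (Xx 0 i0) Xx0).
  by have [_ ->] := hx 0 i0; rewrite subr0 scale1r scale0r addr0.
have e1 : x 1 = x1.
  apply: (inj _ _ (Xx 1 i1) Xx1).
  by have [_ ->] := hx 1 i1; rewrite subrr scale1r scale0r add0r.
have aff : affine01 (fun s => Gy_Gz (x s) p).
  by move=> s si; rewrite e0 e1; have [] := hx s si.
have dH s (si : s \in `[0, 1]) := isD_affine01 si aff.
(* Near [x s] some point of [X] has the same value of [Gy_Gz] as [x r]; by injectivity that point is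
   [x r]. *)
have cx s : s \in `[0, 1] -> x r @[r --> nb01 s] --> x s.
  move=> si; apply/cvgrPdist_le => e e_gt0.
  have [M [C hM]] := dual_diff_inverse (Xx s si).
  have onto := strict_diff_onto_row hM (strict_diff_dual (Xx s si)).
  have nX : nbhs (x s) X by exact: open_nbhs_nbhs (conj oX (Xx s si)).
  move/nbhs_ballP : nX => [r0 /= r00 hr0].
  have m0 : 0 < Num.min e (r0 / 2) by rewrite lt_min e_gt0 divr_gt0.
  have [d d0 hd] := onto _ m0.
  have := isD_cont (dH s si); move=> /cvgrPdist_le /(_ d d0) hN.
  apply: filterS2 hN (near_nb01 s) => r hr [ri _].
  have [|y] := hd (Gy_Gz (x r) p); first by rewrite distrC.
  rewrite le_min => /andP[y1 y2] hy.
  have Xy : X y.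
    by apply: hr0; rewrite -ball_normE /= distrC; apply: le_lt_trans y2 _; lra.
  by rewrite distrC -(inj y (x r) Xy (Xx r ri) hy).
have dx s : s \in `[0, 1] -> exists u, isD x s u.
  move=> si; have [M [C hM]] := dual_diff_inverse (Xx s si).
  exists (M (Gy_Gz (x 1) p - Gy_Gz (x 0) p)).
  have hF : isD (fun r => Gy_Gz (x r) p) s
      (dual_diff (x s) (M (Gy_Gz (x 1) p - Gy_Gz (x 0) p))).
    by have [_ _ -> _ _] := hM; exact: dH.
  exact: (isD_inverse (F := fun y => Gy_Gz y p) (A := X) (dual_diff_lin (Xx s si)) hM
    (strict_diff_small_o X (strict_diff_dual (Xx s si))) Xx (cx s si) hF).
have dx' s : s \in `[0, 1] -> isD x s (D01 x s).
  by move=> si; have [u hu] := dx s si; rewrite (isD_D01 si hu).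
have diffE s : s \in `[0, 1] ->
    dual_diff (x s) (D01 x s) = Gy_Gz x1 p - Gy_Gz x0 p.
  move=> si; rewrite -e0 -e1.
  exact: (isD_uniq si (isD_dual_map Xx si (dx' s si)) (dH s si)).
exists x; split; [split|exact: aff|exact: diffE]; [|exact: Xx|exact: e0|exact: e1].
move=> s si; split; first exact: dx'.
have [M [C hM]] := dual_diff_inverse (Xx s si); have [lM _ ML _ _] := hM.
have ucv : unif_cvg (nb01 s) (fun r => dual_diff (x r)) (dual_diff (x s)).
  apply: unif_cvg_row => i.
  have : unif_cvg (nb01 s) (fun r u => dual_diff_coord (x r) u i)
      (fun u => dual_diff_coord (x s) u i).
    apply: unif_cvg_lin.
    - exact: unif_lin_row.
    - by apply: filterS (near_nb01 s) => r [ri _]; exact: dual_diff_coord_lin (Xx r ri).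
    - exact: dual_diff_coord_lin (Xx s si).
    - move=> u; have h := cvg_dual_diff (u := u) (i := i) (Xx s si).
      exact: (@cvg_comp _ _ _ x (fun y => dual_diff_coord y u i) _ _ _ (cx s si) h).
  move=> h e e_gt0; apply: filterS (h e e_gt0) => r hr u; apply: le_trans (hr u).
  rewrite le_eqVlt; apply/orP; left; apply/eqP; congr Num.norm.
  exact: (congr2 (fun a b => a - b) (rowE (dual_diff_coord (x r) u) i)
    (rowE (dual_diff_coord (x s) u) i)).
have [c hc] : exists c, isD (fun r => dual_diff (x r) (D01 x s)) s c.
  have /boolp.choice [c hc] : forall i, exists c : R,
      isD (fun r => dual_diff_coord (x r) (D01 x s) i) s c.
    move=> i; have b0 := Gz_neq0 (Xx s si) Pp.
    have [l hl _] := isD_quot2 si b0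
      (a := fun r => A i (x r, p)) (a1 := fun r => D (ix (D01 x s)) (A i) (x r, p))
      (b := fun r => B (x r) p) (b1 := fun r => D (ix (D01 x s)) Bz (x r, p))
      (isD_x (sD _) si Xx Pp (dx' s si)) (isD_x (sD _) si Xx Pp (dx' s si))
      (isD_x (sDD _ _) si Xx Pp (dx' s si)) (isD_x (sDD _ _) si Xx Pp (dx' s si)).
    by exists l.
  exists (\row_i c i); apply/isD_rowP => i.
  rewrite [X in isD _ _ X](_ : _ = c i); last exact: rowE.
  apply: isD_eq si _ (hc i) => r ri.
  exact/esym/(rowE (dual_diff_coord (x r) (D01 x s))).
apply: isD_derivable01.
have hc' : isD (fun r => dual_diff (x r) (D01 x s)) s (- dual_diff (x s) (M (- c))).
  by rewrite ML opprK.
exact: (isD_implicit (L := fun r => dual_diff (x r)) si hM ucv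
  (fun r ri => dual_diff_lin (Xx r ri)) diffE hc').
Qed.

Lemma dual_segment_germ x0 u : X x0 ->
  exists d x1 (x : R -> 'rV[R]_n), [/\ 0 < d, curve X x0 x1 x, affine01 (fun s => Gy_Gz (x s) p) &
    D01 x 0 = d *: u].
Proof.
move=> Xx0; have i0 : 0 \in `[0, 1 : R] by rewrite in_itv /= lexx ler01.
have [M [C hM]] := dual_diff_inverse Xx0.
have onto := strict_diff_onto_row hM (strict_diff_dual Xx0).
have nX : nbhs x0 X by exact: open_nbhs_nbhs.
move/nbhs_ballP : nX => [r /= r0 hr].
have [d d0 hd] := onto (r / 2) (divr_gt0 r0 (ltr0n _ 2)).
pose w := dual_diff x0 u; pose c := d / (`|w| + 1).
have w1 : 0 < `|w| + 1 by rewrite ltr_wpDl.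
have c0 : 0 < c by rewrite divr_gt0.
have [] := hd (Gy_Gz x0 p + c *: w).
  rewrite addrAC subrr add0r normrZ gtr0_norm// /c mulrAC ler_pdivrMr//.
  by rewrite ler_pM2l// lerDl.
move=> x1 hx1 F1.
have Xx1 : X x1.
  apply: hr; rewrite -ball_normE /= distrC.
  by apply: le_lt_trans hx1 _; lra.
have [x [cx aff hD]] := dual_segment_exists Xx0 Xx1.
exists c, x1, x; split; [exact: c0|exact: cx|exact: aff|].
have := hD 0 i0; have [_ _ -> _] := cx.
rewrite F1 addrAC subrr add0r -(linZ c u (dual_diff_lin Xx0)).
exact: (lin_inverse_inj hM).
Qed.

End fixed_p.

(** * Homogeneity of the tensor and passage to the boundary *)

Lemma G_accel_scale x p v k (a : R) : X x -> P p -> G_accel x p v k ->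
  G_accel x p (a *: v) (a ^+ 2 *: k).
Proof.
move=> Xx Pp hs; have Kq := inK Xx Pp.
apply: etrans (linZ (a ^+ 2) k (dGx_G_lin sG Xx Pp)) _.
apply: etrans (congr1 (fun z => a ^+ 2 *: z) hs) _; rewrite scalerN; congr (- _).
have ipZ : ip (a *: v) = a *: ip v :> V by congr (_, _); rewrite /= scaler0.
have e2 : a ^+ 2 *: D (ip v) (D (ip v) G) (x, p) =
    D (ip (a *: v)) (D (ip (a *: v)) G) (x, p).
  rewrite ipZ.
  exact/esym/(D2_cl_dir_scale oU uV a (ip v) (smoothW (smoothW sG)) Kq).
have e1 : a ^+ 2 *: \row_i D (ip v) (D (ip v) (D (ix (e_ i)) G)) (x, p) =
    \row_i D (ip (a *: v)) (D (ip (a *: v)) (D (ix (e_ i)) G)) (x, p).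
  apply/rowP => i; apply: etrans (scale_rowE _ _ _) _; apply: etrans _ (esym (rowE _ _)).
  rewrite ipZ.
  exact/esym/(D2_cl_dir_scale oU uV a (ip v) (smoothW (sD (ix (e_ i)))) Kq).
exact: (congr2 pair e1 e2).
Qed.

Lemma Gttxx_scale x p u v k (a b : R) : X x -> P p ->
  Gttxx (a *: v) (a ^+ 2 *: k) (b *: u) x p = b ^+ 2 * (a ^+ 2 * Gttxx v k u x p).
Proof.
move=> Xx Pp; have Kq := inK Xx Pp.
have ipZ c w : ip (c *: w) = c *: ip w :> V by congr (_, _); rewrite /= scaler0.
have ixZ c w : ix (c *: w) = c *: ix w :> V by congr (_, _); rewrite /= scaler0.
have sub := @subset_closure _ U.
have h1 : D (ix u) (D (ix u) (D (ip (a *: v)) (D (ip (a *: v)) G))) (x, p) =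
    a ^+ 2 * D (ix u) (D (ix u) (D (ip v) (D (ip v) G))) (x, p).
  apply: (D2_cl_scale oU (ix u) (sDD (ip v) (ip v)) Kq) => q Uq; rewrite ipZ.
  exact: (D2_cl_dir_scale oU uV a (ip v) (smoothW (smoothW sG)) (sub _ Uq)).
have h2 : D (ix u) (D (ix u) (D (ip (a ^+ 2 *: k)) G)) (x, p) =
    a ^+ 2 * D (ix u) (D (ix u) (D (ip k) G)) (x, p).
  apply: (D2_cl_scale oU (ix u) (smoothW (sD (ip k))) Kq) => q Uq; rewrite ipZ.
  exact: (linZ _ _ (smooth_lin sG (sub _ Uq))).
have h3 (f : V -> R) : smooth 2 U f ->
    D (ix (b *: u)) (D (ix (b *: u)) f) (x, p) = b ^+ 2 * D (ix u) (D (ix u) f) (x, p).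
  by move=> sf; rewrite ixZ; exact: (D2_cl_dir_scale oU uV b (ix u) sf Kq).
have h4 := etrans (h3 _ (sDD (ip (a *: v)) (ip (a *: v)))) (congr1 (fun z => b ^+ 2 * z) h1).
have h5 := etrans (h3 _ (smoothW (sD (ip (a ^+ 2 *: k))))) (congr1 (fun z => b ^+ 2 * z) h2).
apply: etrans (congr2 +%R h4 h5) _.
by apply: etrans (esym (mulrDr _ _ _)) _; apply: congr1; exact/esym/mulrDr.
Qed.

(** The accelerations for [v] and [a *: v] are unique, hence differ by the factor [a ^+ 2]; the
    tensor is then multiplied by the positive number [b ^+ 2 * a ^+ 2]. *)
Lemma curvature_of_germs (A : set E) : A `<=` P ->
  (forall x p, X x -> A p -> forall u v, exists a b k, [/\ 0 < a, 0 < b,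
     G_accel x p (a *: v) k & 0 <= Gttxx (a *: v) k (b *: u) x p]) -> cross_curvature A.
Proof.
move=> AP h x p Xx Ap u v k hk; have Pp := AP _ Ap.
have [a [b [k' [a0 b0 hk' T0]]]] := h x p Xx Ap u v.
have kE : k' = a ^+ 2 *: k.
  apply: (dGx_G_inj Xx Pp).
  exact: etrans hk' (esym (G_accel_scale a Xx Pp hk)).
rewrite kE in T0.
have := le_trans T0 (eqbRL (lexx _) isT).
rewrite (Gttxx_scale u v k a b Xx Pp).
by rewrite !pmulr_rge0// exprn_gt0.
Qed.

(** The acceleration varies with the point, so it must be shown to converge: [v] is kept fixed, and
    the solution of [G_accel] at [q] tends to the one at [p] by [cvg_lin_inverse]. *)
Lemma curvature_closure : cross_curvature (YZ Y zl zu) -> cross_curvature P.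
Proof.
move=> cY x p Xx Pp u v k hk.
pose F := within (YZ Y zl zu) (nbhs p).
have PF : ProperFilter F := within_nbhs_proper Pp.
have FF : Filter F by exact: PF.
have sub : YZ Y zl zu `<=` P by exact: subset_closure.
have nYZ : \forall q \near F, YZ Y zl zu q by exact: near_within_self.
have nP : \forall q \near F, P (id q) by apply: filterS nYZ => q /sub.
have cid : id q @[q --> F] --> p by apply: cvg_within_filter; exact: cvg_id.
have /boolp.choice [kap hkap] : forall q, exists k, P q -> G_accel x q v k.
  move=> q; have [Pq|nPq] := pselect (P q); last first.
    by exists 0 => Pq; exact: (False_ind _ (nPq Pq)).
  have [k' hk'] := G_accel_exists v Xx Pq; exists k' => _; exact: hk'.
have slice (m : nat) f : smooth m U f -> f (x, q) @[q --> F] --> f (x, p).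
  by move=> sf; exact: (cvg_slice_p FF sf Xx Pp nP cid).
have cQ : d2Gx_G x q v @[q --> F] --> d2Gx_G x p v.
  have c2 := slice _ _ (sDD (ip v) (ip v)).
  have c1 : (d2Gx_G x q v).1 @[q --> F] --> (d2Gx_G x p v).1.
    apply/cvg_rowP => i.
    rewrite [X in _ --> X](_ : _ = D (ip v) (D (ip v) (D (ix (e_ i)) G)) (x, p));
      last exact: rowE.
    apply: (cvg_near_eq (slice _ _ (smooth_D (ip v) (smooth_D (ip v) (sD (ix (e_ i))))))).
    by apply: filterE => q; exact/esym/rowE.
  exact: (cvg_pair c1 c2).
have [M [C hM]] := dGx_G_inv Xx Pp.
have ckap : kap q @[q --> F] --> k.
  apply: (cvg_lin_inverse hM (unif_cvg_dGx_G FF Xx Pp nP cid)).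
    by apply: filterS nP => q Pq; exact: (dGx_G_lin sG Xx Pq).
  rewrite hk; apply: (cvg_near_eq (cvgN cQ)).
  by apply: filterS nP => q Pq; exact/esym/hkap.
(* Bringing the direction [w] outermost makes the expression a form in [w] to which [cvg_lin]
   applies with the moving argument [kap q]. *)
have swap q w : P q -> D (ix u) (D (ix u) (D (ip w) G)) (x, q) =
    D (ip w) (D (ix u) (D (ix u) G)) (x, q).
  move=> Pq; have Kq := inK Xx Pq.
  apply: etrans _ (D_cl_comm oU uV _ _ (smoothW (sD (ix u))) Kq).
  apply: (eq_D_cl oU) => r Ur.
  exact: (D_cl_comm oU uV _ _ (smoothW (smoothW sG)) (subset_closure Ur)).
have clin : D (ix u) (D (ix u) (D (ip (kap q)) G)) (x, q) @[q --> F] -->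
    D (ip k) (D (ix u) (D (ix u) G)) (x, p).
  have h : D (ip (kap q)) (D (ix u) (D (ix u) G)) (x, q) @[q --> F] -->
      D (ip k) (D (ix u) (D (ix u) G)) (x, p).
    apply: (@cvg_lin R E _ F FF (fun q w => D (ip w) (D (ix u) (D (ix u) G)) (x, q))
      (fun w => D (ip w) (D (ix u) (D (ix u) G)) (x, p)) kap k).
    - exact: unif_lin_E.
    - by apply: filterS nP => q Pq; exact: (lin_ip (sDD (ix u) (ix u)) (inK Xx Pq)).
    - exact: (lin_ip (sDD (ix u) (ix u)) (inK Xx Pp)).
    - by move=> w; exact: (slice _ _ (smooth_D (ip w) (sDD (ix u) (ix u)))).
    - exact: ckap.
  apply: (cvg_near_eq h); apply: filterS nP => q Pq; exact: (esym (swap q (kap q) Pq)).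
have c4 := slice _ _ (smooth_D (ix u) (smooth_D (ix u) (sDD (ip v) (ip v)))).
have cT : Gttxx v (kap q) u x q @[q --> F] -->
    D (ix u) (D (ix u) (D (ip v) (D (ip v) G))) (x, p) +
    D (ip k) (D (ix u) (D (ix u) G)) (x, p) by exact: (cvgD c4 clin).
have TE : Gttxx v k u x p = D (ix u) (D (ix u) (D (ip v) (D (ip v) G))) (x, p) +
    D (ip k) (D (ix u) (D (ix u) G)) (x, p).
  exact: (congr1 (fun z => _ + z) (swap p k Pp)).
rewrite TE leNgt; apply/negP => T0.
have h1 : \forall q \near F, Gttxx v (kap q) u x q < 0.
  by move: T0; apply: cvgr_lt cT _.
have [q [T1 Yq]] := filter_ex (filterI h1 nYZ).
have := cY x q Xx Yq u v (kap q) (hkap q (sub _ Yq)).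
by rewrite leNgt T1.
Qed.

(** * From each statement to the sign of the tensor, and back to convexity *)

Let i0 : 0 \in `[0, 1 : R]. Proof. by rewrite in_itv /= lexx ler01. Qed.
Let i1 : 1 \in `[0, 1 : R]. Proof. by rewrite in_itv /= lexx ler01. Qed.
Let subYZ : YZ Y zl zu `<=` P. Proof. exact: subset_closure. Qed.
Let oYZ : open (YZ Y zl zu). Proof. exact: open_YZ. Qed.

Lemma mulVle0_ge0 (b z : R) : b < 0 -> b^-1 * z <= 0 -> 0 <= z.
Proof. by move=> b0; rewrite nmulr_rle0// invr_lt0. Qed.

Lemma mulVge0_le0 (b z : R) : b < 0 -> 0 <= z -> b^-1 * z <= 0.
Proof. by move=> b0 z0; rewrite nmulr_rle0// invr_lt0. Qed.

(** The common part of (i) and (iii): the tensor is tested at [s = t = 0] only, along a straight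
    line in [X] and a G-segment issuing from [p]. *)
Lemma curvature_of_G_segments :
  (forall x x1 p p1 (xs : R -> 'rV[R]_n) g, X x -> P p -> P p1 ->
     twice_derivable01 xs -> (forall s, s \in `[0, 1] -> X (xs s)) -> xs 0 = x ->
     xs 1 = x1 -> G_segment X Y zl zu G x p p1 g -> g 0 = p ->
     D01 (D01 (fun s => GttGz xs g s 0)) 0 <= 0) ->
  cross_curvature P.
Proof.
move=> H; apply: curvature_closure; apply: curvature_of_germs => // x p Xx YZp u v.
have Pp := subYZ YZp.
have [b [b0 dx Xxs]] := line_germ u oX Xx.
have [a [p1 [g [a0 Pp1 hg g0 dg0]]]] :=
  G_segment_germ v Xx YZp.
have [dg Pg aff _] := G_segment_curve Xx Pp Pp1 hg.
pose xs s := x + s *: (b *: u).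
have {}dx : twice_derivable01 xs := dx.
have {}Xxs : forall s, s \in `[0, 1] -> X (xs s) := Xxs.
have x00 : xs 0 = x by rewrite /xs scale0r addr0.
have hs : G_accel (xs 0) (g 0) (D01 g 0) (D01 (D01 g) 0).
  by rewrite x00; exact: affine_G_accel.
have [_ /(_ hs) [_ _ h]] := isD_GttGz_accel dx Xxs dg Pg i0 i0.
have := H x (xs 1) p p1 xs g Xx Pp Pp1 dx Xxs x00 erefl hg g0.
rewrite (isD_D01 i0 h) => T0.
exists a, b, (D01 (D01 g) 0).
have dx0 : D01 xs 0 = b *: u := isD_D01 i0 (isD_D01_line x (b *: u) i0).1.
move: hs T0; rewrite x00 g0 dg0 dx0 => hs T0.
split; [exact: a0|exact: b0|exact: hs|].
exact: (mulVle0_ge0 (Gz_lt0 Xx Pp) T0).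
Qed.

Lemma curvature_of_convexity : convex_along_G_segments X Y zl zu G -> cross_curvature P.
Proof.
move=> H; apply: curvature_of_G_segments.
move=> x x1 p p1 xs g Xx Pp Pp1 dx Xxs x00 x11 hg g0.
have [dg Pg aff _] := G_segment_curve Xx Pp Pp1 hg.
have hs : G_accel (xs 0) (g 0) (D01 g 0) (D01 (D01 g) 0).
  by rewrite x00; exact: affine_G_accel.
have [_ /(_ hs) [f0 f10 h]] := isD_GttGz_accel dx Xxs dg Pg i0 i0.
rewrite (isD_D01 i0 h).
have hf s : s \in `[0, 1] ->
    isD (fun s => GttGz xs g s 0) s (D01 (fun s => GttGz xs g s 0) s).
  by move=> si; exact: (isD_GttGz_accel dx Xxs dg Pg i0 si).1.
apply: (second_derivative_max0 hf h f0 f10) => s si.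
apply: mulVge0_le0; first by apply: Gz_lt0; [exact: Xxs|exact: Pg].
have [_ h2] := isD_Gtt dg Pg (Xxs s si) i0; rewrite (isD_D01 i0 h2).
have h1 t : t \in `[0, 1] ->
    isD (fun t => G (xs s, g t)) t (D01 (fun t => G (xs s, g t)) t).
  by move=> ti; exact: (isD_Gtt dg Pg (Xxs s si) ti).1.
exact: (second_derivative_of_convex (H _ _ (Xxs s si) Xx p p1 Pp Pp1 g hg) h1 h2).
Qed.

Lemma curvature_of_G_segment : cross_diff_G_segment X Y zl zu G -> cross_curvature P.
Proof.
move=> H; apply: curvature_of_G_segments.
move=> x x1 p p1 xs g Xx Pp Pp1 dx Xxs x00 x11 hg g0.
have [dg Pg aff _] := G_segment_curve Xx Pp Pp1 hg.
have cx : curve X (xs 0) (xs 1) xs := And4 dx Xxs erefl erefl.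
have cg : curve P (g 0) (g 1) g := And4 dg Pg erefl erefl.
have aff' : affine01 (fun t => Gx_G (xs 0) (g t)) by rewrite x00.
exact: (H (xs 0) (xs 1) xs cx (g 0) (g 1) (Pg 0 i0) (Pg 1 i1) g cg 0 i0 aff' 0 i0).
Qed.

(** Here the line runs in [p] and the segment in [x]. The zero acceleration of the line need not
    solve [G_accel], but [dual_second_derivative] lets the solution [k] take its place. *)
Lemma curvature_of_dual_segment : cross_diff_dual_segment X Y zl zu G -> cross_curvature P.
Proof.
move=> H; apply: curvature_closure; apply: curvature_of_germs => // x p Xx YZp u v.
have Pp := subYZ YZp.
have [a [a0 dp YZps]] := line_germ v oYZ YZp.
have [b [x1 [xs [b0 cx aff dx0]]]] :=
  dual_segment_germ Pp u Xx.
have [dx Xxs x00 x11] := cx.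
pose ps t := p + t *: (a *: v).
have {}dp : twice_derivable01 ps := dp.
have p0 : ps 0 = p by rewrite /ps scale0r addr0.
have Pps t : t \in `[0, 1] -> P (ps t) by move=> ti; exact/subYZ/YZps.
have dp0 : D01 ps 0 = a *: v := isD_D01 i0 (isD_D01_line p (a *: v) i0).1.
have [k hk] := G_accel_exists (a *: v) Xx Pp.
have hk' : G_accel (xs 0) (ps 0) (D01 ps 0) k by rewrite x00 p0 dp0.
have aff' : affine01 (fun s => Gy_Gz (xs s) (ps 0)) by rewrite p0.
have h := dual_second_derivative dx Xxs dp Pps i0 i0 aff' hk'.
have cp : curve P (ps 0) (ps 1) ps := And4 dp Pps erefl erefl.
have Xx1 : X x1 by rewrite -x11; exact: Xxs.
have := H x x1 Xx Xx1 (ps 0) (ps 1) ps cp xs cx 0 i0 aff' 0 i0.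
rewrite (isD_D01 i0 h) x00 p0 dp0 dx0 => T0.
exists a, b, k; split; [exact: a0|exact: b0|exact: hk|].
exact: (mulVle0_ge0 (Gz_lt0 Xx Pp) T0).
Qed.

Lemma convexity_of_dual_segment : cross_diff_dual_segment X Y zl zu G ->
  convex_along_G_segments X Y zl zu G.
Proof.
move=> H x x0 Xx Xx0 p0 p1 Pp0 Pp1 g hg.
have [dg Pg aff _] := G_segment_curve Xx0 Pp0 Pp1 hg.
pose h t := Gtt (D01 g t) (D01 (D01 g) t) x (g t).
apply: (@convex_of_second_derivative R _ (D01 (fun t => G (x, g t))) h).
- by move=> t ti; exact: (isD_Gtt dg Pg Xx ti).1.
- by move=> t ti; exact: (isD_Gtt dg Pg Xx ti).2.
move=> t ti.
(* The dual segment at the point [g t] starts at the base point [x0] of the G-segment, where the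
   quotient and its derivative vanish, and ends at [x]. *)
have [xs [cx affx _]] :=
  dual_segment_exists (Pg t ti) Xx0 Xx.
have [dx Xxs x00 x11] := cx.
have hs : G_accel (xs 0) (g t) (D01 g t) (D01 (D01 g) t).
  by rewrite x00; exact: affine_G_accel.
have [_ /(_ hs) [f0 f10 _]] := isD_GttGz_accel dx Xxs dg Pg ti i0.
have cg : curve P (g 0) (g 1) g := And4 dg Pg erefl erefl.
have f1 : GttGz xs g 1 t <= 0.
  have h1 s : s \in `[0, 1] -> isD (fun s => GttGz xs g s t) s
      (D01 (fun s => GttGz xs g s t) s).
    by move=> si; exact: (isD_GttGz_accel dx Xxs dg Pg ti si).1.
  (* The hypothesis bounds the value of the iterated [D01]; its existence as a derivative comes from
     [dual_second_derivative]. *)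
  have h2 s : s \in `[0, 1] -> isD (D01 (fun s => GttGz xs g s t)) s
      (D01 (D01 (fun s => GttGz xs g s t)) s).
    move=> si; have [k hk] := G_accel_exists (D01 g t) (Xxs s si) (Pg t ti).
    have h2 := dual_second_derivative dx Xxs dg Pg ti si affx hk.
    by rewrite (isD_D01 si h2).
  exact: (second_derivative_le0 h1 h2 (H x0 x Xx0 Xx (g 0) (g 1) g cg xs cx t ti affx)
    f0 f10).
apply: (mulVle0_ge0 (Gz_lt0 Xx (Pg t ti))).
have E1 := GttGzE dg Pg (Xxs 1 i1) ti.
by move: f1; rewrite E1 x11; exact: id.
Qed.

End equivalence.

Theorem propositionA1 (R : realType) (n : nat) (X Y : set 'rV[R]_n)
    (zl : R) (zu : \bar R)
    (G pi : 'rV[R]_n * ('rV[R]_n * R) -> R) (p_out : 'rV[R]_n * R)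
    (a b : R) (ha : a < -1) (hb : -1 < b) (hb0 : b <= 0)
    (hG4 : C_cl 4 (XYZ X Y zl zu) G)
    (hreg : regularity X Y zl zu G)
    (htwist : twist X Y zl zu G)
    (hconv : convex_range X Y zl zu G)
    (hprice : price_monotonicity X Y zl zu G)
    (hout : outside_option X Y zl zu G pi p_out)
    (hnondeg : nondegeneracy X Y zl zu G `]a, b[)
    (hdtwist : dual_twist X Y zl zu G)
    (hdconv : dual_convex_range X Y zl zu G) :
  [<-> convex_along_G_segments X Y zl zu G;
       cross_diff_dual_segment X Y zl zu G;
       cross_diff_G_segment X Y zl zu G].
Proof.
have [[oX _] [oY _] _ _] := hreg.
have sG : smooth 4 (XYZ X Y zl zu) G.
  exact: (C_cl_smooth (@open_U R n X Y zl zu oX oY) hG4).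
have Gz_lt0 x p : X x -> closure (YZ Y zl zu) p -> Gz X Y zl zu G x p < 0.
  move=> Xx /P_prod[cY cZ]; rewrite (surjective_pairing p); exact: hprice.
have inv x p : X x -> closure (YZ Y zl zu) p ->
    exists M C, lin_inverse (dGx_G X Y zl zu G x p) M C.
  exact: (dGx_G_inverse oX oY sG ha hb hnondeg).
(* Each implication passes through [cross_curvature]; the last one goes on to (ii), from which
   convexity is integrated along dual segments. *)
tfae.
- move=> H; apply: (curvature_dual_segment oX oY sG Gz_lt0 inv).
  exact: (curvature_of_convexity oX oY sG Gz_lt0 inv htwist hconv H).
- move=> H; apply: (curvature_G_segment oX oY sG Gz_lt0).
  exact: (curvature_of_dual_segment oX oY sG Gz_lt0 inv hdtwist hdconv H).
- move=> H; apply: (convexity_of_dual_segment oX oY sG Gz_lt0 inv htwist hdtwist hdconv).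
  apply: (curvature_dual_segment oX oY sG Gz_lt0 inv).
  exact: (curvature_of_G_segment oX oY sG Gz_lt0 inv htwist hconv H).
Qed.
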